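(* Let $\{X_n, n\ge 1\}$ be a sequence of i.i.d. random variables with nondegenerate common distribution function $F$, $E(X_1)=0$ and $E(X_1^2)=1$. Let $M_n=\max(X_1,\dots,X_n)$, let $M_n^{(j)}$ be the $j$-th maximum of $\{X_1,\dots,X_n\}$, and let $S_n=\sum_{i=1}^nX_i$. Suppose that there exist constants $a_n>0$, $b_n\in\mathbb{R}$, $n\ge1$, and a nondegenerate distribution $G$ such that $$\lim_{n\to\infty}P(a_n(M_n-b_n)\le x)=G(x)\quad\text{for all } x\in\mathbb{R}.$$ Then for any $x,y\in\mathbb{R}$ and fixed $k\ge1$, $$\lim_{N\to\infty}\frac1{\log N}\sum_{n=1}^N\frac1n I\left(a_n(M_n^{(k)}-b_n)\le x,\ \frac{S_n}{\sqrt n}\le y\right)=G(x)\sum_{i=0}^{k-1}\frac{(-\ln G(x))^i}{i!}\,\Phi(y)\quad\text{a.s.},$$ and for any $x_1,\dots,x_k,y\in\mathbb{R}$ and fixed $k\ge1$, $$\lim_{N\to\infty}\frac1{\log N}\sum_{n=1}^N\frac1n I\left(a_n(M_n^{(1)}-b_n)\le x_1,\dots,a_n(M_n^{(k)}-b_n)\le x_k,\ \frac{S_n}{\sqrt n}\le y\right)=H(x_1,\dots,x_k)\,\Phi(y)\quad\text{a.s.},$$ where $H(x_1,\dots,x_k)$ is the joint limit distribution of $\big(a_n(M_n^{(1)}-b_n),\dots,a_n(M_n^{(k)}-b_n)\big)$.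
   Context: $\Phi$ is the standard normal distribution function and $I(\cdot)$ is the indicator function. The limit $G$ is necessarily of one of the three extreme value types (Gumbel, Fréchet, Weibull), hence continuous. $M_n^{(j)}$ is the $j$-th largest value among $X_1,\dots,X_n$ counted with multiplicity, so $M_n^{(1)}=M_n$; for $n<j$ one may set $M_n^{(j)}=-\infty$ (this affects only finitely many terms). The joint limit distribution is $$H(x_1,\dots,x_k)=\lim_{n\to\infty}P\big(a_n(M_n^{(1)}-b_n)\le x_1,\dots,a_n(M_n^{(k)}-b_n)\le x_k\big).$$ Conventions: the right-hand side of the first assertion is read as $0$ when $G(x)=0$, and $0^0=1$. *)

(* Defs.v *)
From HB Require Import structures.
From mathcomp Require Import all_boot all_order all_algebra.
From mathcomp Require Import all_classical all_reals all_analysis.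

Set Implicit Arguments.
Unset Strict Implicit.
Unset Printing Implicit Defensive.

Import Order.TTheory GRing.Theory Num.Theory.
Import numFieldNormedType.Exports.

Local Open Scope classical_set_scope.
Local Open Scope ring_scope.

Section Distributions.
Context {R : realType}.

Definition nondegenerate_df (F : R -> R) : Prop :=
  ~ exists c : R, forall x : R, F x = (c <= x)%R%:R.

Definition std_normal_cdf (y : R) : R :=
  fine (normal_prob (0 : R) (1 : R) `]-oo, y]).

End Distributions.

(* Random sequences are indexed from 0: [X i] stands for X_{i+1}, so that the
   sample X_1, ..., X_n is [X 0, ..., X n.-1]. *)
Section RandomSequences.
Context {d : measure_display} {T : measurableType d} {R : realType}.
Context {P : probability T R}.

Definition mutually_independent (X : nat -> {RV P >-> R}) : Prop :=
  forall (J : seq nat) (A : nat -> set R), uniq J ->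
    (forall i, i \in J -> measurable (A i)) ->
    P (\bigcap_(i in [set` J]) (X i @^-1` A i)) =
    (\prod_(i <- J) P (X i @^-1` A i))%E.

Definition iid_with_cdf (X : nat -> {RV P >-> R}) (F : R -> R) : Prop :=
  mutually_independent X /\ forall i x, cdf (X i) x = (F x)%:E.

Definition partial_sum (X : nat -> {RV P >-> R}) (n : nat) (w : T) : R :=
  \sum_(i < n) X i w.

Definition sample_max (X : nat -> {RV P >-> R}) (n : nat) (w : T) : \bar R :=
  (\big[maxe/-oo]_(i < n) (X i w)%:E)%E.

(* For j >= 1: entry number j (counted from 1) of the sample sorted in
   decreasing order, repetitions kept; -oo if n < j. *)
Definition order_max (X : nat -> {RV P >-> R}) (n j : nat) (w : T) : \bar R :=
  nth -oo%E (sort >=%O (mkseq (fun i => (X i w)%:E) n)) j.-1.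

(* a_n (m - b_n); as a_n > 0, the value m = -oo is sent to -oo. *)
Definition normalize (a b : nat -> R) (n : nat) (m : \bar R) : \bar R :=
  ((a n)%:E * (m - (b n)%:E))%E.

Definition joint_cdf (X : nat -> {RV P >-> R}) (a b : nat -> R) (k n : nat)
    (x : 'I_k -> R) : \bar R :=
  P [set w | forall j : 'I_k,
      (normalize a b n (order_max X n j.+1 w) <= (x j)%:E)%E].

End RandomSequences.

Definition log_average {R : realType} (u : nat -> R) (N : nat) : R :=
  (ln N%:R)^-1 * \sum_(1 <= n < N.+1) n%:R^-1 * u n.

(* Main.v *)
(* Joint convergence of the order statistics and S_n / sqrt n: the event on the
   order statistics says that, for each level, fewer than kap_j of the X_i exceed
   it; removing or adding one X_i changes this event only with probability O(1/n).
   After replacing the indicator of S_n / sqrt n <= y by a normal cdf of positive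
   variance, Lindeberg's replacement of one X_i at a time by a Gaussian therefore
   decouples the two factors in the limit.

   Almost sure averages: let xi_n be the product of the two (smoothed) factors.
   Discarding X_1, ..., X_m changes xi_n by O(sqrt (m / n)) in L^1 and leaves a
   variable independent of xi_m, so |cov (xi_m, xi_n)| = O(sqrt (m / n)). Hence the
   logarithmic average up to N has variance O(1 / ln N); Borel-Cantelli along
   N = 2^(i^2) and monotonicity give almost sure convergence. The smoothing is
   removed by sandwiching the indicator between shifted normal cdfs. *)
Require Import Defs.
From HB Require Import structures.
From mathcomp Require Import all_boot all_order all_algebra.
From mathcomp Require Import all_classical all_reals all_analysis.
From mathcomp Require Import measurable_realfun ring lra zify.
Set Implicit Arguments.
Unset Strict Implicit.
Unset Printing Implicit Defensive.
Import Order.TTheory GRing.Theory Num.Theory.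
Import numFieldNormedType.Exports.
Local Open Scope classical_set_scope.
Local Open Scope ring_scope.

(** * Smoothing the indicator of a half-line by the normal distribution *)

(** No Gaussian variable is constructed: [heat y s x] is the probability that [x] plus a centred
    Gaussian of variance [s] is at most [y], so exchanging a rescaled observation for a Gaussian of
    variance [1 / n] is the passage from [s] to [s + 1 / n]. The event on the order statistics
    depends on the exchanged observation, so the mean-zero term is split off with that observation
    removed from the event; the cost is small because [n] times the tail at a level stays bounded
    when [G] is positive there. Where [G] vanishes at some level, the event itself has probability
    tending to 0. That fact and the influence of early observations rest on one inequality uniform
    in the level: [p] times the probability of fewer than [k] successes in [n] trials is at most
    [k / (n + 1)]. That the joint limit [H] exists has to be proved as well: the counts of
    exceedances form a Markov chain whose law expands binomially into a number of terms independent
    of [n], and the probability of each nonempty exceedance pattern is a fixed linear combination of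
    one-level tails. *)

Section NormalCalculus.
Context {R : realType}.
Implicit Types x y z h t s : R.

Local Notation Phi := (@std_normal_cdf R).
Local Notation phi := (normal_pdf (0 : R) 1).

Lemma std_normal_pdfE x : phi x = normal_peak 1 * expR (- (x ^+ 2 / 2)).
Proof.
rewrite normal_pdfE ?oner_neq0// /normal_fun subr0 expr1n.
by congr (_ * expR _); rewrite mulNr.
Qed.

Lemma std_normal_peak_le1 : normal_peak (1 : R) <= 1.
Proof.
rewrite /normal_peak expr1n mul1r invf_le1 ?sqrtr_gt0; last first.
  by rewrite mulrn_wgt0// pi_gt0.
rewrite -{1}sqrtr1 ler_wsqrtr// -mulr_natr.
have := @pi_ge2 R; lra.
Qed.

Lemma is_derive_std_normal_cdf x : is_derive x 1 Phi (phi x).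
Proof.
have iphi : (@lebesgue_measure R).-integrable [set` Interval -oo%O (BRight (x + 1))]
    (EFin \o phi).
  by apply: (@integrableS _ _ _ _ setT) => //; exact: integrable_normal_pdf.
have xx1 : x < x + 1 by rewrite ltrDl.
have cphi : {for x, continuous phi}.
  exact: (@continuous_normal_pdf R 0 1 (oner_neq0 R) x).
have [dF F'] := @continuous_FTC1 R phi -oo%O x (x + 1) xx1 iphi (ltNyr _) cphi.
by apply: DeriveDef; [exact: dF|rewrite -F' derive1E].
Qed.

Lemma std_normal_cdf_ge0 x : 0 <= Phi x.
Proof. by rewrite /std_normal_cdf fine_ge0. Qed.

Lemma std_normal_cdf_le1 x : Phi x <= 1.
Proof.
rewrite /std_normal_cdf -lee_fin fineK ?fin_num_measure//.
exact: probability_le1.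
Qed.

Lemma is_derive_std_normal_pdf x : is_derive x 1 phi (- (x * phi x)).
Proof.
have -> : phi = normal_peak 1 \*: (expR \o (- (2^-1 \*: ((@id R) ^+ 2)))).
  apply/funext => t; rewrite std_normal_pdfE /= /GRing.scale/=.
  by congr (_ * expR (- _)); rewrite mulrC.
apply: is_derive_eq; rewrite /GRing.scale/= expr1 /GRing.scale/=.
by rewrite !fctE/= /GRing.scale/=; field.
Qed.

(** The density is at most [e], where [e * expR (x ^+ 2 / 2) = 1]; the lower bounds [1 + t] and
    [1 + t ^+ 2 / 2] for [expR t] at [t = x ^+ 2 / 2] produce the constants 2 and 8. *)
Lemma std_normal_pdf_bounds x :
  [/\ 0 <= phi x, phi x <= 1, x ^+ 2 * phi x <= 2 & x ^+ 4 * phi x <= 8].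
Proof.
have p0 : 0 <= normal_peak (1 : R) by exact: normal_peak_ge0.
have p1 := std_normal_peak_le1.
set e := expR (- (x ^+ 2 / 2)).
have e0 : 0 < e by exact: expR_gt0.
have x2 : 0 <= x ^+ 2 / 2 by rewrite divr_ge0 ?sqr_ge0.
have e1 : e * expR (x ^+ 2 / 2) = 1 by rewrite /e expRN mulVf ?gt_eqF ?expR_gt0.
have A := expR_ge1Dxn 0 x2; have B := expR_ge1Dxn 1 x2.
rewrite /= ?expr1 in A B.
have e_le1 : e <= 1 by rewrite -[leRHS]expR0 ler_expR; lra.
have Hp : phi x = normal_peak 1 * e by rewrite std_normal_pdfE.
have p_e : phi x <= e by rewrite Hp; nra.
have A' : x ^+ 2 * e <= 2.
  have : e * (1 + x ^+ 2 / 2 / 1`!%:R) <= 1 by rewrite -[leRHS]e1 ler_pM2l.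
  rewrite factS fact0 muln1 divr1; nra.
have B' : x ^+ 4 * e <= 8.
  have : e * (1 + (x ^+ 2 / 2) ^+ 2 / 2`!%:R) <= 1 by rewrite -[leRHS]e1 ler_pM2l.
  have -> : 2`!%:R = 2 :> R by [].
  have -> : x ^+ 4 = (x ^+ 2) ^+ 2 by rewrite -exprM.
  nra.
split=> //.
- exact: normal_pdf_ge0.
- exact: le_trans e_le1.
- by apply: le_trans A'; apply: ler_wpM2l => //; exact: sqr_ge0.
- apply: le_trans B'; apply: ler_wpM2l => //.
  by rewrite (_ : 4 = 2 * 2)%N// exprM sqr_ge0.
Qed.

(** The first three quantities are, up to sign, the derivatives of [Phi] of orders one to three; the
    last one appears when [heat] is differentiated twice in its variance. *)
Lemma std_normal_pdf_moments x :
  [/\ `|phi x| <= 1, `|x * phi x| <= 2, `|(1 - x ^+ 2) * phi x| <= 3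
   & `|x * ((1 - x ^+ 2) * phi x)| <= 7].
Proof.
have [a b c d] := std_normal_pdf_bounds x.
have x4 : x ^+ 4 = (x ^+ 2) ^+ 2 by rewrite -exprM.
split.
- by rewrite ger0_norm.
- rewrite ler_norml; apply/andP; split; nra.
- rewrite ler_norml; apply/andP; split; nra.
- have H : `|x * phi x| <= 2 by rewrite ler_norml; apply/andP; split; nra.
  have K : `|x ^+ 3 * phi x| <= 5.
    have : `|x ^+ 3 * phi x| = `|x| ^+ 3 * phi x by rewrite normrM normrX (ger0_norm a).
    move=> ->; have : 0 <= `|x| by []. have : `|x| ^+ 2 = x ^+ 2 by rewrite real_normK ?num_real.
    have -> : `|x| ^+ 3 = `|x| * `|x| ^+ 2 by rewrite exprS.
    move=> -> ?; rewrite -mulrA.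
    have := sqr_ge0 (`|x| - 1); rewrite sqrrB real_normK ?num_real// => ?.
    (* Since [2 |x| <= x ^+ 2 + 1], the odd power is controlled by the even ones:
       [(8 + 2) / 2 = 5]. *)
    have : `|x| * (x ^+ 2 * phi x) <= ((x ^+ 2 + 1) / 2) * (x ^+ 2 * phi x).
      apply: ler_wpM2r; first by rewrite mulr_ge0 ?sqr_ge0.
      lra.
    nra.
  have -> : x * ((1 - x ^+ 2) * phi x) = x * phi x - x ^+ 3 * phi x by ring.
  apply: le_trans (ler_normB _ _) _; lra.
Qed.

(** By the mean value theorem. Each application raises the order of vanishing at 0 by one, so Taylor
    remainders follow by iteration; the factor [1 / n.+1] of an exact integration is given up. The
    two conditions on [t] place it between 0 and [h] for either sign of [h], which also covers
    functions controlled on one side of 0 only, as for increments of the variance. *)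
Lemma derive_bound_expn (f df : R -> R) (C h : R) n :
  f 0 = 0 ->
  (forall t, 0 <= t * h -> `|t| <= `|h| -> is_derive t 1 f (df t)) ->
  (forall t, 0 <= t * h -> `|t| <= `|h| -> `|df t| <= C * `|t| ^+ n) ->
  `|f h| <= C * `|h| ^+ n.+1.
Proof.
move=> f0 fd fb.
have C0 : 0 <= C \/ h = 0.
  have [->|h0] := eqVneq h 0; [by right|left].
  have := fb h (sqr_ge0 h) (lexx _) => H.
  rewrite -(pmulr_lge0 _ (_ : 0 < `|h| ^+ n)); last by rewrite exprn_gt0// normr_gt0.
  exact: le_trans H.
have [->|h0] := eqVneq h 0; first by rewrite f0 !normr0 exprS mul0r mulr0.
have {}C0 : 0 <= C by case: C0 => // e; rewrite e eqxx in h0.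
have cont t : 0 <= t * h -> `|t| <= `|h| -> {for t, continuous f}.
  move=> t1 t2; have [D _] := fd t t1 t2.
  by apply/differentiable_continuous/derivable1_diffP.
suff [c [c1 c2 ->]] : exists c, [/\ 0 <= c * h, `|c| <= `|h| & f h = df c * h].
  rewrite normrM exprS mulrCA [leRHS]mulrC ler_wpM2r//.
  apply: le_trans (fb _ c1 c2) _.
  by rewrite ler_wpM2l// lerXn2r// nnegrE.
have [hp|hn|/eqP] := ltrgtP h 0; last by rewrite (negPf h0).
- have [t| |c] := @MVT R f df h 0 hp.
  + rewrite in_itv/= => /andP[c1 c2]; apply: fd; first nra.
    by rewrite !ltr0_norm//; lra.
  + apply: continuous_in_subspaceT => t; rewrite inE/= in_itv/= => /andP[c1 c2].
    apply: cont; first nra.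
    by rewrite (ltr0_norm hp) ler0_norm//; lra.
  + rewrite in_itv/= => /andP[c1 c2]; rewrite f0 => E.
    exists c; split; [nra|by rewrite !ltr0_norm//; lra|lra].
- have [t| |c] := @MVT R f df 0 h hn.
  + rewrite in_itv/= => /andP[c1 c2]; apply: fd; first nra.
    by rewrite !gtr0_norm//; lra.
  + apply: continuous_in_subspaceT => t; rewrite inE/= in_itv/= => /andP[c1 c2].
    apply: cont; first nra.
    by rewrite (gtr0_norm hn) ger0_norm//; lra.
  + rewrite in_itv/= => /andP[c1 c2]; rewrite f0 => E.
    exists c; split; [nra|by rewrite !gtr0_norm//; lra|lra].
Qed.

(** The cubic bound uses that the second derivative is Lipschitz, the quadratic one that it is
    bounded. Both are kept: with two moments only, large values of [h] can afford no more than a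
    square. *)
Lemma std_normal_cdf_taylor z h :
  `|Phi (z + h) - Phi z - phi z * h + z * phi z / 2 * h ^+ 2|
    <= 4 * Num.min (`|h| ^+ 3) (`|h| ^+ 2).
Proof.
pose r2 t := z * phi z - (z + t) * phi (z + t).
pose r1 t := phi (z + t) - phi z + z * phi z * t.
pose r0 t := Phi (z + t) - Phi z - phi z * t + z * phi z / 2 * t ^+ 2.
have dsh t : is_derive t 1 (fun t : R => z + t) 1.
  have -> : (fun t : R => z + t) = cst z + @id R by apply/funext.
  by apply: is_derive_eq; rewrite add0r.
have d0 t : is_derive t 1 r0 (r1 t).
  have -> : r0 = (Phi \o (fun t => z + t)) - cst (Phi z) - (phi z \*: (@id R))
                 + (z * phi z / 2) \*: ((@id R) ^+ 2).
    by apply/funext => u; rewrite /r0.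
  notypeclasses refine (is_derive_eq _ _).
    apply: is_deriveD; apply: is_deriveB; apply: is_deriveB.
    apply: is_derive1_comp; exact: is_derive_std_normal_cdf.
  by rewrite /r1 /GRing.scale/= expr1; field.
have d1 t : is_derive t 1 r1 (r2 t).
  have -> : r1 = (phi \o (fun t => z + t)) - cst (phi z) + ((z * phi z) \*: (@id R)).
    by apply/funext => u; rewrite /r1.
  notypeclasses refine (is_derive_eq _ _).
    apply: is_deriveD; apply: is_deriveB.
    apply: is_derive1_comp; exact: is_derive_std_normal_pdf.
  by rewrite /r2 /GRing.scale/=; field.
have d2 t : is_derive t 1 r2 (- ((1 - (z + t) ^+ 2) * phi (z + t))).
  have -> : r2 = cst (z * phi z) - ((fun t => z + t) * (phi \o (fun t => z + t))).
    by apply/funext => u; rewrite /r2.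
  notypeclasses refine (is_derive_eq _ _).
    apply: is_deriveB; apply: is_deriveM; apply: is_derive1_comp.
    exact: is_derive_std_normal_pdf.
  by rewrite /GRing.scale/=; field.
have r00 : r0 0 = 0 by rewrite /r0; rewrite addr0; ring.
have r10 : r1 0 = 0 by rewrite /r1; rewrite addr0; ring.
have r20 : r2 0 = 0 by rewrite /r2; rewrite addr0; ring.
have b2 t : `|r2 t| <= 4 * `|t| ^+ 1.
  apply: (@derive_bound_expn r2 (fun t => - ((1 - (z + t) ^+ 2) * phi (z + t)))) => // u _ _.
  rewrite normrN expr0 mulr1; have [_ _ + _] := std_normal_pdf_moments (z + u); lra.
have b2' t : `|r2 t| <= 4 * `|t| ^+ 0.
  rewrite expr0 mulr1 /r2; apply: le_trans (ler_normB _ _) _.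
  have [_ + _ _] := std_normal_pdf_moments (z + t).
  have [_ + _ _] := std_normal_pdf_moments z; lra.
have b1 t : `|r1 t| <= 4 * `|t| ^+ 2 by apply: derive_bound_expn => //.
have b1' t : `|r1 t| <= 4 * `|t| ^+ 1 by apply: derive_bound_expn => //.
have b0 : `|r0 h| <= 4 * `|h| ^+ 3 by apply: derive_bound_expn => //.
have b0' : `|r0 h| <= 4 * `|h| ^+ 2 by apply: derive_bound_expn => //.
by rewrite minr_pMr// le_min b0 b0'.
Qed.

Lemma std_normal_cdf_lipschitz x y : `|Phi x - Phi y| <= `|x - y|.
Proof.
have := @derive_bound_expn (fun t => Phi (y + t) - Phi y) (fun t => phi (y + t)) 1 (x - y) 0.
rewrite subrKC mul1r expr1; apply; first by rewrite addr0 subrr.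
- move=> t _ _.
  have -> : (fun t => Phi (y + t) - Phi y) = (Phi \o (fun t => y + t)) - cst (Phi y).
    by apply/funext.
  notypeclasses refine (is_derive_eq _ _).
    apply: is_deriveB; apply: is_derive1_comp; exact: is_derive_std_normal_cdf.
  by ring.
- by move=> t _ _; rewrite mul1r expr0; have [] := std_normal_pdf_moments (y + t).
Qed.

Lemma continuous_std_normal_cdf : continuous Phi.
Proof.
move=> x; have [D _] := is_derive_std_normal_cdf x.
by apply/differentiable_continuous/derivable1_diffP.
Qed.

Lemma cvg_std_normal_cdf_pinfty : Phi x @[x --> +oo%R] --> (1 : R).
Proof.
pose idTR : measurableTypeR R -> R := idfun.
pose X : {RV (normal_prob (0 : R) 1) >-> R} :=
  HB.pack idTR (@isMeasurableFun.Build _ _ _ _ idTR (@measurable_id _ _ setT)).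
have := @cvg_cdfy1 _ _ R (normal_prob 0 1) X.
by move/fine_cvg; apply: cvg_trans; apply: near_eq_cvg; near=> x.
Unshelve. all: by end_near. Qed.

Lemma cvg_std_normal_cdf_ninfty : Phi x @[x --> -oo%R] --> (0 : R).
Proof.
pose idTR : measurableTypeR R -> R := idfun.
pose X : {RV (normal_prob (0 : R) 1) >-> R} :=
  HB.pack idTR (@isMeasurableFun.Build _ _ _ _ idTR (@measurable_id _ _ setT)).
have := @cvg_cdfNy0 _ _ R (normal_prob 0 1) X.
by move/fine_cvg; apply: cvg_trans; apply: near_eq_cvg; near=> x.
Unshelve. all: by end_near. Qed.

End NormalCalculus.

(** * The smoothed indicator as a function of position and variance *)

Section HeatFlow.
Context {R : realType}.
Implicit Types x y z h t s : R.

Local Notation Phi := (@std_normal_cdf R).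
Local Notation phi := (normal_pdf (0 : R) 1).

Definition heat y s x := Phi ((y - x) / Num.sqrt s).

Lemma heat_ge0 y s x : 0 <= heat y s x.
Proof. exact: std_normal_cdf_ge0. Qed.

Lemma heat_le1 y s x : heat y s x <= 1.
Proof. exact: std_normal_cdf_le1. Qed.

Lemma heat_lipschitz y s x x' : 0 < s ->
  `|heat y s x - heat y s x'| <= (Num.sqrt s)^-1 * `|x - x'|.
Proof.
move=> s0; apply: le_trans (std_normal_cdf_lipschitz _ _) _.
rewrite -mulrBl normrM mulrC ger0_norm ?invr_ge0 ?sqrtr_ge0//.
by rewrite opprB addrC addrA subrK distrC.
Qed.

Lemma continuous_heat y s : continuous (heat y s).
Proof.
move=> x; apply: (@continuous_comp _ _ _ (fun x => (y - x) / Num.sqrt s) Phi).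
  by apply: cvgMr_tmp; apply: cvgB; [exact: cvg_cst|exact: cvg_id].
exact: continuous_std_normal_cdf.
Qed.

(** A second-order expansion in the variance. The second derivative [r2] is made of the products
    bounded by 7 and 2 above, hence is at most [(7 / 4 + 1) / s0 ^+ 2]; the 4 is a rounding. *)
Lemma heat_time_taylor (c s0 s dl : R) : 0 < s0 -> s0 <= s -> 0 <= dl ->
  `|Phi (c / Num.sqrt (s + dl)) - Phi (c / Num.sqrt s)
    + (c / Num.sqrt s) * phi (c / Num.sqrt s) / (2 * s) * dl|
  <= 4 / s0 ^+ 2 * dl ^+ 2.
Proof.
move=> s00 s0s dl0; have sp : 0 < s by exact: lt_le_trans s0s.
pose Z t := c / Num.sqrt (s + t).
pose k := (c / Num.sqrt s) * phi (c / Num.sqrt s) / (2 * s).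
pose r0 t := Phi (Z t) - Phi (c / Num.sqrt s) + k * t.
pose r1 t := k - Z t * phi (Z t) / (2 * (s + t)).
pose r2 t := (1 - Z t ^+ 2) * phi (Z t) * Z t / (4 * (s + t) ^+ 2)
             + Z t * phi (Z t) / (2 * (s + t) ^+ 2).
have tge0 t : 0 <= t * dl -> `|t| <= `|dl| -> 0 <= t.
  move=> t1 t2; have [dl00|dl00] := eqVneq dl 0.
    by move: t2; rewrite dl00 normr0 normr_le0 => /eqP ->.
  by rewrite -(@pmulr_lge0 _ dl)// lt_neqAle eq_sym dl00.
have dsh t : is_derive t 1 (fun t : R => s + t) 1.
  have -> : (fun t : R => s + t) = cst s + @id R by apply/funext.
  by apply: is_derive_eq; rewrite add0r.
have dZ t : 0 <= t -> is_derive t 1 Z (- (Z t / (2 * (s + t)))).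
  move=> t0; have st : 0 < s + t by rewrite ltr_wpDr.
  have q0 : Num.sqrt (s + t) != 0 by rewrite gt_eqF ?sqrtr_gt0.
  have -> : Z = c \*: (fun t => (Num.sqrt (s + t))^-1) by apply/funext.
  notypeclasses refine (is_derive_eq _ _).
    apply: is_deriveZ; apply: is_deriveV => //.
    apply: (is_derive1_comp (f := Num.sqrt) (g := fun t => s + t)).
    exact: is_derive1_sqrt.
  rewrite /= /GRing.scale/= -[X in _ = - (_ / (2 * X))](sqr_sqrtr (ltW st)).
  rewrite /GRing.scale/=.
  by field.
have dphiZ t : 0 <= t ->
    is_derive t 1 (fun t => Z t * phi (Z t))
      (- ((1 - Z t ^+ 2) * phi (Z t) * Z t / (2 * (s + t)))).
  move=> t0; have st : 0 < s + t by rewrite ltr_wpDr.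
  have -> : (fun t => Z t * phi (Z t)) = Z * (phi \o Z) by apply/funext.
  notypeclasses refine (is_derive_eq _ _).
    apply: is_deriveM; first exact: dZ.
    apply: is_derive1_comp; last exact: dZ.
    exact: is_derive_std_normal_pdf.
  by rewrite /GRing.scale/=; field; rewrite gt_eqF.
have d0 t : 0 <= t -> is_derive t 1 r0 (r1 t).
  move=> t0; have st : 0 < s + t by rewrite ltr_wpDr.
  have -> : r0 = (Phi \o Z) - cst (Phi (c / Num.sqrt s)) + (k \*: (@id R)).
    by apply/funext.
  notypeclasses refine (is_derive_eq _ _).
    apply: is_deriveD; apply: is_deriveB; apply: is_derive1_comp; last exact: dZ.
    exact: is_derive_std_normal_cdf.
  by rewrite /r1 /GRing.scale/=; field; rewrite gt_eqF.
have d1 t : 0 <= t -> is_derive t 1 r1 (r2 t).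
  move=> t0; have st : 0 < s + t by rewrite ltr_wpDr.
  have -> : r1 = cst k - (fun t => Z t * phi (Z t)) * (fun t => (2 * (s + t))^-1).
    by apply/funext.
  notypeclasses refine (is_derive_eq _ _).
    apply: is_deriveB; apply: is_deriveM; first exact: dphiZ.
    apply: is_deriveV; first by rewrite gt_eqF// mulr_gt0.
  by rewrite /r2 /= /GRing.scale/= /GRing.scale/=; field; rewrite gt_eqF.
have r00 : r0 0 = 0 by rewrite /r0 /Z addr0; ring.
have r10 : r1 0 = 0 by rewrite /r1 /Z addr0; apply/eqP; rewrite subr_eq0.
have b2 t : 0 <= t -> `|r2 t| <= 4 / s0 ^+ 2 * `|t| ^+ 0.
  move=> t0; have st : s0 <= s + t by rewrite ler_wpDr.
  have st0 : 0 < s + t by exact: lt_le_trans st.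
  rewrite expr0 mulr1 /r2; apply: le_trans (ler_normD _ _) _.
  have [_ H2 _ H4] := std_normal_pdf_moments (Z t).
  have i0 : 0 <= (s + t) ^- 2 by rewrite invr_ge0 exprn_ge0// ltW.
  have i1 : (s + t) ^- 2 <= s0 ^- 2.
    by rewrite lef_pV2 ?posrE ?exprn_gt0// lerXn2r// nnegrE ltW.
  have -> : (1 - Z t ^+ 2) * phi (Z t) * Z t / (4 * (s + t) ^+ 2) =
    (Z t * ((1 - Z t ^+ 2) * phi (Z t))) * ((s + t) ^- 2) / 4.
    by field; rewrite gt_eqF.
  have -> : Z t * phi (Z t) / (2 * (s + t) ^+ 2) =
     (Z t * phi (Z t)) * ((s + t) ^- 2) / 2.
    by field; rewrite gt_eqF.
  rewrite !(normrM _ (_^-1)) (ger0_norm i0) !(@ger0_norm _ (_^-1)) ?invr_ge0//.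
  nra.
have := @derive_bound_expn _ r0 r1 (4 / s0 ^+ 2) dl 1.
rewrite (ger0_norm dl0); apply; first exact: r00.
- by move=> t t1 t2; apply: d0; apply: tge0 => //; rewrite (ger0_norm dl0).
- move=> t t1 t2; have t0 : 0 <= t by apply: tge0 => //; rewrite (ger0_norm dl0).
  apply: (@derive_bound_expn _ r1 r2 _ t 0 r10) => u u1 u2.
    apply: d1; have [t00|t00] := eqVneq t 0.
      by move: u2; rewrite t00 normr0 normr_le0 => /eqP ->.
    by rewrite -(@pmulr_lge0 _ t)// lt_neqAle eq_sym t00.
  apply: b2; have [t00|t00] := eqVneq t 0.
    by move: u2; rewrite t00 normr0 normr_le0 => /eqP ->.
  by rewrite -(@pmulr_lge0 _ t)// lt_neqAle eq_sym t00.
Qed.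

(* [heat] solves [d/ds = (1/2) d^2/dx^2], so the time step [dl] compensates
   the quadratic space term when [h] has variance [dl]. *)
Lemma heat_expansion y s0 : 0 < s0 ->
  exists (C : R) (A B : R -> R -> R), 0 <= C /\
    forall s, s0 <= s ->
    [/\ continuous (A s), continuous (B s),
        forall x, `|A s x| <= C, forall x, `|B s x| <= C &
        forall x h dl : R, 0 <= dl ->
        `|heat y s (x + h) - heat y (s + dl) x - (A s x * h + B s x * (h ^+ 2 - dl))|
        <= C * (Num.min (`|h| ^+ 3) (`|h| ^+ 2) + dl ^+ 2)].
Proof.
move=> s00.
pose q s := (Num.sqrt s)^-1.
pose A s x := - (phi ((y - x) * q s) * q s).
pose B s x := - ((y - x) * q s * phi ((y - x) * q s) * (q s ^+ 2 / 2)).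
have q00 : 0 < q s0 by rewrite invr_gt0 sqrtr_gt0.
(* The summands serve, in order, the bound on [A], the bound on [B], the cubic and quadratic space
   remainders, and the time remainder [4 / s0 ^+ 2]. *)
pose C := q s0 + q s0 ^+ 2 + 4 * q s0 ^+ 3 + 4 * q s0 ^+ 2 + 4 * q s0 ^+ 4.
have Cparts : [/\ q s0 <= C, q s0 ^+ 2 <= C, 4 * q s0 ^+ 3 + 4 * q s0 ^+ 2 <= C
    & 4 * q s0 ^+ 4 <= C].
  have := exprn_gt0 2 q00; have := exprn_gt0 3 q00; have := exprn_gt0 4 q00.
  by move=> *; split; rewrite /C; lra.
have [C1 C2 C3 C4] := Cparts.
exists C, A, B; split; first exact: le_trans (ltW q00) C1.
move=> s s0s; have sp : 0 < s by exact: lt_le_trans s0s.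
have qs : 0 < q s by rewrite invr_gt0 sqrtr_gt0.
have qq : q s <= q s0 by rewrite lef_pV2 ?posrE ?sqrtr_gt0// ler_wsqrtr.
have qXn n : q s ^+ n <= q s0 ^+ n by rewrite lerXn2r// nnegrE ltW.
have ctz : continuous (fun x => (y - x) * q s).
  by move=> x; apply: cvgMr_tmp; apply: cvgB; [exact: cvg_cst|exact: cvg_id].
have ctp : continuous (fun x => phi ((y - x) * q s)).
  move=> x; apply: (@continuous_comp _ _ _ (fun x => (y - x) * q s) phi).
    exact: ctz.
  exact: (@continuous_normal_pdf R 0 1 (oner_neq0 R)).
split.
- by move=> x; apply: cvgN; apply: cvgMr_tmp; exact: ctp.
- move=> x; apply: cvgN; apply: cvgMr_tmp.
  by apply: cvgM; [exact: ctz|exact: ctp].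
- move=> x; rewrite normrN normrM (gtr0_norm qs).
  have [+ _ _ _] := std_normal_pdf_moments ((y - x) * q s).
  have := normr_ge0 (phi ((y - x) * q s)); nra.
- move=> x; rewrite normrN normrM (@ger0_norm _ (q s ^+ 2 / 2)); last first.
    by rewrite divr_ge0// sqr_ge0.
  have [_ + _ _] := std_normal_pdf_moments ((y - x) * q s).
  set w := `|_|; have w0 : 0 <= w by exact: normr_ge0.
  have := qXn 2; have := sqr_ge0 (q s); nra.
move=> x h dl dl0; set z := (y - x) * q s.
have T1 := std_normal_cdf_taylor z (- h * q s).
have T2 := @heat_time_taylor (y - x) s0 s dl s00 s0s dl0.
rewrite -/(q s) -/z in T2.
have qs2 : q s ^+ 2 = s^-1 by rewrite exprVn sqr_sqrtr// ltW.
have q02 : q s0 ^+ 2 = s0^-1 by rewrite exprVn sqr_sqrtr// ltW.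
have E1 : heat y s (x + h) = Phi (z + - h * q s).
  by rewrite /heat /z -mulrDl opprD addrA.
have -> : heat y s (x + h) - heat y (s + dl) x - (A s x * h + B s x * (h ^+ 2 - dl))
  = (Phi (z + - h * q s) - Phi z - phi z * (- h * q s)
      + z * phi z / 2 * (- h * q s) ^+ 2)
   - (Phi ((y - x) / Num.sqrt (s + dl)) - Phi z + z * phi z / (2 * s) * dl).
  rewrite E1 /A /B -/z (_ : z * phi z / (2 * s) = z * phi z * (q s ^+ 2 / 2)).
    by rewrite /heat; ring.
  by rewrite qs2; field; rewrite gt_eqF.
apply: le_trans (ler_normB _ _) _; rewrite mulrDr; apply: lerD; last first.
  apply: le_trans T2 _; rewrite ler_wpM2r ?sqr_ge0// -exprVn -q02 -exprM.
  exact: C4.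
apply: le_trans T1 _.
rewrite normrM normrN (gtr0_norm qs) !exprMn.
set a := `|h|; have a0 : 0 <= a by exact: normr_ge0.
have a2 : 0 <= a ^+ 2 by exact: exprn_ge0.
have a3 : 0 <= a ^+ 3 by exact: exprn_ge0.
have m3 := qXn 3%N; have m2 := qXn 2%N.
have p3 := exprn_gt0 3 q00; have p2 := exprn_gt0 2 q00.
rewrite [leRHS]minr_pMr ?(le_trans (ltW q00))// minr_pMr// le_min !ge_min.
apply/andP; split; apply/orP; [left|right].
- have : a ^+ 3 * q s ^+ 3 <= a ^+ 3 * q s0 ^+ 3 by exact: ler_wpM2l.
  nra.
- have : a ^+ 2 * q s ^+ 2 <= a ^+ 2 * q s0 ^+ 2 by exact: ler_wpM2l.
  nra.
Qed.

End HeatFlow.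

(** * Independence and expectations *)

Section Independence.
Context {d : measure_display} {T : measurableType d} {R : realType}.
Context {P : probability T R}.
Variable X : nat -> {RV P >-> R}.

(** A pi-system generating the sigma-algebra of the [X i] with [i] in [I]. Measurability on the type
    [sigX I] is how dependence on these variables alone is expressed throughout. *)
Definition cylinders (I : set nat) : set (set T) :=
  [set C | exists (s : seq nat) (A : nat -> set R),
    [/\ uniq s, [set` s] `<=` I, forall i, measurable (A i)
      & C = \bigcap_(i in [set` s]) (X i @^-1` A i)]].

Local Notation sigX I := (g_sigma_algebraType (cylinders I)).

Lemma cylinders_measurable I : cylinders I `<=` measurable.
Proof.
move=> _ [s [A [us sI mA ->]]]; apply: fin_bigcap_measurable => //.
by move=> i _; rewrite -[X in measurable X]setTI; exact: measurable_funPT.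
Qed.

Lemma cylinders_setI I : setI_closed (cylinders I).
Proof.
move=> _ _ [s [A [us sI mA ->]]] [s' [A' [us' sI' mA' ->]]].
pose B i := (if i \in s then A i else setT) `&` (if i \in s' then A' i else setT).
exists (undup (s ++ s')), B; split.
- exact: undup_uniq.
- by move=> i /=; rewrite mem_undup mem_cat => /orP[/sI|/sI'].
- by move=> i; apply: measurableI; case: ifP.
- apply/seteqP; split=> [w [w1 w2] i /=|w H].
    rewrite /B => _; split; case: ifPn => // ?; [exact: w1|exact: w2].
  split=> i /= si; have := H i; rewrite /= mem_undup mem_cat si ?orbT => /(_ isT).
    by rewrite /B si => -[].
  by rewrite /B si => -[].
Qed.

Lemma cylinders_setT I : cylinders I setT.
Proof.
by exists [::], (fun=> setT); split => //; apply/seteqP; split.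
Qed.

Lemma sigX_measurable I : <<s cylinders I>> `<=` @measurable _ T.
Proof.
apply: smallest_sub; [exact: sigma_algebra_measurable|exact: cylinders_measurable].
Qed.

Lemma measurable_sigXT I d' (U : measurableType d') (f : T -> U) :
  measurable_fun [set: sigX I] (f : sigX I -> U) -> measurable_fun setT f.
Proof.
by move=> mf _ B mB; apply: (@sigX_measurable I); have := mf measurableT B mB.
Qed.

Lemma measurable_sigX_sub I J d' (U : measurableType d') (f : T -> U) :
  I `<=` J -> measurable_fun [set: sigX I] (f : sigX I -> U) ->
  measurable_fun [set: sigX J] (f : sigX J -> U).
Proof.
move=> IJ mf _ B mB; have : <<s cylinders I>> (setT `&` f @^-1` B).
  exact: mf measurableT B mB.
apply: sub_smallest2r; first exact: smallest_sigma_algebra.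
by move=> _ [s [A [us sI mA ->]]]; exists s, A; split=> // i /sI /IJ.
Qed.

Lemma measurable_sigX I i : I i ->
  measurable_fun [set: sigX I] (X i : sigX I -> R).
Proof.
move=> Ii _ B mB; rewrite setTI; apply: sub_sigma_algebra.
exists [:: i], (fun=> B); split=> //.
  by move=> j /=; rewrite inE => /eqP ->.
apply/seteqP; split=> [w wB j /=|w /(_ i)/=]; first by rewrite inE => /eqP->.
by rewrite inE => /(_ (eqxx _)).
Qed.

Hypothesis indX : mutually_independent X.

Lemma cylinders_indep I J A B : I `&` J = set0 -> cylinders I A -> cylinders J B ->
  P (A `&` B) = (P A * P B)%E.
Proof.
move=> IJ [s [A1 [us sI mA ->]]] [s' [B1 [us' sJ mB ->]]].
have disj i : i \in s -> i \notin s'.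
  move=> si; apply/negP => s'i; suff : (I `&` J) i by rewrite IJ.
  by split; [exact: sI|exact: sJ].
pose C i := if i \in s then A1 i else B1 i.
have mC i : measurable (C i) by rewrite /C; case: ifP.
have us12 : uniq (s ++ s').
  rewrite cat_uniq us us' andbT /=; apply/hasPn => i s'i; apply/negP => si.
  by have := disj i si; rewrite s'i.
have -> : (\bigcap_(i in [set` s]) X i @^-1` A1 i)
    `&` (\bigcap_(i in [set` s']) X i @^-1` B1 i)
  = \bigcap_(i in [set` s ++ s']) X i @^-1` C i.
  apply/seteqP; split=> [w [w1 w2] i /=|w H].
    rewrite mem_cat /C /preimage/=; case: ifPn => [si _|si /=]; [exact: w1|exact: w2].
  split=> i /= si; have := H i; rewrite /= mem_cat si ?orbT => /(_ isT).
    by rewrite /preimage/= /C si.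
  rewrite /preimage/= /C; case: ifPn => // /disj; by rewrite si.
rewrite !indX// big_cat/=; congr (_ * _)%E; apply: eq_big_seq => i si.
  by rewrite /C si.
by rewrite /C; case: ifPn => // /disj; rewrite si.
Qed.

(** Independence holds on the two pi-systems and is extended to the generated sigma-algebras one
    side at a time. *)
Lemma sigX_indep I J A B : I `&` J = set0 ->
  <<s cylinders I>> A -> <<s cylinders J>> B -> P (A `&` B) = (P A * P B)%E.
Proof.
move=> IJ.
(* For fixed [B'], the finite measures sending [A'] to [P (A' & B')] and to [P B' * P A'] agree on a
   pi-system containing [setT], hence on what it generates. *)
have step K (B' : set T) : measurable B' ->
    (forall A', cylinders K A' -> P (A' `&` B') = (P A' * P B')%E) ->
    forall A', <<s cylinders K>> A' -> P (A' `&` B') = (P A' * P B')%E.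
  move=> mB' H A' sA'.
  have PB0 : 0 <= fine (P B') by exact: fine_ge0.
  have := @g_sigma_algebra_measure_unique _ R T (cylinders K)
    (@cylinders_measurable K) (fun=> setT) (fun=> cylinders_setT K) (bigcup_const _ _)
    (mrestr P mB') (mscale (NngNum PB0) P) (@cylinders_setI K).
  move=> /(_ (ex_intro _ 0%N Logic.I)) H1.
  have := H1 _ _ A' sA'; rewrite /= /mrestr /mscale/= fineK ?fin_num_measure// => ->.
  - by rewrite muleC.
  - by move=> C KC; rewrite /= /mrestr/= H// muleC.
  - by move=> _; rewrite /= /mrestr setTI -ge0_fin_numE// fin_num_measure.
move=> sA sB.
have mB := sigX_measurable sB.
apply: (step I) => // A' cA'.
have mA' := cylinders_measurable cA'.
rewrite setIC muleC; apply: (step J) => // B' cB'.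
by rewrite setIC muleC; exact: (cylinders_indep IJ).
Qed.

(** The law of the pair [(f, g)] is the product of the two laws, so Fubini for the product of
    coordinates gives both integrability and the formula. *)
Lemma sigX_indep_expectation I J (f g : T -> R) : I `&` J = set0 ->
  measurable_fun [set: sigX I] (f : sigX I -> R) ->
  measurable_fun [set: sigX J] (g : sigX J -> R) ->
  P.-integrable setT (EFin \o f) -> P.-integrable setT (EFin \o g) ->
  P.-integrable setT (EFin \o (fun w => f w * g w)) /\
  \int[P]_w (f w * g w) = \int[P]_w f w * \int[P]_w g w.
Proof.
move=> IJ mf mg If Ig.
have mfT := measurable_sigXT mf; have mgT := measurable_sigXT mg.
pose f' : {mfun T >-> R} := HB.pack f (@isMeasurableFun.Build _ _ _ _ f mfT).
pose g' : {mfun T >-> R} := HB.pack g (@isMeasurableFun.Build _ _ _ _ g mgT).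
pose Pf := distribution P f'; pose Pg := distribution P g'.
have mh : measurable_fun setT (fun w => (f w, g w)) by exact: measurable_fun_pair.
pose h : {mfun T >-> (R * R)%type} :=
  HB.pack (fun w => (f w, g w)) (@isMeasurableFun.Build _ _ _ _ (fun w => (f w, g w)) mh).
pose Ph := distribution P h.
have PhE A : measurable A -> (Pf \x Pg)%E A = Ph A.
  move=> mA; apply: product_measure_unique => // B C mB mC.
  rewrite /Ph /Pf /Pg /distribution /pushforward/= -(sigX_indep IJ)//.
    by have := mf measurableT B mB; rewrite setTI.
  by have := mg measurableT C mC; rewrite setTI.
pose m := EFin \o (fun z : R * R => z.1 * z.2).
have /measurable_EFinP mm : measurable_fun setT (fun z : R * R => z.1 * z.2).
  exact: measurable_funM.
have mid : measurable_fun setT (EFin \o (@id R)) by exact/measurable_EFinP.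
have iPf : Pf.-integrable setT (EFin \o (@id R)).
  exact: (@integrable_pushforward _ _ _ _ _ f').
have iPg : Pg.-integrable setT (EFin \o (@id R)).
  exact: (@integrable_pushforward _ _ _ _ _ g').
have Ef : (\int[Pf]_x x%:E = \int[P]_w (f w)%:E)%E.
  exact: (@integral_pushforward _ _ _ _ _ f').
have Eg : (\int[Pg]_x x%:E = \int[P]_w (g w)%:E)%E.
  exact: (@integral_pushforward _ _ _ _ _ g').
have Ifin := integrable_fin_num measurableT If.
have Igin := integrable_fin_num measurableT Ig.
have iprod : (Pf \x Pg)%E.-integrable setT m.
  apply: (proj2 (@integrable12ltyP _ _ _ _ _ Pf Pg m mm)).
  pose c := (\int[Pg]_y `|y%:E|)%E.
  have cfin : c \is a fin_num.
    by rewrite ge0_fin_numE ?integral_ge0//; move/integrableP : iPg => [].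
  have inner x : (\int[Pg]_y `|m (x, y)| = `|x%:E| * c)%E.
    rewrite -ge0_integralZl//; last exact: measurableT_comp.
    by apply: eq_integral => y _; rewrite /m /= normrM EFinM.
  under eq_integral => x _ do rewrite inner.
  rewrite ge0_integralZr//; last 2 first.
  - exact: measurableT_comp.
  - exact: integral_ge0.
  rewrite lte_mul_pinfty ?integral_ge0//.
    by rewrite ge0_fin_numE ?integral_ge0//; move/integrableP : iPf => [].
  by rewrite -ge0_fin_numE ?integral_ge0.
have meq (k : R * R -> \bar R) : (\int[(Pf \x Pg)%E]_z k z = \int[Ph]_z k z)%E.
  by apply: eq_measure_integral => A mA _; exact: PhE.
have ih : Ph.-integrable setT m.
  apply/integrableP; split => //; move/integrableP : iprod => [_].
  by rewrite meq.
have iP : P.-integrable setT (m \o h).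
  apply/integrableP; split; first exact: measurableT_comp.
  move/integrableP : ih => [_].
  rewrite ge0_integral_pushforward//; exact: measurableT_comp.
split; first exact: iP.
rewrite /Rintegral.
have -> : (\int[P]_w (f w * g w)%:E = \int[Ph]_z m z)%E.
  by rewrite integral_pushforward.
rewrite -meq -integral12_prod_meas1// /fubini_F/=.
have inner x : (\int[Pg]_y m (x, y) = x%:E * \int[P]_w (g w)%:E)%E.
  by rewrite -Eg -integralZl//; apply: eq_integral => y _; rewrite /m /= EFinM.
under eq_integral => x _ do rewrite inner -(fineK Igin).
by rewrite integralZr// fineM//; [rewrite Ef|rewrite Ef].
Qed.

End Independence.

(** * Transfer between observations with the same law *)

Section IdenticalDistribution.
Context {d : measure_display} {T : measurableType d} {R : realType}.
Context {P : probability T R}.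
Variables (X : nat -> {RV P >-> R}) (F : cumulativeBounded (0 : R) (1 : R)).
Hypothesis XF : forall i x, cdf (X i) x = (F x)%:E.

(** The half-open intervals are a pi-system exhausting the line, and [cdf] determines their
    measure. *)
Lemma ident_distr_probability i A : measurable A ->
  P (X i @^-1` A) = P (X 0%N @^-1` A).
Proof.
have itv j a b : P (X j @^-1` `]a, b]) = if a <= b then ((F b)%:E - (F a)%:E)%E else 0%E.
  have [ab|ba] := leP a b; last first.
    by rewrite set_itv_ge ?preimage_set0 ?measure0// bnd_simp -leNgt ltW.
  rewrite -!(XF j) /cdf /distribution /pushforward.
  have -> : `]a, b]%classic = `]-oo, b] `\` `]-oo, a].
    by rewrite -[RHS]setCK setCD setCitvl setUC -[LHS]setCK setCitv.
  have m c : measurable (X j @^-1` `]-oo, c]%classic).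
    by rewrite -[X in measurable X]setTI; exact: measurable_funPT.
  rewrite (_ : _ @^-1` _ = (X j @^-1` `]-oo, b]) `\` (X j @^-1` `]-oo, a]))//.
  rewrite measureD//; last by rewrite -ge0_fin_numE// fin_num_measure.
  congr (_ - P _)%E; apply/setIidr; apply: preimage_subset; exact: subset_itvl.
move=> mA.
have := @measure_unique _ _ R (@ocitv R) (fun n => `]- n%:R, n%:R]%classic) erefl
  (@ocitvI R) (fun n => is_ocitv _ _) _ (distribution P (X i)) (distribution P (X 0%N)).
rewrite /distribution /pushforward; apply => //=.
- apply/seteqP; split=> // x _; exists (Num.truncn `|x|).+1 => //=.
  have /andP[x1 x2] : - (Num.truncn `|x|).+1%:R < x < (Num.truncn `|x|).+1%:R.
    by rewrite -ltr_norml truncnS_gt.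
  by rewrite in_itv/= x1 ltW.
- by move=> _ [[a b] _ <-]; rewrite /distribution /pushforward/= !itv.
- by move=> n; rewrite -ge0_fin_numE// fin_num_measure.
Qed.

Lemma ident_distr_integral i (f : R -> \bar R) : measurable_fun setT f ->
  (forall x, 0 <= f x)%E ->
  (\int[P]_w f (X i w) = \int[P]_w f (X 0%N w))%E.
Proof.
move=> mf f0; have := ge0_integral_distribution (X i) mf f0.
have := ge0_integral_distribution (X 0%N) mf f0.
rewrite /comp => <- <-; apply: eq_measure_integral => A mA _ /=.
exact: ident_distr_probability.
Qed.

Lemma ident_distr_integrable i (f : R -> R) : measurable_fun setT f ->
  P.-integrable setT (EFin \o (f \o X 0%N)) ->
  P.-integrable setT (EFin \o (f \o X i)).
Proof.
move=> mf /integrableP[_ H]; apply/integrableP; split.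
  by apply/measurable_EFinP; exact: measurableT_comp.
move: H; rewrite -(@ident_distr_integral i (fun x => `|(f x)%:E|%E))//.
by apply: measurableT_comp => //; exact/measurable_EFinP.
Qed.

Lemma ident_distr_Rintegral i (f : R -> R) : measurable_fun setT f ->
  P.-integrable setT (EFin \o (f \o X 0%N)) ->
  \int[P]_w f (X i w) = \int[P]_w f (X 0%N w).
Proof.
move=> mf If; have Ifi := ident_distr_integrable i mf If.
have mEf : measurable_fun setT (EFin \o f) by exact/measurable_EFinP.
have := integral_distribution (X := X i) mEf Ifi.
have := integral_distribution (X := X 0%N) mEf If.
rewrite /Rintegral /comp => <- <-; congr fine; apply: eq_measure_integral => A mA _ /=.
exact: ident_distr_probability.
Qed.

End IdenticalDistribution.

(** * Calculus of real-valued expectations *)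

Section RealExpectation.
Context {d : measure_display} {T : measurableType d} {R : realType}.
Variable P : probability T R.
Implicit Types (f g : T -> R) (c : R).

Local Notation intg f := (P.-integrable setT (EFin \o f)).
Local Notation meas f := (measurable_fun [set: T] f).

Lemma intg_meas f : intg f -> meas f.
Proof. by move=> /measurable_int/measurable_EFinP. Qed.

Lemma intg_le f g : meas f -> (forall w, `|f w| <= g w) -> intg g -> intg f.
Proof.
move=> mf fg; apply: le_integrable => //; first exact/measurable_EFinP.
by move=> w _ /=; rewrite lee_fin (le_trans (fg w))// ler_norm.
Qed.

Lemma intg_cst c : intg (fun=> c).
Proof. exact: finite_measure_integrable_cst. Qed.

Lemma intg_bnd f c : meas f -> (forall w, `|f w| <= c) -> intg f.
Proof. by move=> mf fc; apply: (intg_le mf fc); exact: intg_cst. Qed.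

Lemma intgD f g : intg f -> intg g -> intg (fun w => f w + g w).
Proof. exact: integrableD. Qed.

Lemma intgB f g : intg f -> intg g -> intg (fun w => f w - g w).
Proof. exact: integrableB. Qed.

Lemma intgZ c f : intg f -> intg (fun w => c * f w).
Proof. exact: integrableZl. Qed.

Lemma intg_norm f : intg f -> intg (fun w => `|f w|).
Proof. exact: integrable_norm. Qed.

Lemma intg_bndM f g c : meas f -> (forall w, `|f w| <= c) -> intg g ->
  intg (fun w => f w * g w).
Proof.
move=> mf fc ig; apply: (@intg_le _ (fun w => c * `|g w|)).
- by apply: measurable_funM => //; exact: intg_meas.
- by move=> w; rewrite normrM ler_wpM2r.
- by apply: intgZ; exact: intg_norm.
Qed.

Lemma intg_sum (I : Type) (s : seq I) (F : I -> T -> R) :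
  (forall i, intg (F i)) -> intg (fun w => \sum_(i <- s) F i w).
Proof.
move=> iF; elim: s => [|i s IH].
  have -> : (fun w => \sum_(i <- [::]) F i w) = (fun=> 0).
    by apply/funext => w; rewrite big_nil.
  exact: intg_cst.
have -> : (fun w => \sum_(i <- i :: s) F i w) = (fun w => F i w + \sum_(i <- s) F i w).
  by apply/funext => w; rewrite big_cons.
exact: intgD.
Qed.

Lemma Ecst c : \int[P]_w c = c.
Proof. by rewrite Rintegral_cst//= probability_setT/= mulr1. Qed.

Lemma ED f g : intg f -> intg g ->
  \int[P]_w (f w + g w) = \int[P]_w f w + \int[P]_w g w.
Proof. by move=> ? ?; rewrite RintegralD. Qed.

Lemma EB f g : intg f -> intg g ->
  \int[P]_w (f w - g w) = \int[P]_w f w - \int[P]_w g w.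
Proof. by move=> ? ?; rewrite RintegralB. Qed.

Lemma EZ c f : intg f -> \int[P]_w (c * f w) = c * \int[P]_w f w.
Proof. by move=> ?; rewrite RintegralZl. Qed.

Lemma Ele f g : intg f -> intg g -> (forall w, f w <= g w) ->
  \int[P]_w f w <= \int[P]_w g w.
Proof. by move=> ? ? ?; exact: le_Rintegral. Qed.

Lemma Ele_norm f g : intg f -> intg g -> (forall w, `|f w| <= g w) ->
  `|\int[P]_w f w| <= \int[P]_w g w.
Proof.
move=> If Ig fg; apply: le_trans (le_normr_Rintegral _ If) _ => //.
by apply: Ele => //; exact: intg_norm.
Qed.

Lemma Esum (I : Type) (s : seq I) (F : I -> T -> R) : (forall i, intg (F i)) ->
  \int[P]_w (\sum_(i <- s) F i w) = \sum_(i <- s) \int[P]_w F i w.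
Proof.
move=> iF; elim: s => [|i s IH].
  under eq_Rintegral => w _ do rewrite big_nil.
  by rewrite Ecst big_nil.
under eq_Rintegral => w _ do rewrite big_cons.
by rewrite ED ?IH ?big_cons//; exact: intg_sum.
Qed.

Lemma E_indic (A : set T) : measurable A -> \int[P]_w \1_A w = fine (P A).
Proof. by move=> mA; rewrite /Rintegral integral_indic// setIT. Qed.

End RealExpectation.

(** * Counting exceedances of several levels *)

Section ExceedanceCounts.
Context {d : measure_display} {T : measurableType d} {R : realType}.
Context {P : probability T R}.
Variables (X : nat -> {RV P >-> R}) (F : cumulativeBounded (0 : R) (1 : R)).
Hypothesis iidX : iid_with_cdf X F.
Variable I : finType.

Local Notation state := {ffun I -> nat}.
Local Notation pattern := {ffun I -> bool}.
Local Notation intg f := (P.-integrable setT (EFin \o f)).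
Local Notation sigX K := (g_sigma_algebraType (cylinders X K)).
Implicit Types (u : I -> R) (f : state -> R) (c : state) (D : pattern).

Definition exceed u (x : R) : pattern := [ffun j => u j < x].

Definition add_pattern c D : state := [ffun j => (c j + D j)%N].

(** The initial count [c] makes the counts a chain that can be unrolled one observation at a time.
    The sample is a list of indices, so that one observation can be deleted or the first [m]
    discarded. *)
Definition excess u (s : seq nat) c (w : T) : state :=
  [ffun j => (c j + count (fun i => (u j < X i w)%R) s)%N].

Definition pattern_prob u D : R := \int[P]_w (exceed u (X 0%N w) == D)%:R.

(** For [q] the law of a pattern, this is the transition operator of the chain of counts. *)
Definition step (q : pattern -> R) f c : R := \sum_D q D * f (add_pattern c D).

Lemma excess_nil u c w : excess u [::] c w = c.
Proof. by apply/ffunP => j; rewrite ffunE addn0. Qed.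

Lemma excess_cons u i s c w :
  excess u (i :: s) c w = excess u s (add_pattern c (exceed u (X i w))) w.
Proof. by apply/ffunP => j; rewrite !ffunE /= addnA. Qed.

Lemma measurable_pattern u D :
  measurable_fun setT (fun x : R => (exceed u x == D)%:R : R).
Proof.
(* A pattern is a finite conjunction of half-line conditions, so its indicator is a product of
   half-line indicators. *)
have -> : (fun x : R => (exceed u x == D)%:R : R) =
    (fun x => \prod_(j <- enum I) (if D j then \1_(`]u j, +oo[) x else \1_(`]-oo, u j]) x)).
  apply/funext => x; have [<-|xD] := eqVneq.
    rewrite big1_seq// => j _; rewrite ffunE; case: ifPn => ux; rewrite indicE.
      by rewrite mem_set//= in_itv/= ux.
    by rewrite mem_set//= in_itv/= leNgt.
  have /existsP[j Dj] : [exists j, exceed u x j != D j].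
    rewrite -negb_forall; apply: contra xD => /forallP h.
    by apply/eqP/ffunP => j; exact/eqP/h.
  rewrite big_enum/= (bigD1 j)//=; move: Dj; rewrite ffunE => Dj.
  case: ifPn Dj => _ Dj; rewrite indicE memNset ?mul0r//= in_itv/=.
    by rewrite andbT; apply/negP; move: Dj; case: (u j < x).
  by apply/negP; rewrite leNgt; move: Dj; case: (u j < x).
apply: measurable_prod => j _; case: (D j); exact: measurable_indic.
Qed.

Lemma excess_sum_pattern f u i s c w :
  f (excess u (i :: s) c w) =
  \sum_D (exceed u (X i w) == D)%:R * f (excess u s (add_pattern c D) w).
Proof.
rewrite excess_cons (bigD1 (exceed u (X i w)))//= eqxx mul1r big1 ?addr0//.
by move=> D; rewrite eq_sym => /negPf ->; rewrite mul0r.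
Qed.

Lemma pattern_distr u i D :
  measurable_fun [set: sigX [set i]] ((fun w => (exceed u (X i w) == D)%:R) : sigX [set i] -> R)
  /\ intg (fun w => (exceed u (X i w) == D)%:R : R)
  /\ \int[P]_w (exceed u (X i w) == D)%:R = pattern_prob u D.
Proof.
have b j : intg (fun w => (exceed u (X j w) == D)%:R : R).
  apply: (@intg_bnd _ _ _ P _ 1).
    exact: (measurableT_comp (measurable_pattern u D)).
  by move=> w; case: eqP; rewrite ?normr1 ?normr0.
split; last split=> //.
  apply: (measurableT_comp (measurable_pattern u D)); exact: measurable_sigX.
apply: (@ident_distr_Rintegral _ _ _ _ X F iidX.2 i (fun x => (exceed u x == D)%:R)).
  exact: measurable_pattern.
exact: b.
Qed.

(** The head observation is independent of the later ones and only moves the initial state, whence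
    the generality in [c], and in [f] for the conditioning on its pattern. The law depends on [s]
    through its size alone. *)
Lemma excess_distr u s : uniq s -> forall f c,
  [/\ measurable_fun [set: sigX [set` s]] ((fun w => f (excess u s c w)) : sigX [set` s] -> R),
      intg (fun w => f (excess u s c w))
    & \int[P]_w f (excess u s c w) = iter (size s) (step (pattern_prob u)) f c].
Proof.
elim: s => [_ f c|i s IH /= /andP[si us] f c].
  have -> : (fun w => f (excess u [::] c w)) = fun=> f c.
    by apply/funext => w; rewrite excess_nil.
  split; [exact: measurable_cst|exact: intg_cst|].
  by rewrite Ecst.
have -> : (fun w => f (excess u (i :: s) c w)) =
    fun w => \sum_D (exceed u (X i w) == D)%:R * f (excess u s (add_pattern c D) w).
  by apply/funext => w; rewrite excess_sum_pattern.
have prodD D : intg (fun w => (exceed u (X i w) == D)%:R * f (excess u s (add_pattern c D) w)) /\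
    \int[P]_w ((exceed u (X i w) == D)%:R * f (excess u s (add_pattern c D) w)) =
    pattern_prob u D * iter (size s) (step (pattern_prob u)) f (add_pattern c D).
  have [m1 [i1 <-]] := pattern_distr u i D.
  have [m2 i2 <-] := IH us f (add_pattern c D).
  apply: (@sigX_indep_expectation _ _ _ _ X iidX.1 [set i] [set` s]) => //.
  by apply/seteqP; split=> // j [/= ->]; rewrite (negPf si).
split.
- apply: measurable_sum => D; apply: measurable_funM.
    have [m1 _] := pattern_distr u i D.
    by apply: measurable_sigX_sub m1 => j /= ->; rewrite inE eqxx.
  have [m2 _ _] := IH us f (add_pattern c D).
  by apply: measurable_sigX_sub m2 => j /= js; rewrite inE js orbT.
- by apply: intg_sum => D; have [] := prodD D.
- rewrite Esum; last by move=> D; have [] := prodD D.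
  by apply: eq_bigr => D _; have [] := prodD D.
Qed.

End ExceedanceCounts.

Section RealLimits.
Context {R : realType}.

Lemma cvg_sumr (J : Type) (r : seq J) (Q : pred J) (f : J -> nat -> R) (l : J -> R) :
  (forall j, Q j -> f j n @[n --> \oo] --> l j) ->
  \sum_(j <- r | Q j) f j n @[n --> \oo] --> \sum_(j <- r | Q j) l j.
Proof.
move=> fl; elim: r => [|j r IH].
  by rewrite big_nil; apply: cvg_near_cst; near=> n; rewrite big_nil.
rewrite big_cons; under eq_fun => n do rewrite big_cons.
by case: ifPn => // Qj; apply: cvgD => //; exact: fl.
Unshelve. all: by end_near. Qed.

Lemma cvg_eq_from (N : nat) (g f : nat -> R) (l : R) :
  (forall n, (N <= n)%N -> g n = f n) -> g n @[n --> \oo] --> l -> f n @[n --> \oo] --> l.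
Proof.
move=> gf; apply: cvg_trans; apply: near_eq_cvg; near=> n.
by rewrite gf//; near: n; exact: nbhs_infty_ge.
Unshelve. all: by end_near. Qed.

Lemma cvg_invr_idn : (n%:R^-1 : R) @[n --> \oo] --> (0 : R).
Proof.
apply/gtr0_cvgV0; last exact: cvgr_idn.
near=> n; rewrite ltr0n; near: n; exact: nbhs_infty_gt.
Unshelve. all: by end_near. Qed.

End RealLimits.

(** * Binomial expansion of the transition operator *)

Section StepIteration.
Context {R : realType} {I : finType}.

Local Notation state := {ffun I -> nat}.
Local Notation pattern := {ffun I -> bool}.
Implicit Types (f : state -> R) (c : state) (D : pattern) (q : pattern -> R).

Definition nopattern : pattern := [ffun=> false].

Definition jump q f c : R := \sum_(D | D != nopattern) q D * f (add_pattern c D).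

Definition below (kap : I -> nat) c : R := [forall j, (c j < kap j)%N]%:R.

Lemma add_nopattern c : add_pattern c nopattern = c.
Proof. by apply/ffunP => j; rewrite !ffunE addn0. Qed.

Lemma stepE q f c : step q f c = q nopattern * f c + jump q f c.
Proof. by rewrite /step (bigD1 nopattern)//= add_nopattern. Qed.

Lemma iter_jump_step q f l c : iter l (jump q) (step q f) c =
  q nopattern * iter l (jump q) f c + iter l.+1 (jump q) f c.
Proof.
elim: l c => [|l IH] c; first by rewrite /= stepE.
rewrite [LHS]/= [in RHS]iterS {1}/jump.
under eq_bigr => D _ do rewrite IH mulrDr.
rewrite big_split/=; congr (_ + _).
by rewrite /jump mulr_sumr; apply: eq_bigr => D _; rewrite mulrCA.
Qed.

(** The step is the scalar [q nopattern] plus the operator [jump q]; a scalar commutes with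
    everything, so this is the binomial theorem. *)
Lemma iter_stepE q f n c : iter n (step q) f c =
  \sum_(l < n.+1) 'C(n, l)%:R * q nopattern ^+ (n - l) * iter l (jump q) f c.
Proof.
elim: n f c => [|n IH] f c; first by rewrite big_ord1 /= bin0 !mul1r.
rewrite iterSr IH.
under eq_bigr => l _ do rewrite iter_jump_step mulrDr.
rewrite big_split/= [in RHS]big_ord_recl /= bin0 mul1r subn0.
under [in RHS]eq_bigr => l _ do rewrite /bump leq0n add1n binS natrD mulrDl mulrDl subSS.
rewrite big_split/= addrA; congr (_ + _).
rewrite [in RHS]big_ord_recr/= bin_small// !mul0r addr0 big_ord_recl/= bin0 mul1r subn0.
rewrite mulrA -exprSr; congr (_ + _); apply: eq_bigr => l _.
rewrite /bump leq0n add1n; have -> : (n - l = (n - l.+1).+1)%N by rewrite -subSn.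
by rewrite exprSr !mulrA.
Qed.

Lemma sum_add_pattern c D : D != nopattern ->
  (\sum_j c j < \sum_j add_pattern c D j)%N.
Proof.
move=> DN; have /existsP[j Dj] : [exists j, D j].
  apply: contraR DN; rewrite negb_exists => /forallP h.
  by apply/eqP/ffunP => j; rewrite ffunE; exact/negbTE/h.
rewrite [X in (X < _)%N](bigD1 j)//= [X in (_ < X)%N](bigD1 j)//= ffunE Dj addn1.
by rewrite addSn ltnS leq_add2l; apply: leq_sum => i _; rewrite ffunE leq_addr.
Qed.

(** Every jump raises the total count by at least one, and [below kap] vanishes at states whose
    total exceeds the sum of the bounds: on such functions [jump] is nilpotent. *)
Lemma iter_jump_below kap q l c : (\sum_j kap j < l + \sum_j c j)%N ->
  iter l (jump q) (below kap) c = 0.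
Proof.
elim: l c => [|l IH] c.
  rewrite add0n /= /below => H; case: forallP => // h; exfalso.
  have : (\sum_j c j <= \sum_j kap j)%N by apply: leq_sum => j _; exact: ltnW.
  by rewrite leqNgt H.
move=> H; rewrite iterS /jump big1// => D DN; rewrite IH ?mulr0//.
apply: leq_trans H _; rewrite addSnnS leq_add2l; exact: sum_add_pattern.
Qed.

(** Nilpotency fixes the number of terms independently of [n], so that the limit in [n] can be taken
    term by term. *)
Lemma iter_step_below kap q n c m : (\sum_j kap j < m)%N ->
  iter n (step q) (below kap) c =
  \sum_(l < m) 'C(n, l)%:R * q nopattern ^+ (n - l) * iter l (jump q) (below kap) c.
Proof.
move=> km; rewrite iter_stepE.
pose t l := 'C(n, l)%:R * q nopattern ^+ (n - l) * iter l (jump q) (below kap) c.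
rewrite -(big_mkord xpredT t) -[RHS](big_mkord xpredT t).
have t0 l : ((n < l) || (m <= l))%N -> t l = 0.
  case/orP => h; rewrite /t; first by rewrite bin_small// !mul0r.
  by rewrite iter_jump_below ?mulr0//; exact: leq_trans (leq_trans km h) (leq_addr _ _).
have [nm|mn] := leqP n.+1 m.
  rewrite [RHS](big_cat_nat (n := n.+1))//=.
  rewrite [X in _ = _ + X]big_nat_cond [X in _ = _ + X]big1 ?addr0// => l.
  by rewrite andbT => /andP[nl _]; rewrite t0// nl.
rewrite (big_cat_nat (n := m))//=; last exact: ltnW.
rewrite [X in _ + X]big_nat_cond [X in _ + X]big1 ?addr0// => l.
by rewrite andbT => /andP[nl _]; rewrite t0// nl orbT.
Qed.

End StepIteration.

(** * Multivariate Poisson limit *)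

Section PoissonLimit.
Context {R : realType} {I : finType}.

Local Notation state := {ffun I -> nat}.
Local Notation pattern := {ffun I -> bool}.
Implicit Types (f : state -> R) (c : state) (D : pattern).

Lemma cvg_bin_exp l : ('C(n, l)%:R / n%:R ^+ l : R) @[n --> \oo] --> (l`!%:R^-1 : R).
Proof.
have ff : forall l, ((n ^_ l)%:R / n%:R ^+ l : R) @[n --> \oo] --> (1 : R).
  elim=> [|k IH].
    apply: cvg_near_cst; near=> n; by rewrite ffactn0 expr0 divr1.
  have h : ((n - k)%:R / n%:R : R) @[n --> \oo] --> (1 : R).
    apply: (@cvg_eq_from _ k.+1 (fun n => 1 - k%:R * n%:R^-1)).
      move=> n kn; rewrite natrB ?(ltnW kn)// mulrBl divff// pnatr_eq0 -lt0n.
      exact: leq_trans kn.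
    rewrite -[X in _ --> X]subr0 -[X in _ - X](mulr0 k%:R).
    by apply: cvgB; [exact: cvg_cst|apply: cvgMl_tmp; exact: cvg_invr_idn].
  apply: (@cvg_eq_from _ 0 (fun n => (n ^_ k)%:R / n%:R ^+ k * ((n - k)%:R / n%:R))).
    by move=> n _; rewrite ffactnSr natrM exprSr invfM mulrACA.
  by rewrite -[X in _ --> X](mulr1 1); exact: cvgM.
apply: (@cvg_eq_from _ 0 (fun n => (n ^_ l)%:R / n%:R ^+ l * l`!%:R^-1)).
  by move=> n _; rewrite -bin_ffact natrM mulrAC mulfK// pnatr_eq0 -lt0n fact_gt0.
by rewrite -[X in _ --> X]mul1r; apply: cvgMr_tmp.
Unshelve. all: by end_near. Qed.

Variables (q : nat -> pattern -> R) (tau : pattern -> R) (g : R).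
Hypothesis q_tau : forall D, D != nopattern -> n%:R * q n D @[n --> \oo] --> tau D.
Hypothesis q_g : q n nopattern ^+ n @[n --> \oo] --> g.
Hypothesis q_1 : q n nopattern @[n --> \oo] --> (1 : R).

Lemma cvg_iter_jump f l c :
  n%:R ^+ l * iter l (jump (q n)) f c @[n --> \oo] --> iter l (jump tau) f c.
Proof.
elim: l c => [|l IH] c /=.
  by apply: cvg_near_cst; near=> n; rewrite expr0 mul1r.
have -> : (fun n => n%:R ^+ l.+1 * jump (q n) (iter l (jump (q n)) f) c) =
   fun n => \sum_(D | D != nopattern)
     (n%:R * q n D) * (n%:R ^+ l * iter l (jump (q n)) f (add_pattern c D)).
  apply/funext => n; rewrite /jump mulr_sumr; apply: eq_bigr => D _.
  by rewrite exprS mulrACA.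
rewrite /jump.
have h : forall D, D != nopattern ->
   (n%:R * q n D) * (n%:R ^+ l * iter l (jump (q n)) f (add_pattern c D)) @[n --> \oo]
   --> tau D * iter l (jump tau) f (add_pattern c D).
  by move=> D DN; apply: cvgM; [exact: q_tau|exact: IH].
exact: cvg_sumr.
Unshelve. all: by end_near. Qed.

(** Each term of the expansion regroups as ['C(n, l) / n ^ l], the [n]-th power of the no-exceedance
    weight corrected by a fixed power tending to 1, and [n ^ l] times [l] jumps; the three limits
    are [1 / l!], [g] and the jumps with intensities [tau]. *)
Lemma cvg_iter_step_below kap c m : (\sum_j kap j < m)%N ->
  iter n (step (q n)) (below kap) c @[n --> \oo] -->
  g * \sum_(l < m) iter l (jump tau) (below kap) c / l`!%:R.
Proof.
move=> km.
have h l : ('C(n, l)%:R * q n nopattern ^+ (n - l) * iter l (jump (q n)) (below kap) c)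
     @[n --> \oo] --> (l`!%:R)^-1 * (g * (1 : R) ^- l) * iter l (jump tau) (below kap) c.
  have qV : (q n nopattern ^- l) @[n --> \oo] --> (1 : R) ^- l.
    apply: cvgV; first by rewrite expr1n oner_neq0.
    elim: l => [|l IH]; first by apply: cvg_near_cst; near=> n; rewrite !expr0.
    have -> : (fun n => q n nopattern ^+ l.+1) =
       (fun n => q n nopattern * q n nopattern ^+ l).
      by apply/funext => n; rewrite exprS.
    by rewrite exprS; exact: cvgM.
  have [N _ HN] : \forall n \near \oo, 0 < q n nopattern.
    by apply: (cvgr_gt _ q_1); exact: ltr01.
  apply: (@cvg_eq_from _ (maxn N (maxn l 1)) (fun n => 'C(n, l)%:R / n%:R ^+ l *
      (q n nopattern ^+ n * q n nopattern ^- l) *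
      (n%:R ^+ l * iter l (jump (q n)) (below kap) c))); last first.
    apply: cvgM; last exact: cvg_iter_jump.
    by apply: cvgM; [exact: cvg_bin_exp|exact: cvgM].
  move=> n; rewrite !geq_max => /and3P[Nn ln n0].
  have q0 : q n nopattern != 0 by rewrite gt_eqF//; exact: HN.
  have nl0 : n%:R ^+ l != 0 :> R by rewrite expf_neq0// pnatr_eq0 -lt0n.
  have -> : q n nopattern ^+ n = q n nopattern ^+ (n - l) * q n nopattern ^+ l.
    by rewrite -exprD subnK.
  by rewrite mulfK ?expf_neq0//; field.
have -> : (fun n => iter n (step (q n)) (below kap) c) =
   fun n => \sum_(l < m) ('C(n, l)%:R * q n nopattern ^+ (n - l)
      * iter l (jump (q n)) (below kap) c).
  by apply/funext => n; exact: iter_step_below.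
have -> : g * \sum_(l < m) iter l (jump tau) (below kap) c / l`!%:R =
  \sum_(l < m) (l`!%:R)^-1 * (g * (1 : R) ^- l) * iter l (jump tau) (below kap) c.
  rewrite mulr_sumr; apply: eq_bigr => l _; rewrite expr1n invr1 mulr1.
  by ring.
by apply: cvg_sumr => l _; exact: h.
Unshelve. all: by end_near. Qed.

End PoissonLimit.

(** * One level: binomial counts *)

Section SingleLevel.
Context {R : realType}.
Local Notation state := {ffun unit -> nat}.
Local Notation pattern := {ffun unit -> bool}.
Implicit Types (q : pattern -> R) (c : state).

Definition allpattern : pattern := [ffun=> true].

Lemma unit_patternE (D : pattern) : (D != nopattern) = (D == allpattern).
Proof.
apply/idP/eqP => [|->].
  move=> DN; apply/ffunP => -[]; rewrite ffunE.
  apply: contraNT DN => D0; apply/eqP/ffunP => -[].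
  by rewrite ffunE; exact/negbTE.
by apply/eqP => /ffunP /(_ tt); rewrite !ffunE.
Qed.

(** With one level there is a single nonempty pattern, so each jump adds exactly one to the
    count. *)
Lemma iter_jump_single q (k : nat) l c :
  iter l (jump q) (below (fun=> k)) c = q allpattern ^+ l * (c tt + l < k)%N%:R.
Proof.
elim: l c => [|l IH] c.
  rewrite /= mul1r addn0 /below; congr (nat_of_bool _)%:R.
  by apply/forallP/idP => [/(_ tt)|h []].
rewrite iterS /jump (eq_bigl (pred1 allpattern)) => [|D]; last first.
  exact: unit_patternE.
by rewrite big_pred1_eq IH !ffunE addn1 addSnnS exprS mulrA.
Qed.

Lemma iter_step_single q (k : nat) n :
  iter n (step q) (below (fun=> k)) [ffun=> 0%N] =
  \sum_(l < k) 'C(n, l)%:R * q nopattern ^+ (n - l) * q allpattern ^+ l.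
Proof.
rewrite (@iter_step_below _ _ _ _ _ _ k.+1); last by rewrite sum_nat_const card_unit mul1n.
rewrite big_ord_recr/= [iter k _ _ _]iter_jump_single ffunE add0n ltnn mulr0 mulr0 addr0.
apply: eq_bigr => l _; rewrite iter_jump_single ffunE add0n ltn_ord mulr1.
by [].
Qed.

(* The probability that [n + 1] trials have exactly [l + 1] successes is at most 1. *)
Lemma single_level_bound (p : R) (k n : nat) : 0 <= p <= 1 ->
  p * \sum_(l < k) 'C(n, l)%:R * (1 - p) ^+ (n - l) * p ^+ l <= k%:R / n.+1%:R.
Proof.
move=> /andP[p0 p1].
(* From [(l + 1) 'C(n + 1, l + 1) = (n + 1) 'C(n, l)]: up to the factor [(l + 1) / (n + 1)], the
   left side is the probability of [l + 1] successes in [n + 1] trials. *)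
have H (l : nat) : p * ('C(n, l)%:R * (1 - p) ^+ (n - l) * p ^+ l)
    = l.+1%:R / n.+1%:R * ((1 - p) ^+ (n.+1 - l.+1) * p ^+ l.+1 *+ 'C(n.+1, l.+1)).
  have := mul_bin_diag n.+1 l; move/(congr1 (fun x => x%:R : R)); rewrite !natrM /= => E.
  have n0 : n.+1%:R != 0 :> R by rewrite pnatr_eq0.
  have -> : 'C(n, l)%:R = l.+1%:R * 'C(n.+1, l.+1)%:R / n.+1%:R :> R by rewrite -E mulrAC mulfV ?mul1r.
  by rewrite subSS exprS -[X in _ = _ * X]mulr_natr; field.
rewrite mulr_sumr; under eq_bigr => l _ do rewrite H.
have t0 (l : nat) : 0 <= (1 - p) ^+ (n.+1 - l) * p ^+ l *+ 'C(n.+1, l).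
  by rewrite mulrn_wge0// mulr_ge0// exprn_ge0// subr_ge0.
apply: (@le_trans _ _ (\sum_(l < k) k%:R / n.+1%:R *
    ((1 - p) ^+ (n.+1 - l.+1) * p ^+ l.+1 *+ 'C(n.+1, l.+1)))).
  apply: ler_sum => l _; apply: ler_wpM2r; first exact: t0.
  by rewrite ler_wpM2r ?invr_ge0// ler_nat.
rewrite -mulr_sumr ler_piMr ?divr_ge0//.
pose t l : R := (1 - p) ^+ (n.+1 - l) * p ^+ l *+ 'C(n.+1, l).
have E1 : 1 = \sum_(0 <= l < n.+2) t l.
  by rewrite big_mkord -exprDn subrK expr1n.
rewrite [leRHS]E1 -(big_mkord xpredT (fun l => t l.+1)) -(big_add1 _ _ 0%N k.+1 xpredT t).
case: k {H} => [|k]; first by rewrite big_geq//; apply: sumr_ge0 => i _; exact: t0.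
have [kn|nk] := leqP k.+2 n.+2.
  rewrite [leRHS](big_cat_nat (n := 1))//= [X in _ <= _ + X](big_cat_nat (n := k.+2))//=.
  by rewrite addrCA lerDl addr_ge0//; apply: sumr_ge0 => i _; exact: t0.
(* When the range overshoots [n.+1] successes, the additional binomial coefficients vanish. *)
rewrite [leLHS](big_cat_nat (n := n.+2))//=; last exact: ltnW.
rewrite [X in _ + X]big_nat_cond [X in _ + X]big1 ?addr0; last first.
  by move=> l; rewrite andbT => /andP[nl _]; rewrite /t bin_small.
rewrite [leRHS](big_cat_nat (n := 1))//= lerDr.
by apply: sumr_ge0 => i _; exact: t0.
Qed.

End SingleLevel.

(** * Limit laws of order statistics *)

Section Normalization.
Context {d : measure_display} {T : measurableType d} {R : realType}.
Context {P : probability T R}.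
Variables (X : nat -> {RV P >-> R}) (a b : nat -> R).

Definition level n x : R := x / a n + b n.

Lemma normalize_le n (m : \bar R) x : 0 < a n ->
  (normalize a b n m <= x%:E)%E = (m <= (level n x)%:E)%E.
Proof.
move=> an; rewrite /normalize /level; case: m => [r| |].
- rewrite -EFinB -EFinM !lee_fin -lerBlDr mulrC ler_pdivlMr//.
- by rewrite /= mulry gtr0_sg// mul1e.
- by rewrite /= mulrNy gtr0_sg// mul1e !leNye.
Qed.

Lemma sample_max_le n w x :
  (sample_max X n w <= x%:E)%E = all (fun i => X i w <= x) (iota 0 n).
Proof.
rewrite /sample_max; apply/idP/allP => [h i|h].
  rewrite mem_iota/= add0n => ni; rewrite -lee_fin; apply: le_trans h.
  by rewrite (bigD1 (Ordinal ni))//= le_max lexx.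
elim/big_rec: _ => [|i m _ hm]; first exact: leNye.
by rewrite ge_max hm lee_fin h// mem_iota/= ltn_ord.
Qed.

End Normalization.

(** * Exceedance patterns as combinations of half-lines *)

Section PatternSpan.
Context {R : realType} {I : finType}.
Variable x : I -> R.

(** The points with pattern [D] lie above the largest level of [D] and at or below the smallest
    level outside [D]: a half-line, a difference of two, or nothing. The coefficients do not depend
    on [y], so pattern probabilities inherit their asymptotics from the tails. The empty pattern
    would require a constant term. *)
Lemma exceed_span (D : {ffun I -> bool}) : D != nopattern ->
  exists k : I -> R, forall y : R,
    (exceed x y == D)%:R = \sum_j k j * (x j < y)%R%:R.
Proof.
move=> DN.
have [j0 Dj0] : exists j, D j.
  apply/existsP; apply: contraR DN; rewrite negb_exists => /forallP h.
  by apply/eqP/ffunP => j; rewrite ffunE; exact/negbTE/h.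
pose j1 := [arg max_(j > j0 | D j) x j]%O.
have [Dj1 j1max] : D j1 /\ forall j, D j -> x j <= x j1.
  by rewrite /j1; case: arg_maxP.
have single (j : I) (y : R) : \sum_i (i == j)%:R * (x i < y)%R%:R = (x j < y)%R%:R :> R.
  rewrite (bigD1 j)//= eqxx mul1r big1 ?addr0// => i ij.
  by rewrite (negPf ij) mul0r.
have eqD y : (exceed x y == D) = (x j1 < y) && [forall j, ~~ D j ==> (y <= x j)].
  apply/eqP/andP => [ED|[yj1 /forallP h]].
    split; first by move: Dj1; rewrite -ED ffunE.
    by apply/forallP => j; apply/implyP; rewrite -ED ffunE -leNgt.
  apply/ffunP => j; rewrite ffunE; have [Dj|NDj] := boolP (D j).
    exact: le_lt_trans (j1max j Dj) yj1.
  by apply/negbTE; rewrite -leNgt; exact: (implyP (h j)).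
have [j2' NDj2'|allD] := pickP (fun j => ~~ D j); last first.
  exists (fun j => (j == j1)%:R) => y; rewrite single eqD.
  suff -> : [forall j, ~~ D j ==> (y <= x j)] by rewrite andbT.
  by apply/forallP => j; rewrite allD.
pose j2 := [arg min_(j < j2' | ~~ D j) x j]%O.
have [NDj2 j2min] : ~~ D j2 /\ forall j, ~~ D j -> x j2 <= x j.
  by rewrite /j2; case: arg_minP.
have {}eqD y : (exceed x y == D) = (x j1 < y) && (y <= x j2).
  rewrite eqD; congr andb; apply/forallP/idP => [/(_ j2)|yj2 j].
    by rewrite NDj2.
  by apply/implyP => /j2min; exact: le_trans.
have [x21|x12] := leP (x j2) (x j1).
  exists (fun=> 0) => y; rewrite eqD big1; last by move=> j _; rewrite mul0r.
  case: andP => // -[h1 h2]; have := lt_le_trans h1 (le_trans h2 x21).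
  by rewrite ltxx.
exists (fun j => (j == j1)%:R - (j == j2)%:R) => y; rewrite eqD.
under eq_bigr => j _ do rewrite mulrBl.
rewrite sumrB !single; case: (leP y (x j2)) => [h|h].
  by rewrite andbT subr0.
by rewrite (lt_trans x12 h) subrr.
Qed.

End PatternSpan.

(** * Exceedance probabilities and limits of the counts *)

Section ExtremeLimits.
Context {d : measure_display} {T : measurableType d} {R : realType}.
Context {P : probability T R}.
Variables (X : nat -> {RV P >-> R}) (F G : cumulativeBounded (0 : R) (1 : R)).
Variables (a b : nat -> R).
Hypothesis iidX : iid_with_cdf X F.
Hypothesis a_gt0 : forall n, (1 <= n)%N -> 0 < a n.
Hypothesis cvgMax : forall x : R,
  P [set w | (normalize a b n (sample_max X n w) <= x%:E)%E] @[n --> \oo] --> (G x)%:E.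

Local Notation lev := (level a b).
Definition tail n x : R := 1 - F (lev n x).

Lemma cdf_ge0_le1 u : 0 <= F u <= 1.
Proof.
have := iidX.2 0%N u => E.
by rewrite -!lee_fin -E cdf_ge0 cdf_le1.
Qed.

Lemma E_le i u : \int[P]_w (X i w <= u)%R%:R = F u.
Proof.
have -> : (fun w => (X i w <= u)%R%:R : R) = \1_(X i @^-1` `]-oo, u]).
  apply/funext => w; rewrite indicE; congr (nat_of_bool _)%:R.
  by apply/idP/idP; rewrite inE /= in_itv/=.
rewrite E_indic; last by rewrite -[X in measurable X]setTI; exact: measurable_funPT.
have := iidX.2 i u; rewrite /cdf /distribution /pushforward => ->.
by [].
Qed.

Lemma E_gt i u : \int[P]_w (u < X i w)%R%:R = 1 - F u.
Proof.
rewrite -(E_le i u) -[X in _ = X - _](Ecst P 1) -EB.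
- by apply: eq_Rintegral => w _; case: ltP; rewrite ?subr0 ?subrr.
- exact: intg_cst.
- have -> : (fun w => (X i w <= u)%R%:R : R) = \1_(X i @^-1` `]-oo, u]).
    apply/funext => w; rewrite indicE; congr (nat_of_bool _)%:R.
    by apply/idP/idP; rewrite inE /= in_itv/=.
  apply: (@intg_bnd _ _ _ P _ 1).
    by apply: measurable_indic; rewrite -[X in measurable X]setTI; exact: measurable_funPT.
  by move=> w; rewrite indicE; case: (_ \in _); rewrite ?normr1 ?normr0.
Qed.

Lemma cvg_cdf_exp x : F (lev n x) ^+ n @[n --> \oo] --> G x.
Proof.
apply: (@cvg_eq_from _ 1 (fun n =>
  fine (P [set w | (normalize a b n (sample_max X n w) <= x%:E)%E]))); last first.
  exact: fine_cvg (@cvgMax x).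
move=> n n1.
have -> : [set w | (normalize a b n (sample_max X n w) <= x%:E)%E] =
    \bigcap_(i in [set` iota 0 n]) (X i @^-1` `]-oo, lev n x]).
  apply/seteqP; split=> w /=.
    rewrite normalize_le ?a_gt0// sample_max_le => /allP h i /= /h.
    by rewrite in_itv/=.
  move=> h; rewrite normalize_le ?a_gt0// sample_max_le; apply/allP => i /h.
  by rewrite /= in_itv/=.
rewrite iidX.1 ?iota_uniq//.
rewrite (eq_bigr (fun=> (F (lev n x))%:E)); last by move=> i _; exact: iidX.2.
rewrite prodEFin/= big_const_seq count_predT size_iota.
by rewrite iter_mulr_1.
Qed.

Lemma limit_cdf_ge0 x : 0 <= G x.
Proof.
apply: (cvgr_to_ge (@cvg_cdf_exp x)).
by near=> n; rewrite exprn_ge0//; case/andP: (cdf_ge0_le1 (lev n x)).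
Unshelve. all: by end_near. Qed.

Lemma tail_bounds n x : 0 <= tail n x <= 1.
Proof. rewrite /tail; have := cdf_ge0_le1 (lev n x); lra. Qed.

Section PositiveLimit.
Variable x : R.
Hypothesis Gx : 0 < G x.

Lemma cdf_level_gt0 : \forall n \near \oo, 0 < F (lev n x).
Proof.
near=> n.
have : 0 < F (lev n x) ^+ n by near: n; exact: (cvgr_gt _ (@cvg_cdf_exp x)).
have n0 : (0 < n)%N by near: n; exact: nbhs_infty_gt.
case/andP: (cdf_ge0_le1 (lev n x)); rewrite le_eqVlt => /predU1P[<-|//] _.
by rewrite expr0n gtn_eqF// ltxx.
Unshelve. all: by end_near. Qed.

Lemma cvg_ln_cdf_level : n%:R * - ln (F (lev n x)) @[n --> \oo] --> - ln (G x).
Proof.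
have h : ln (F (lev n x) ^+ n) @[n --> \oo] --> ln (G x).
  by apply: cvg_comp (@cvg_cdf_exp x) _; exact: continuous_ln.
have [N _ HN] := cdf_level_gt0.
apply: (@cvg_eq_from _ N (fun n => - ln (F (lev n x) ^+ n))); last exact: cvgN.
by move=> n /HN Fn; rewrite lnXn// mulrN mulr_natl.
Qed.

Lemma cvg_cdf_level : F (lev n x) @[n --> \oo] --> (1 : R).
Proof.
have [N _ HN] := cdf_level_gt0.
apply: (@cvg_eq_from _ (maxn N 1) (fun n => expR (- (n%:R * - ln (F (lev n x)) * n%:R^-1)))).
  move=> n; rewrite geq_max => /andP[/HN Fn n0].
  rewrite mulrAC mulfV ?pnatr_eq0 -?lt0n// mul1r opprK lnK//.
rewrite -[X in _ --> X]expR0 -[X in expR X]oppr0 -[X in - X](mulr0 (- ln (G x))).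
apply: (@cvg_comp _ _ _ (fun n => - (n%:R * - ln (F (lev n x)) * n%:R^-1)) expR).
  by apply: cvgN; apply: cvgM; [exact: cvg_ln_cdf_level|exact: cvg_invr_idn].
exact: continuous_expR.
Qed.

(** Squeezed by [- F * ln F <= 1 - F <= - ln F] at the level: both sides, multiplied by [n], have
    the same limit since [F] tends to 1 there. *)
Lemma cvg_tail : n%:R * tail n x @[n --> \oo] --> - ln (G x).
Proof.
have t1 := cvg_ln_cdf_level.
have t2 : F (lev n x) * (n%:R * - ln (F (lev n x))) @[n --> \oo] --> - ln (G x).
  by rewrite -[X in _ --> X]mul1r; apply: cvgM => //; exact: cvg_cdf_level.
apply: squeeze_cvgr t2 t1; near=> n.
have Fn : 0 < F (lev n x) by near: n; exact: cdf_level_gt0.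
have n0 : 0 <= n%:R :> R by [].
rewrite /tail mulrCA; apply/andP; split; apply: ler_wpM2l => //; last first.
  have := @le_ln1Dx R (F (lev n x) - 1); rewrite subrKC => h.
  by rewrite -[leLHS]opprB lerN2 h// ltrBrDl addrN.
have := @le_ln1Dx R ((F (lev n x))^-1 - 1); rewrite subrKC lnV//= => h.
have {h} : - ln (F (lev n x)) <= (F (lev n x))^-1 - 1.
  by apply: h; rewrite ltrBrDl addrN invr_gt0.
move=> h; apply: le_trans (ler_wpM2l (ltW Fn) h) _.
by rewrite mulrBr mulfV ?gt_eqF// mulr1.
Unshelve. all: by end_near. Qed.

End PositiveLimit.

(** If [n * tail] were below [K'], the power [F ^+ n] would be at least [expR (- (2 * K'))], while
    it tends to [G x = 0]. *)
Lemma tail_unbounded x : G x = 0 -> n%:R * tail n x @[n --> \oo] --> +oo.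
Proof.
move=> G0; apply/cvgryPge => K.
pose K' := Num.max K 1.
have K1 : 1 <= K' by rewrite le_max lexx orbT.
near=> n; rewrite leNgt; apply/negP => h.
have h' : n%:R * tail n x < K' by rewrite lt_max h.
have n2K : 2 * K' <= n%:R by near: n; exact: nbhs_infty_ger.
have n0 : 0 < n%:R :> R by lra.
have p2 : tail n x < 2^-1.
  rewrite -(ltr_pM2l n0); apply: lt_le_trans h' _; lra.
have /andP[p0 _] := tail_bounds n x.
have F1 : F (lev n x) = 1 - tail n x by rewrite /tail subKr.
have : F (lev n x) ^+ n < expR (- (2 * K')).
  near: n; apply: (cvgr_lt _ (@cvg_cdf_exp x)); rewrite G0; exact: expR_gt0.
apply/negP; rewrite -leNgt.
(* This is [1 - p >= expR (- 2 p)] for [p <= 1 / 2], by way of [(1 + 2 p) (1 - p) >= 1]. *)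
have e1 : expR (- (2 * tail n x)) <= F (lev n x).
  rewrite F1 expRN -[leRHS]invrK lef_pV2 ?posrE ?expR_gt0 ?invr_gt0//; last by lra.
  apply: le_trans (expR_ge1Dx _).
  rewrite -[leLHS]mul1r ler_pdivrMr; [nra|lra].
apply: (@le_trans _ _ (expR (- (2 * tail n x)) ^+ n)); last first.
  by rewrite lerXn2r// nnegrE ?expR_ge0// (le_trans _ e1)// expR_ge0.
rewrite -expRM_natl ler_expR; lra.
Unshelve. all: by end_near. Qed.

Lemma intg_gt i u : P.-integrable setT (EFin \o (fun w => (u < X i w)%R%:R : R)).
Proof.
have -> : (fun w => (u < X i w)%R%:R : R) = \1_(X i @^-1` `]u, +oo[).
  apply/funext => w; rewrite indicE; congr (nat_of_bool _)%:R.
  by apply/idP/idP; rewrite inE /= in_itv/= andbT.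
apply: (@intg_bnd _ _ _ P _ 1).
  by apply: measurable_indic; rewrite -[X in measurable X]setTI; exact: measurable_funPT.
by move=> w; rewrite indicE; case: (_ \in _); rewrite ?normr1 ?normr0.
Qed.

Lemma below_single_prob u s k : uniq s ->
  \int[P]_w below (fun=> k) (excess X (fun _ : unit => u) s [ffun=> 0%N] w) =
  \sum_(l < k) 'C(size s, l)%:R * F u ^+ (size s - l) * (1 - F u) ^+ l.
Proof.
move=> us; have [_ _ ->] := excess_distr iidX (fun _ : unit => u) us (below (fun=> k)) [ffun=> 0%N].
rewrite iter_step_single; apply: eq_bigr => l _; congr (_ * _ ^+ _ * _ ^+ _).
  rewrite -(E_le 0 u); apply: eq_Rintegral => w _; congr (nat_of_bool _)%:R.
  apply/eqP/idP => [/ffunP /(_ tt)|h]; first by rewrite !ffunE leNgt => ->.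
  by apply/ffunP => -[]; rewrite !ffunE; apply/negbTE; rewrite -leNgt.
rewrite -(E_gt 0 u); apply: eq_Rintegral => w _; congr (nat_of_bool _)%:R.
apply/eqP/idP => [/ffunP /(_ tt)|h]; first by rewrite !ffunE => ->.
by apply/ffunP => -[]; rewrite !ffunE.
Qed.

(** The bound is uniform in the level [u]. It drives both the vanishing of the events where [G] is 0
    and the decay of covariances. *)
Lemma below_single_bound u s k : uniq s ->
  (1 - F u) * \int[P]_w below (fun=> k) (excess X (fun _ : unit => u) s [ffun=> 0%N] w)
  <= k%:R / (size s).+1%:R.
Proof.
move=> us; rewrite below_single_prob//.
have : 0 <= 1 - F u <= 1 by have := cdf_ge0_le1 u; lra.
by move=> /(@single_level_bound _ _ k (size s)); rewrite subKr.
Qed.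

Lemma cvg_below_single x k : 0 < G x ->
  \int[P]_w below (fun=> k) (excess X (fun _ : unit => lev n x) (iota 0 n) [ffun=> 0%N] w)
    @[n --> \oo] --> G x * \sum_(l < k) (- ln (G x)) ^+ l / l`!%:R.
Proof.
move=> Gx.
pose q n (D : {ffun unit -> bool}) : R := if D == nopattern then F (lev n x) else tail n x.
have qN n : q n nopattern = F (lev n x) by rewrite /q eqxx.
have qA n : q n allpattern = tail n x.
  by rewrite /q; case: eqP => // /eqP; apply: contraTeq => _; rewrite unit_patternE.
pose tau (D : {ffun unit -> bool}) := - ln (G x).
have h := @cvg_iter_step_below R unit q tau (G x) _ _ _ (fun=> k) [ffun=> 0%N] k.+1.
(* The truncation index must strictly exceed the bound [k] on the count; the added term [l = k] is
   0. *)
have -> : \sum_(l < k) (- ln (G x)) ^+ l / l`!%:R =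
    \sum_(l < k.+1) iter l (jump tau) (below (fun=> k)) [ffun=> 0%N] / l`!%:R.
  rewrite big_ord_recr/= [iter k _ _ _]iter_jump_single ffunE add0n ltnn mulr0 mul0r addr0.
  by apply: eq_bigr => l _; rewrite iter_jump_single ffunE add0n ltn_ord mulr1.
apply: (@cvg_eq_from _ 0 (fun n => iter n (step (q n)) (below (fun=> k)) [ffun=> 0%N])).
  move=> n _; rewrite iter_step_single below_single_prob ?iota_uniq// size_iota.
  by apply: eq_bigr => l _; rewrite qN qA.
apply: h.
- move=> D; rewrite unit_patternE => /eqP ->.
  under eq_fun => n do rewrite qA; exact: cvg_tail.
- under eq_fun => n do rewrite qN; exact: cvg_cdf_exp.
- under eq_fun => n do rewrite qN; exact: cvg_cdf_level.
- by rewrite sum_nat_const card_unit mul1n.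
Qed.

Section Levels.
Variables (I : finType) (x : I -> R) (kap : I -> nat).

Definition levels n (j : I) : R := lev n (x j).

Definition belowX n s w : R := below kap (excess X (levels n) s [ffun=> 0%N] w).

Lemma belowXE n s w :
  belowX n s w = [forall j, (count (fun i => (levels n j < X i w)%R) s < kap j)%N]%:R.
Proof.
by congr (nat_of_bool _)%:R; apply: eq_forallb => j; rewrite !ffunE add0n.
Qed.

Lemma belowX_ge0 n s w : 0 <= belowX n s w.
Proof. by rewrite /belowX /below. Qed.

Lemma belowX_le1 n s w : belowX n s w <= 1.
Proof. by rewrite /belowX /below; case: [forall _, _]. Qed.

Lemma belowX_le_single n s w j :
  belowX n s w <= below (fun=> kap j) (excess X (fun _ : unit => levels n j) s [ffun=> 0%N] w).
Proof.
rewrite belowXE /below; case: forallP => [h|_]; last by [].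
rewrite (_ : [forall _, _] = true)//; apply/forallP => -[].
by rewrite ffunE ffunE add0n h.
Qed.

Lemma intg_belowX n s : uniq s -> P.-integrable setT (EFin \o belowX n s).
Proof.
by move=> us; have [] := excess_distr iidX (levels n) us (below kap) [ffun=> 0%N].
Qed.

(** Level [j] alone suffices: the probability is at most [kap j] over [n * tail n (x j)], and the
    denominator tends to infinity. *)
Lemma cvg_belowX_zero j : G (x j) = 0 ->
  \int[P]_w belowX n (iota 0 n) w @[n --> \oo] --> (0 : R).
Proof.
move=> Gj0; have tinf := tail_unbounded Gj0.
have up : (kap j)%:R * (n%:R * tail n (x j))^-1 @[n --> \oo] --> (0 : R).
  rewrite -(mulr0 (kap j)%:R); apply: cvgMl_tmp.
  apply/gtr0_cvgV0 => //; near=> n.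
  by near: n; move/cvgryPgt : tinf; apply.
apply: (squeeze_cvgr _ (cvg_cst (0 : R)) up); near=> n.
rewrite Rintegral_ge0/=; last by move=> w _; exact: belowX_ge0.
have tp : 0 < n%:R * tail n (x j) by near: n; move/cvgryPgt : tinf; apply.
have n0 : (0 < n)%N by near: n; exact: nbhs_infty_gt.
have n0R : 0 < n%:R :> R by rewrite ltr0n.
have t0 : 0 < tail n (x j) by rewrite -(pmulr_rgt0 _ n0R).
have us := iota_uniq 0 n.
apply: (@le_trans _ _ (\int[P]_w below (fun=> kap j)
    (excess X (fun _ : unit => levels n j) (iota 0 n) [ffun=> 0%N] w))).
  apply: Ele; [exact: intg_belowX| |by move=> w; exact: belowX_le_single].
  by have [] := excess_distr iidX (fun _ : unit => levels n j) us (below (fun=> kap j)) [ffun=> 0%N].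
rewrite ler_pdivlMr// mulrC -mulrA.
have := @below_single_bound (levels n j) _ (kap j) us; rewrite size_iota => h.
apply: le_trans (ler_wpM2l (ltW n0R) h) _.
rewrite mulrCA ler_piMr// ler_pdivrMr// mul1r ler_nat//.
Unshelve. all: by end_near. Qed.

(** The limit is the Poisson expression with intensities obtained by replacing tails by
    [- ln (G (x j))] in the decomposition of each pattern. As [a n > 0], the levels are increasing
    affine images of [x], so this decomposition is the same for all [n]. *)
Lemma cvg_belowX_pos (j0 : I) : (forall j, 0 < G (x j)) ->
  exists H, \int[P]_w belowX n (iota 0 n) w @[n --> \oo] --> (H : R).
Proof.
move=> Gx.
pose q n := pattern_prob X (levels n).
have lev_lt n y j : (0 < n)%N -> (levels n j < y) = (x j < a n * (y - b n)).
  by move=> /a_gt0 an; rewrite /levels /level -ltrBrDr ltr_pdivrMr// mulrC.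
have /choice[kD hk] : forall D, exists k : I -> R, D != nopattern ->
    forall n, (0 < n)%N -> q n D = \sum_j k j * tail n (x j).
  move=> D; have [->|DN] := eqVneq D nopattern; first by exists (fun=> 0).
  have [k hk] := exceed_span x DN; exists k => _ n n0.
  rewrite /q /pattern_prob.
  transitivity (\int[P]_w (\sum_j k j * (levels n j < X 0%N w)%R%:R)).
    apply: eq_Rintegral => w _.
    have -> : exceed (levels n) (X 0%N w) = exceed x (a n * (X 0%N w - b n)).
      by apply/ffunP => j; rewrite !ffunE lev_lt.
    by rewrite hk; apply: eq_bigr => j _; rewrite lev_lt.
  rewrite Esum; last by move=> j; apply: intgZ; exact: intg_gt.
  by apply: eq_bigr => j _; rewrite EZ ?E_gt//; exact: intg_gt.
(* No level is exceeded exactly when the lowest one is not; [j0] witnesses that there is a lowest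
   one. *)
pose jm := [arg min_(j < j0) x j]%O.
have jmin j : x jm <= x j by rewrite /jm; case: arg_minP => // i _; apply.
have qN n : (0 < n)%N -> q n nopattern = F (lev n (x jm)).
  move=> n0; rewrite -(E_le 0 (lev n (x jm))); apply: eq_Rintegral => w _.
  congr (nat_of_bool _)%:R; apply/eqP/idP => [/ffunP /(_ jm)|h].
    by rewrite !ffunE leNgt => /negbT.
  apply/ffunP => j; rewrite !ffunE; apply/negbTE; rewrite -leNgt.
  apply: le_trans h _; rewrite /levels /level lerD2r ler_wpM2r//.
  by rewrite invr_ge0 ltW// a_gt0.
eexists; apply: (@cvg_eq_from _ 0
    (fun n => iter n (step (q n)) (below kap) [ffun=> 0%N])) => [n _|].
  have [_ _ ->] := excess_distr iidX (levels n) (iota_uniq 0 n) (below kap) [ffun=> 0%N].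
  by rewrite size_iota.
apply: (@cvg_iter_step_below _ _ _ (fun D => \sum_j kD D j * - ln (G (x j))) (G (x jm))).
- move=> D DN; apply: (@cvg_eq_from _ 1 (fun n => \sum_j kD D j * (n%:R * tail n (x j)))).
    by move=> n n0; rewrite (hk D DN n n0) mulr_sumr; apply: eq_bigr => j _; rewrite mulrCA.
  by apply: cvg_sumr => j _; apply: cvgMl_tmp; exact: cvg_tail.
- apply: (@cvg_eq_from _ 1 _ _ _ _ (@cvg_cdf_exp (x jm))) => n n0.
  by rewrite qN.
- apply: (@cvg_eq_from _ 1 _ _ _ _ (@cvg_cdf_level _ (Gx jm))) => n n0.
  by rewrite qN.
- exact: ltnSn.
Qed.

End Levels.

End ExtremeLimits.

(** * Joint limit with the partial sums *)

Section SmallEvents.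
Context {d : measure_display} {T : measurableType d} {R : realType}.
Variable P : probability T R.

(** Absolute continuity of the integral. Applied to the square of [X 0], it replaces any moment
    beyond the second. *)
Lemma cvg_E_small_events (g : T -> R) (A : nat -> set T) :
  P.-integrable setT (EFin \o g) -> (forall w, 0 <= g w) ->
  (forall n, measurable (A n)) -> fine (P (A n)) @[n --> \oo] --> (0 : R) ->
  \int[P]_w (\1_(A n) w * g w) @[n --> \oo] --> (0 : R).
Proof.
move=> ig g0 mA PA0; apply/cvgr0Pnorm_lt => e e0.
have [dl [dl0 H]] := integral_normr_continuous ig e0.
near=> n.
have -> : \int[P]_w (\1_(A n) w * g w) = \int[P]_(w in A n) `|g w|.
  rewrite [RHS]Rintegral_mkcond; apply: eq_Rintegral => w _; rewrite patchE indicE.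
  by case: ifP => _; rewrite ?mul1r ?mul0r// ger0_norm.
rewrite ger0_norm; last by apply: Rintegral_ge0.
apply: H => //; rewrite -[X in (X < _)%E]fineK ?fin_num_measure// lte_fin.
near: n; exact: (cvgr_lt _ PA0).
Unshelve. all: by end_near. Qed.

End SmallEvents.

Section Moments.
Context {d : measure_display} {T : measurableType d} {R : realType}.
Context {P : probability T R}.
Variables (X : nat -> {RV P >-> R}) (F : cumulativeBounded (0 : R) (1 : R)).
Hypothesis iidX : iid_with_cdf X F.
Hypothesis EX : ('E_P[X 0%N] = 0)%E.
Hypothesis EX2 : ('E_P[(fun w => (X 0%N w ^+ 2)%R)] = 1)%E.

Local Notation intg f := (P.-integrable setT (EFin \o f)).
Local Notation sigX K := (g_sigma_algebraType (cylinders X K)).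

Lemma meas_sq : measurable_fun setT (fun x : R => x ^+ 2).
Proof. by apply: measurable_funX. Qed.

Lemma intg_sq i : intg (fun w => X i w ^+ 2).
Proof.
apply: (@ident_distr_integrable _ _ _ _ X F iidX.2 i (fun x => x ^+ 2)).
  exact: meas_sq.
have mX2 : measurable_fun setT (fun w => X 0%N w ^+ 2).
  by apply: (measurableT_comp meas_sq); exact: measurable_funPT.
apply/integrableP; split; first exact/measurable_EFinP.
rewrite (_ : (\int[P]_w `| _ |)%E = 1%E) ?ltry//.
move: EX2; rewrite unlock => <-; apply: eq_integral => w _ /=.
by rewrite ger0_norm// sqr_ge0.
Qed.

Lemma intg_X i : intg (X i).
Proof.
apply: (@intg_le _ _ _ P _ (fun w => 1 + X i w ^+ 2)); first exact: measurable_funPT.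
  move=> w; have := sqr_ge0 (`|X i w| - 1); rewrite sqrrB real_normK ?num_real//.
  have := normr_ge0 (X i w); have := sqr_ge0 (X i w); lra.
by apply: intgD; [exact: intg_cst|exact: intg_sq].
Qed.

Lemma E_X i : \int[P]_w X i w = 0.
Proof.
rewrite (@ident_distr_Rintegral _ _ _ _ X F iidX.2 i id)//; last exact: intg_X.
by rewrite /Rintegral; move: EX; rewrite unlock => ->.
Qed.

Lemma E_sq i : \int[P]_w (X i w ^+ 2) = 1.
Proof.
rewrite (@ident_distr_Rintegral _ _ _ _ X F iidX.2 i (fun x => x ^+ 2))//.
  by rewrite /Rintegral; move: EX2; rewrite unlock => ->.
exact: (intg_sq 0).
Qed.

Lemma partial_sumS n w : partial_sum X n.+1 w = partial_sum X n w + X n w.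
Proof. by rewrite /partial_sum big_ord_recr. Qed.

Lemma measurable_partial_sum n K : (forall i, (i < n)%N -> K i) ->
  measurable_fun [set: sigX K] (partial_sum X n : sigX K -> R).
Proof.
elim: n => [_|n IH nK].
  have -> : partial_sum X 0 = cst 0 by apply/funext => w; rewrite /partial_sum big_ord0.
  exact: measurable_cst.
have -> : partial_sum X n.+1 = fun w => partial_sum X n w + X n w.
  by apply/funext => w; exact: partial_sumS.
apply: measurable_funD; first by apply: IH => i ni; apply: nK; exact: ltnW.
by apply: measurable_sigX; exact: nK.
Qed.

Lemma intg_partial_sum n : intg (partial_sum X n).
Proof. by apply: intg_sum => i; exact: intg_X. Qed.

Lemma E_partial_sum_sq n :
  intg (fun w => partial_sum X n w ^+ 2) /\ \int[P]_w (partial_sum X n w ^+ 2) = n%:R.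
Proof.
elim: n => [|n [IH1 IH2]].
  have -> : (fun w => partial_sum X 0 w ^+ 2) = cst 0.
    by apply/funext => w; rewrite /partial_sum big_ord0 expr0n.
  by split; [exact: intg_cst|exact: Ecst].
have [i1 e1] : intg (fun w => partial_sum X n w * X n w) /\
    \int[P]_w (partial_sum X n w * X n w) = \int[P]_w partial_sum X n w * \int[P]_w X n w.
  apply: (@sigX_indep_expectation _ _ _ _ X iidX.1 [set k | (k < n)%N] [set n]).
  - by apply/seteqP; split => // k [/= kn kE]; move: kn; rewrite kE ltnn.
  - by apply: measurable_partial_sum.
  - exact: measurable_sigX.
  - exact: intg_partial_sum.
  - exact: intg_X.
have E w : partial_sum X n.+1 w ^+ 2 =
    (partial_sum X n w ^+ 2 + 2 * (partial_sum X n w * X n w)) + X n w ^+ 2.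
  by rewrite partial_sumS; ring.
have -> : (fun w => partial_sum X n.+1 w ^+ 2) = fun w =>
    (partial_sum X n w ^+ 2 + 2 * (partial_sum X n w * X n w)) + X n w ^+ 2.
  by apply/funext.
have i2 := intgD IH1 (intgZ 2 i1).
split; first by apply: (intgD i2); exact: intg_sq.
rewrite (ED i2 (intg_sq n)) (ED IH1 (intgZ 2 i1)) EZ// e1 IH2 E_X E_sq mulr0 mulr0 addr0.
by rewrite -natr1.
Qed.

(** Cauchy-Schwarz in pointwise form: [|z| <= z ^+ 2 / (2 * q) + q / 2] with [q] the square root of
    [n], where both halves integrate to [q / 2]. *)
Lemma E_norm_partial_sum n : \int[P]_w `|partial_sum X n w| <= Num.sqrt n%:R.
Proof.
have [i1 e1] := E_partial_sum_sq n.
case: n i1 e1 => [|n] i1 e1.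
  rewrite sqrtr0; under eq_Rintegral => w _ do rewrite /partial_sum big_ord0 normr0.
  by rewrite Ecst.
set q := Num.sqrt _; have q0 : 0 < q by rewrite sqrtr_gt0.
have qq : q ^+ 2 = n.+1%:R by rewrite sqr_sqrtr.
apply: (@le_trans _ _ (\int[P]_w ((2 * q)^-1 * partial_sum X n.+1 w ^+ 2 + q / 2))).
  apply: Ele.
  - by apply: intg_norm; exact: intg_partial_sum.
  - by apply: intgD; [exact: intgZ|exact: intg_cst].
  move=> w; set z := partial_sum _ _ _; have := sqr_ge0 (`|z| - q).
  rewrite sqrrB real_normK ?num_real// => h.
  rewrite -(ler_pM2l (_ : 0 < 2 * q)) ?mulr_gt0// mulrDr mulVKf ?gt_eqF ?mulr_gt0//.
  have -> : 2 * q * (q / 2) = q ^+ 2 by field.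
  nra.
rewrite ED//; [|exact: intgZ|exact: intg_cst].
rewrite EZ// Ecst e1 -qq.
have -> : (2 * q)^-1 * q ^+ 2 = q / 2 by field; rewrite gt_eqF.
by rewrite -splitr.
Qed.


(** * Exchange of one observation for a Gaussian *)

Section LindebergSwap.
Variables (y s0 C : R) (A B : R -> R -> R).
Hypothesis s0_gt0 : 0 < s0.
Hypothesis C_ge0 : 0 <= C.
Hypothesis heatAB : forall s, s0 <= s ->
    [/\ continuous (A s), continuous (B s),
        forall x, `|A s x| <= C, forall x, `|B s x| <= C &
        forall x h dl : R, 0 <= dl ->
        `|heat y s (x + h) - heat y (s + dl) x - (A s x * h + B s x * (h ^+ 2 - dl))|
        <= C * (Num.min (`|h| ^+ 3) (`|h| ^+ 2) + dl ^+ 2)].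
Variables (n : nat) (f g : T -> R) (i : nat) (s M : R) (I : finType) (u : I -> R).
Hypotheses (n_gt0 : (0 < n)%N) (s0s : s0 <= s) (M_ge0 : 0 <= M).
Hypotheses (mf : measurable_fun setT f) (f0 : forall w, 0 <= f w) (f1 : forall w, f w <= 1).
Hypotheses (mg : measurable_fun [set: sigX [set k | k != i]] (g : sigX [set k | k != i] -> R))
  (g1 : forall w, `|g w| <= 1).
Hypothesis fg : forall w, `|f w - g w| <= \sum_j (u j < X i w)%R%:R.

Local Notation q := (Num.sqrt (n%:R : R)).
Local Notation x := (fun w => partial_sum X i w / q).
Local Notation h := (fun w => X i w / q).

Let q0 : 0 < q. Proof. by rewrite sqrtr_gt0 ltr0n. Qed.

Let qq : q ^+ 2 = n%:R :> R.
Proof. by rewrite sqr_sqrtr ?ler0n. Qed.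

Let mx : measurable_fun [set: sigX [set k | k != i]] (x : sigX [set k | k != i] -> R).
Proof.
apply: measurable_funM; last exact: measurable_cst.
by apply: measurable_partial_sum => k /= ki; rewrite neq_ltn ki.
Qed.

Let mcomp (D : R -> R) : continuous D ->
  measurable_fun [set: sigX [set k | k != i]] ((fun w => D (x w)) : sigX [set k | k != i] -> R).
Proof.
move=> /continuous_measurable_fun mD.
exact: (measurableT_comp mD mx).
Qed.

Let disj : [set k | k != i] `&` [set i] = set0 :> set nat.
Proof. by apply/seteqP; split => // k [/= ki kE]; move: ki; rewrite kE eqxx. Qed.

Let mXX : measurable_fun [set: sigX [set i]] (X i : sigX [set i] -> R).
Proof. exact: measurable_sigX. Qed.

Let intgh : intg h.
Proof.
have -> : h = (fun w => q^-1 * X i w) by apply/funext => w; rewrite mulrC.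
exact/intgZ/intg_X.
Qed.

Let intgh2 : intg (fun w => h w ^+ 2 - n%:R^-1).
Proof.
apply: intgB; last exact: intg_cst.
have -> : (fun w => h w ^+ 2) = (fun w => n%:R^-1 * X i w ^+ 2).
  by apply/funext => w; rewrite expr_div_n qq mulrC.
exact/intgZ/intg_sq.
Qed.

(* Independence kills the drift: [h] is centred and [h ^+ 2] has mean [1 / n]. *)
Lemma E_swap_main :
  intg (fun w => g w * (A s (x w) * h w + B s (x w) * (h w ^+ 2 - n%:R^-1))) /\
  \int[P]_w (g w * (A s (x w) * h w + B s (x w) * (h w ^+ 2 - n%:R^-1))) = 0.
Proof.
have [cA cB bA bB _] := heatAB s0s.
have term (D : R -> R) (z : R -> R) : continuous D -> (forall t, `|D t| <= C) ->
    measurable_fun setT z -> intg (fun w => z (X i w)) -> \int[P]_w z (X i w) = 0 ->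
    intg (fun w => (g w * D (x w)) * z (X i w)) /\
    \int[P]_w ((g w * D (x w)) * z (X i w)) = 0.
  move=> cD bD mz iz z0.
  have mgD : measurable_fun [set: sigX [set k | k != i]]
      ((fun w => g w * D (x w)) : sigX [set k | k != i] -> R).
    by apply: measurable_funM => //; exact: mcomp.
  have := @sigX_indep_expectation _ _ _ _ X iidX.1 _ _
    (fun w => g w * D (x w)) (fun w => z (X i w)) disj mgD.
  rewrite z0 mulr0; apply => //.
    exact: (measurableT_comp mz mXX).
  apply: (@intg_bnd _ _ _ P _ C); first exact: measurable_sigXT mgD.
  by move=> w; rewrite normrM -[C]mul1r ler_pM.
have mz1 : measurable_fun setT (fun t : R => t / q).
  by apply: measurable_funM => //; exact: measurable_cst.
have z1 : \int[P]_w (X i w / q) = 0.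
  have -> : (fun w => X i w / q) = (fun w => q^-1 * X i w) by apply/funext => w; rewrite mulrC.
  by rewrite EZ ?(E_X)// ?mulr0//; exact: intg_X.
have [i1 e1] := @term (A s) (fun t => t / q) cA bA mz1 intgh z1.
have mz2 : measurable_fun setT (fun t : R => (t / q) ^+ 2 - n%:R^-1).
  apply: measurable_funB; last exact: measurable_cst.
  by apply: measurable_funX; apply: measurable_funM => //; exact: measurable_cst.
have z2 : \int[P]_w ((X i w / q) ^+ 2 - n%:R^-1) = 0.
  have -> : (fun w => (X i w / q) ^+ 2 - n%:R^-1) = (fun w => n%:R^-1 * X i w ^+ 2 - n%:R^-1).
    by apply/funext => w; rewrite expr_div_n qq mulrC.
  rewrite EB ?Ecst; [|exact/intgZ/intg_sq|exact: intg_cst].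
  by rewrite EZ ?E_sq ?mulr1 ?subrr//; exact: intg_sq.
have [i2 e2] := @term (B s) (fun t => (t / q) ^+ 2 - n%:R^-1) cB bB mz2 intgh2 z2.
have -> : (fun w => g w * (A s (x w) * h w + B s (x w) * (h w ^+ 2 - n%:R^-1))) =
   fun w => (g w * A s (x w)) * (X i w / q) + (g w * B s (x w)) * ((X i w / q) ^+ 2 - n%:R^-1).
  by apply/funext => w; ring.
by split; [exact: intgD|rewrite ED// e1 e2 addr0].
Qed.

(** In use, [f] is the event on all observations and [g] the same event without observation [i]. The
    sum over [j] pays for the set where they differ; [M / q] is the cubic remainder for
    [|X i| <= M], the truncated second moment is the quadratic remainder beyond [M], and the last
    term is the time remainder. The prefactor [1 / n] allows [n] exchanges. *)
Definition swap_error : R := C / n%:R *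
  (\sum_j \int[P]_w ((u j < X i w)%R%:R * (q * `|X i w| + X i w ^+ 2 + 1))
   + M / q + \int[P]_w (\1_[set w | M < `|X i w|] w * X i w ^+ 2) + n%:R^-1).

Let mgt (c : R) : measurable_fun setT (fun w => (c < X i w)%R%:R : R).
Proof.
have -> : (fun w => (c < X i w)%R%:R : R) = \1_(X i @^-1` `]c, +oo[).
  apply/funext => w; rewrite indicE; congr (nat_of_bool _)%:R.
  by apply/idP/idP; rewrite inE /= in_itv/= andbT.
by apply: measurable_indic; rewrite -[X in measurable X]setTI; exact: measurable_funPT.
Qed.

Let bool1 (c : bool) : `|c%:R : R| <= 1.
Proof. by case: c; rewrite ?normr1 ?normr0. Qed.

Let intgE1 j : intg (fun w => (u j < X i w)%R%:R * (q * `|X i w| + X i w ^+ 2 + 1)).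
Proof.
apply: (@intg_bndM _ _ _ P _ _ 1); [exact: mgt|by move=> w; exact: bool1|].
apply: intgD; last exact: intg_cst.
by apply: intgD; [apply/intgZ/intg_norm; exact: intg_X|exact: intg_sq].
Qed.

Lemma measurable_big_X : measurable [set w | M < `|X i w|].
Proof.
have -> : [set w | M < `|X i w|] = (fun w => `|X i w|) @^-1` `]M, +oo[.
  by apply/seteqP; split=> w /=; rewrite in_itv/= andbT.
rewrite -[X in measurable X]setTI; apply: measurableT_comp => //.
Qed.

Let intgE2 : intg (fun w => \1_[set w | M < `|X i w|] w * X i w ^+ 2).
Proof.
apply: (@intg_bndM _ _ _ P _ _ 1); last exact: intg_sq.
  by apply: measurable_indic; exact: measurable_big_X.
by move=> w; rewrite indicE.
Qed.

(** The integrand of the difference is [f * r + (f - g) * L + g * L] with [r] the Taylor remainder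
    and [L] the main part. The last product has mean zero because [g] and the earlier partial sum
    are independent of [X i]. *)
Lemma swap_bound :
  `|\int[P]_w (f w * heat y s (x w + h w)) - \int[P]_w (f w * heat y (s + n%:R^-1) (x w))|
  <= swap_error.
Proof.
have [cA cB bA bB tay] := heatAB s0s.
have [im em] := E_swap_main.
have n0 : 0 < n%:R :> R by rewrite ltr0n.
have mxT : measurable_fun setT (fun w => x w).
  by have := measurable_sigXT mx.
have mhT : measurable_fun setT (fun w => h w).
  by apply: measurable_funM => //; exact: measurable_cst.
have ih s' (z : T -> R) : measurable_fun setT z -> intg (fun w => f w * heat y s' (z w)).
  move=> mz; apply: (@intg_bnd _ _ _ P _ 1).
    apply: measurable_funM => //; apply: (measurableT_comp _ mz).
    by apply: continuous_measurable_fun; exact: continuous_heat.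
  move=> w; rewrite ger0_norm ?mulr_ge0 ?heat_ge0// -[1]mulr1 ler_pM ?heat_ge0//.
  exact: heat_le1.
have i1 := ih s (fun w => x w + h w) (measurable_funD mxT mhT).
have i2 := ih (s + n%:R^-1) (fun w => x w) mxT.
rewrite -(EB i1 i2) -[X in `|X|]subr0 -em -(EB (intgB i1 i2) im).
have -> : swap_error = \int[P]_w (C / n%:R *
  (\sum_j (u j < X i w)%R%:R * (q * `|X i w| + X i w ^+ 2 + 1)
   + ((M / q) * X i w ^+ 2 + \1_[set w | M < `|X i w|] w * X i w ^+ 2 + n%:R^-1))).
  have I1 : intg (fun w => \sum_j (u j < X i w)%R%:R * (q * `|X i w| + X i w ^+ 2 + 1)).
    by apply: intg_sum => j; exact: intgE1.
  have I2 : intg (fun w => (M / q) * X i w ^+ 2) by exact/intgZ/intg_sq.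
  have I3 := intg_cst P (n%:R^-1).
  have I4 := intgD I2 intgE2.
  have I5 := intgD I4 I3.
  rewrite (EZ _ (intgD I1 I5)) (ED I1 I5) (ED I4 I3) (ED I2 intgE2) Ecst EZ; last exact: intg_sq.
  by rewrite E_sq mulr1 Esum// /swap_error !addrA.
apply: Ele_norm.
- exact: intgB (intgB i1 i2) im.
- apply: intgZ; apply: intgD; first by apply: intg_sum => j; exact: intgE1.
  apply: intgD; last exact: intg_cst.
  by apply: intgD; [exact/intgZ/intg_sq|exact: intgE2].
move=> w; set xw := x w; set hw := h w.
have hX : `|hw| = `|X i w| / q by rewrite /hw normrM normfV (gtr0_norm q0).
have h2 : hw ^+ 2 = X i w ^+ 2 / n%:R by rewrite /hw expr_div_n qq.
have := tay xw hw n%:R^-1; rewrite invr_ge0 ler0n => /(_ isT).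
set r := heat _ _ _ - _ - _; set m := Num.min _ _.
set L := A s xw * hw + B s xw * (hw ^+ 2 - n%:R^-1) => rb.
have -> : f w * heat y s (xw + hw) - f w * heat y (s + n%:R^-1) xw - g w * L =
   f w * r + (f w - g w) * L by rewrite /r /L; ring.
have Lb : `|L| <= C / n%:R * (q * `|X i w| + X i w ^+ 2 + 1).
  rewrite /L; apply: le_trans (ler_normD _ _) _; rewrite (normrM (A s xw)) (normrM (B s xw)).
  have -> : C / n%:R * (q * `|X i w| + X i w ^+ 2 + 1) =
     C * `|hw| + C * (hw ^+ 2 + n%:R^-1).
    have qn : q / n%:R = q^-1 by rewrite -[X in _ / X]qq expr2 invfM mulVKf// gt_eqF.
    by rewrite hX h2 -[in RHS]qn; ring.
  apply: lerD; first by apply: ler_wpM2r.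
  apply: ler_pM => //; apply: le_trans (ler_normB _ _) _.
  by rewrite ger0_norm ?sqr_ge0// ger0_norm// invr_ge0.
(* For [|X i| <= M] the cube of [h] is at most [M / q] times its square; beyond [M] the square is
   used. *)
have mb : m <= (M / q * X i w ^+ 2 + \1_[set w | M < `|X i w|] w * X i w ^+ 2) / n%:R.
  rewrite indicE; have [XM|XM] := leP `|X i w| M.
    rewrite memNset ?mul0r ?addr0; last by rewrite /= ltNge XM.
    apply: (@le_trans _ _ (`|hw| ^+ 3)); first by rewrite ge_min lexx.
    rewrite exprS real_normK ?num_real// h2 hX mulrA; apply: ler_wpM2r.
      by rewrite invr_ge0.
    by apply: ler_wpM2r; [exact: sqr_ge0|apply: ler_wpM2r => //; rewrite invr_ge0 ltW].
  rewrite mem_set// mul1r; apply: (@le_trans _ _ (`|hw| ^+ 2)).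
    by rewrite ge_min lexx orbT.
  rewrite real_normK ?num_real// h2; apply: ler_wpM2r; first by rewrite invr_ge0.
  by rewrite lerDr mulr_ge0 ?sqr_ge0// divr_ge0// ltW.
apply: le_trans (ler_normD _ _) _; rewrite [leLHS]addrC [leRHS]mulrDr; apply: lerD.
  rewrite -mulr_suml (normrM (f w - g w) L) [leRHS]mulrCA.
  by apply: ler_pM.
rewrite (normrM (f w) r); apply: (@le_trans _ _ (1 * `|r|)).
  by apply: ler_wpM2r => //; rewrite ger0_norm.
rewrite mul1r; apply: le_trans rb _; rewrite -[leRHS]mulrA; apply: ler_wpM2l => //.
by rewrite [leRHS]mulrC [leRHS]mulrDl expr2; apply: lerD.
Qed.

End LindebergSwap.

End Moments.

(** * Decoupling the order statistics from the sum *)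

Section JointLimit.
Context {d : measure_display} {T : measurableType d} {R : realType}.
Context {P : probability T R}.
Variables (X : nat -> {RV P >-> R}) (F G : cumulativeBounded (0 : R) (1 : R)).
Variables (a b : nat -> R).
Hypothesis iidX : iid_with_cdf X F.
Hypothesis EX : ('E_P[X 0%N] = 0)%E.
Hypothesis EX2 : ('E_P[(fun w => (X 0%N w ^+ 2)%R)] = 1)%E.
Hypothesis a_gt0 : forall n, (1 <= n)%N -> 0 < a n.
Hypothesis cvgMax : forall x : R,
  P [set w | (normalize a b n (sample_max X n w) <= x%:E)%E] @[n --> \oo] --> (G x)%:E.
Variables (I : finType) (x : I -> R) (kap : I -> nat).

Local Notation intg f := (P.-integrable setT (EFin \o f)).
Local Notation sigX K := (g_sigma_algebraType (cylinders X K)).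
Local Notation lvl := (levels a b x).
Local Notation bel := (belowX X a b x kap).

Lemma ind_funE (i : nat) (c : R) (w : T) :
  \1_[set w | c < `|X i w|] w = (c < `|X i w|)%R%:R :> R.
Proof. by rewrite indicE; congr (nat_of_bool _)%:R; apply/idP/idP; rewrite inE. Qed.

Lemma meas_gt (c : R) : measurable_fun setT (fun t : R => (c < t)%R%:R : R).
Proof.
have -> : (fun t => (c < t)%R%:R : R) = \1_`]c, +oo[.
  apply/funext => t; rewrite indicE; congr (nat_of_bool _)%:R.
  by apply/idP/idP; rewrite inE /= in_itv/= andbT.
exact: measurable_indic.
Qed.

Lemma bool_norm1 (c : bool) : `|c%:R : R| <= 1.
Proof. by case: c; rewrite ?normr1 ?normr0. Qed.

(** The error sees observation [i] only through its law, so [n] exchanges cost [n] times one fixed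
    error. *)
Lemma swap_errorE C n i M (u : I -> R) : swap_error X C n i M u = swap_error X C n 0 M u.
Proof.
rewrite /swap_error; congr (_ * _); congr (_ + _); congr (_ + _); first congr (_ + _).
  apply: eq_bigr => j _.
  pose g (t : R) := (u j < t)%R%:R * (Num.sqrt n%:R * `|t| + t ^+ 2 + 1) : R.
  have mg : measurable_fun setT g.
    apply: measurable_funM; first exact: meas_gt.
    apply: measurable_funD; last exact: measurable_cst.
    apply: measurable_funD; last exact: meas_sq.
    apply: measurable_funM; first exact: measurable_cst.
    exact: normr_measurable.
  apply: (@ident_distr_Rintegral _ _ _ _ X F iidX.2 i g mg).
  apply: (@intg_bndM _ _ _ P _ _ 1).
  - exact: (measurableT_comp (meas_gt (u j))).
  - by move=> w; exact: bool_norm1.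
  apply: intgD; last exact: intg_cst.
  by apply: intgD; [apply/intgZ/intg_norm; exact: (intg_X iidX EX2)|exact: (intg_sq iidX EX2)].
pose g (t : R) := (M < `|t|)%R%:R * t ^+ 2 : R.
have mM : measurable_fun setT (fun t : R => (M < `|t|)%R%:R : R).
  by apply: (measurableT_comp (meas_gt M)); exact: normr_measurable.
have mg : measurable_fun setT g by apply: measurable_funM => //; exact: meas_sq.
under eq_Rintegral => w _ do rewrite ind_funE.
under [RHS]eq_Rintegral => w _ do rewrite ind_funE.
apply: (@ident_distr_Rintegral _ _ _ _ X F iidX.2 i g mg).
apply: (@intg_bndM _ _ _ P _ _ 1); last exact: (intg_sq iidX EX2).
- exact: (measurableT_comp mM).
- by move=> w; exact: bool_norm1.
Qed.

Lemma belowX_swap n i w : `|bel n (iota 0 n) w - bel n [seq k <- iota 0 n | k != i] w|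
  <= \sum_j (lvl n j < X i w)%R%:R.
Proof.
have [/existsP[j uj]|/existsPn h] := boolP [exists j, lvl n j < X i w].
  apply: (@le_trans _ _ 1).
    rewrite !belowXE; case: [forall _, _]; case: [forall _, _];
      by rewrite ?subrr ?subr0 ?sub0r ?normrN ?normr0 ?normr1.
  rewrite (bigD1 j)//= uj lerDl; exact: sumr_ge0.
rewrite !belowXE (_ : [forall _, _] = [forall j,
    (count (fun k => (lvl n j < X k w)%R) [seq k <- iota 0 n | k != i] < kap j)%N]).
  by rewrite subrr normr0 sumr_ge0.
apply: eq_forallb => j; congr (_ < _)%N; rewrite count_filter.
apply: eq_count => k /=; have [->|//] := eqVneq k i; last by rewrite andbT.
by rewrite (negPf (h j)).
Qed.

Section FixedVariance.
Variables (y s0 : R).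
Hypothesis s0_gt0 : 0 < s0.

Lemma heat_intg (f : T -> R) s (z : T -> R) : measurable_fun setT f ->
  (forall w, `|f w| <= 1) -> measurable_fun setT z ->
  intg (fun w => f w * heat y s (z w)).
Proof.
move=> mf f1 mz; apply: (@intg_bnd _ _ _ P _ 1).
  apply: measurable_funM => //; apply: (measurableT_comp _ mz).
  by apply: continuous_measurable_fun; exact: continuous_heat.
move=> w; rewrite normrM -[1]mulr1 ler_pM ?f1//.
by rewrite ger0_norm ?heat_ge0 ?heat_le1.
Qed.

Lemma lindeberg_bound : exists2 C : R, 0 <= C & forall n M, (0 < n)%N -> 0 <= M ->
  `|\int[P]_w (bel n (iota 0 n) w * heat y s0 (partial_sum X n w / Num.sqrt n%:R))
    - \int[P]_w bel n (iota 0 n) w * heat y (s0 + 1) 0|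
  <= C * (\sum_j \int[P]_w ((lvl n j < X 0%N w)%R%:R
                              * (Num.sqrt n%:R * `|X 0%N w| + X 0%N w ^+ 2 + 1))
   + M / Num.sqrt n%:R + \int[P]_w (\1_[set w | M < `|X 0%N w|] w * X 0%N w ^+ 2) + n%:R^-1).
Proof.
have [C [A [B [C0 HAB]]]] := heat_expansion y s0_gt0.
exists C => // n M n0 M0.
have n0R : 0 < n%:R :> R by rewrite ltr0n.
have usi : uniq (iota 0 n) by exact: iota_uniq.
have mf : measurable_fun setT (bel n (iota 0 n)).
  exact: intg_meas (intg_belowX a b iidX x kap n usi).
have f0 := @belowX_ge0 _ _ _ _ X a b _ x kap n (iota 0 n).
have f1 := @belowX_le1 _ _ _ _ X a b _ x kap n (iota 0 n).
have fn w : `|bel n (iota 0 n) w| <= 1 by rewrite ger0_norm.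
have mS m : measurable_fun setT (fun w => partial_sum X m w / Num.sqrt (n%:R : R)).
  apply: measurable_funM; last exact: measurable_cst.
  exact: intg_meas (intg_partial_sum iidX EX2 m).
(* After the exchanges, [m] observations remain in the sum and the others are represented by the
   additional variance [(n - m) / n]; the factor [bel] keeps all [n] observations throughout. At
   [m = 0] the heat factor is deterministic and leaves the expectation. *)
have step m : (m <= n)%N ->
  `|\int[P]_w (bel n (iota 0 n) w *
       heat y (s0 + (n - m)%:R / n%:R) (partial_sum X m w / Num.sqrt n%:R))
    - \int[P]_w (bel n (iota 0 n) w * heat y (s0 + 1) 0)| <= m%:R * swap_error X C n 0 M (lvl n).
  elim: m => [_|m IH mn].
    rewrite mul0r subn0 divff ?lt0r_neq0//.
    under eq_Rintegral => w _ do rewrite /partial_sum big_ord0 mul0r.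
    by rewrite subrr normr0.
  pose s := s0 + (n - m.+1)%:R / n%:R.
  have s0s : s0 <= s by rewrite lerDl divr_ge0.
  have sE : s0 + (n - m)%:R / n%:R = s + n%:R^-1.
    have -> : (n - m = (n - m.+1).+1)%N by rewrite -subSn.
    by rewrite /s -natr1 mulrDl mul1r addrA.
  have uf : uniq [seq k <- iota 0 n | k != m] by rewrite filter_uniq.
  have mg : measurable_fun [set: sigX [set k | k != m]]
      (bel n [seq k <- iota 0 n | k != m] : sigX [set k | k != m] -> R).
    have [+ _ _] := excess_distr iidX (lvl n) uf (below kap) [ffun=> 0%N].
    by apply: measurable_sigX_sub => k /=; rewrite mem_filter => /andP[].
  have g1 w : `|bel n [seq k <- iota 0 n | k != m] w| <= 1.
    by rewrite ger0_norm ?belowX_le1 ?belowX_ge0.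
  have := @swap_bound _ _ _ _ X F iidX EX EX2 y s0 C A B C0 HAB n
    (bel n (iota 0 n)) (bel n [seq k <- iota 0 n | k != m]) m s M I (lvl n)
    n0 s0s M0 mf f0 f1 mg g1 (belowX_swap n m).
  rewrite swap_errorE -sE => sb.
  have {}IH := IH (ltnW mn).
  rewrite -natr1 mulrDl mul1r -/s.
  set Q0 := \int[P]_w (_ * heat y (s0 + 1) 0) in IH *.
  set Q1 := \int[P]_w (_ * heat y (s0 + _) _) in IH sb.
  have E : forall w, partial_sum X m.+1 w / Num.sqrt n%:R =
      partial_sum X m w / Num.sqrt n%:R + X m w / Num.sqrt n%:R :> R.
    by move=> w; rewrite partial_sumS mulrDl.
  under eq_Rintegral => w _ do rewrite E.
  set Q2 := \int[P]_w (_ * heat y s _) in sb *.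
  have -> : Q2 - Q0 = (Q1 - Q0) + (Q2 - Q1) by ring.
  by apply: le_trans (ler_normD _ _) _; exact: lerD.
have := step n (leqnn n); rewrite subnn mul0r addr0.
rewrite [X in _ - X](_ : _ = \int[P]_w bel n (iota 0 n) w * heat y (s0 + 1) 0); last first.
  have -> : (fun w => bel n (iota 0 n) w * heat y (s0 + 1) 0) =
      fun w => heat y (s0 + 1) 0 * bel n (iota 0 n) w.
    by apply/funext => w; rewrite mulrC.
  rewrite EZ; first by rewrite mulrC.
  exact: (intg_belowX a b iidX x kap n usi).
move=> h; apply: le_trans h _.
by rewrite /swap_error mulrA mulrCA mulfV ?lt0r_neq0// mulr1.
Qed.

(** Weighted Young: [sqrt n * |X| <= eta * n / 2 + X ^+ 2 / (2 * eta)] on the exceedance event.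
    Since [n * p] stays bounded and [kp] tends to 0 at levels where [G] is positive, the weight must
    be small but not below the order of the square root of [kp]. *)
Lemma truncated_moment_bound (j : I) n p kp : (0 < n)%N ->
  p = tail F a b n (x j) ->
  kp = \int[P]_w ((lvl n j < X 0%N w)%R%:R * X 0%N w ^+ 2) ->
  \int[P]_w ((lvl n j < X 0%N w)%R%:R * (Num.sqrt n%:R * `|X 0%N w| + X 0%N w ^+ 2 + 1))
  <= ((Num.sqrt kp + n%:R^-1) * (n%:R * p) + Num.sqrt kp) / 2 + kp + p.
Proof.
move=> n0 pE kpE; have n0R : 0 < n%:R :> R by rewrite ltr0n.
have i1 : intg (fun w => (lvl n j < X 0%N w)%R%:R : R).
  apply: (@intg_bnd _ _ _ P _ 1); last by move=> w; exact: bool_norm1.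
  exact: (measurableT_comp (meas_gt (lvl n j))).
have i2 : intg (fun w => (lvl n j < X 0%N w)%R%:R * X 0%N w ^+ 2).
  apply: (@intg_bndM _ _ _ P _ _ 1); [exact: intg_meas i1|by move=> w; exact: bool_norm1|].
  exact: (intg_sq iidX EX2).
have kp0 : 0 <= kp.
  by rewrite kpE; apply: Rintegral_ge0 => w _; rewrite mulr_ge0 ?sqr_ge0.
pose q : R := Num.sqrt n%:R; have q0 : 0 < q by rewrite sqrtr_gt0.
have qq : q ^+ 2 = n%:R by rewrite sqr_sqrtr ?ler0n.
(* The square root of [kp] balances the two terms; adding [1 / n] keeps the weight positive when
   [kp = 0]. *)
have [eta etaE eta0] : exists2 eta, eta = Num.sqrt kp + n%:R^-1 & 0 < eta.
  by eexists; [reflexivity|rewrite ltr_wpDl ?sqrtr_ge0// invr_gt0].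
have ep : p = \int[P]_w (lvl n j < X 0%N w)%R%:R.
  by rewrite pE (E_gt iidX 0 (lvl n j)).
apply: (@le_trans _ _ (\int[P]_w (((eta * n%:R) / 2 + 1) * (lvl n j < X 0%N w)%R%:R
    + ((2 * eta)^-1 + 1) * ((lvl n j < X 0%N w)%R%:R * X 0%N w ^+ 2)))).
  apply: Ele.
  - apply: (@intg_bndM _ _ _ P _ _ 1); [exact: intg_meas i1|by move=> w; exact: bool_norm1|].
    apply: intgD; last exact: intg_cst.
    by apply: intgD; [apply/intgZ/intg_norm; exact: (intg_X iidX EX2)|exact: (intg_sq iidX EX2)].
  - by apply: intgD; exact: intgZ.
  move=> w; case: (lvl n j < X 0%N w); rewrite ?mul0r ?mulr0 ?addr0// !mul1r mulr1.
  pose z : R := `|X 0%N w|; rewrite -/z; have z2 : X 0%N w ^+ 2 = z ^+ 2 by rewrite real_normK ?num_real.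
  rewrite z2.
  have : q * z <= eta * n%:R / 2 + (2 * eta)^-1 * z ^+ 2.
    rewrite -(ler_pM2l (_ : 0 < 2 * eta)) ?mulr_gt0// mulrDr mulVKf ?lt0r_neq0 ?mulr_gt0//.
    have := sqr_ge0 (eta * q - z); rewrite -qq; nra.
  rewrite -/q => h.
  have -> : eta * n%:R / 2 + 1 + ((2 * eta)^-1 + 1) * z ^+ 2 =
      (eta * n%:R / 2 + (2 * eta)^-1 * z ^+ 2) + z ^+ 2 + 1 by ring.
  by rewrite !lerD2r.
rewrite ED; [|exact: intgZ|exact: intgZ].
rewrite !EZ// -ep -kpE.
have h : (2 * eta)^-1 * kp <= Num.sqrt kp / 2.
  rewrite invfM mulrAC [_ / 2]mulrC mulrAC -mulrA ler_pM2l ?invr_gt0//.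
  rewrite ler_pdivrMl// -[leLHS](sqr_sqrtr kp0) expr2 ler_wpM2r ?sqrtr_ge0//.
  by rewrite etaE lerDl invr_ge0.
rewrite -etaE; lra.
Qed.

Lemma cvg_tail0 j : 0 < G (x j) -> tail F a b n (x j) @[n --> \oo] --> (0 : R).
Proof.
move=> Gj; rewrite -(subrr 1); apply: cvgB; first exact: cvg_cst.
exact: (cvg_cdf_level iidX a_gt0 cvgMax Gj).
Qed.

Lemma cvg_truncated_sq j : 0 < G (x j) ->
  \int[P]_w ((lvl n j < X 0%N w)%R%:R * X 0%N w ^+ 2) @[n --> \oo] --> (0 : R).
Proof.
move=> Gj.
have E n : (fun w => (lvl n j < X 0%N w)%R%:R : R) = \1_(X 0%N @^-1` `]lvl n j, +oo[).
  apply/funext => w; rewrite indicE; congr (nat_of_bool _)%:R.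
  by apply/idP/idP; rewrite inE /= in_itv/= andbT.
have mA n : measurable (X 0%N @^-1` `]lvl n j, +oo[).
  by rewrite -[X in measurable X]setTI; exact: measurable_funPT.
apply: (@cvg_eq_from _ 0 (fun n => \int[P]_w (\1_(X 0%N @^-1` `]lvl n j, +oo[) w * X 0%N w ^+ 2))).
  by move=> n _; rewrite -E.
apply: cvg_E_small_events => //.
- exact: (intg_sq iidX EX2).
- by move=> w; exact: sqr_ge0.
apply: (@cvg_eq_from _ 0 (fun n => tail F a b n (x j))); last exact: cvg_tail0.
by move=> n _; rewrite -E_indic// -E (E_gt iidX 0 (lvl n j)).
Qed.

Lemma cvg_sqrt_pinfty : Num.sqrt (n%:R : R) @[n --> \oo] --> +oo.
Proof.
apply/cvgryPge => K; near=> n.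
have [K0|K0] := leP K 0; first exact: le_trans K0 (sqrtr_ge0 _).
rewrite -[K]gtr0_norm// -sqrtr_sqr ler_wsqrtr//.
by near: n; exact: nbhs_infty_ger.
Unshelve. all: by end_near. Qed.

(** The truncation is at the fourth root of [n]: it tends to infinity, yet is negligible against the
    square root of [n]. Chebyshev bounds the probability of the event by the inverse square root of
    [n]. *)
Lemma cvg_big_sq : \int[P]_w (\1_[set w | Num.sqrt (Num.sqrt (n%:R : R)) < `|X 0%N w|] w * X 0%N w ^+ 2)
  @[n --> \oo] --> (0 : R).
Proof.
have mA n : measurable [set w | Num.sqrt (Num.sqrt (n%:R : R)) < `|X 0%N w|].
  exact: measurable_big_X.
apply: cvg_E_small_events => //.
- exact: (intg_sq iidX EX2).
- by move=> w; exact: sqr_ge0.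
have up : (Num.sqrt (n%:R : R))^-1 @[n --> \oo] --> (0 : R).
  apply/gtr0_cvgV0; last exact: cvg_sqrt_pinfty.
  by near=> n; rewrite sqrtr_gt0 ltr0n; near: n; exact: nbhs_infty_gt.
apply: (squeeze_cvgr _ (cvg_cst (0 : R)) up); near=> n.
rewrite fine_ge0//= -E_indic//.
have q0 : 0 < Num.sqrt (n%:R : R).
  by rewrite sqrtr_gt0 ltr0n; near: n; exact: nbhs_infty_gt.
rewrite -[leRHS]mulr1 -[X in _ <= _ * X](E_sq iidX EX2 0) -EZ; last exact: (intg_sq iidX EX2).
apply: Ele.
- apply: (@intg_bnd _ _ _ P _ 1); first exact: measurable_indic.
  by move=> w; rewrite ind_funE//; exact: bool_norm1.
- by apply: intgZ; exact: (intg_sq iidX EX2).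
move=> w; rewrite ind_funE//; case: ltP => h; last by rewrite mulr_ge0 ?invr_ge0 ?sqr_ge0 ?sqrtr_ge0.
rewrite mulrC ler_pdivlMr// mul1r -[leRHS]real_normK ?num_real//.
rewrite -[leLHS](@sqr_sqrtr _ (Num.sqrt n%:R)) ?sqrtr_ge0//.
by rewrite lerXn2r ?nnegrE ?sqrtr_ge0// ltW.
Unshelve. all: by end_near. Qed.

Lemma cvg_lindeberg : (forall j, 0 < G (x j)) ->
  \int[P]_w (bel n (iota 0 n) w * heat y s0 (partial_sum X n w / Num.sqrt n%:R))
    - \int[P]_w bel n (iota 0 n) w * heat y (s0 + 1) 0 @[n --> \oo] --> (0 : R).
Proof.
move=> Gx; have [C C0 HC] := lindeberg_bound.
pose p j n := tail F a b n (x j).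
pose kp j n := \int[P]_w ((lvl n j < X 0%N w)%R%:R * X 0%N w ^+ 2).
pose rhs n : R := C * (\sum_j
    (((Num.sqrt (kp j n) + n%:R^-1) * (n%:R * p j n) + Num.sqrt (kp j n)) / 2 + kp j n + p j n)
   + (Num.sqrt (Num.sqrt n%:R))^-1
   + \int[P]_w (\1_[set w | Num.sqrt (Num.sqrt (n%:R : R)) < `|X 0%N w|] w * X 0%N w ^+ 2)
   + n%:R^-1).
have c1 := @cvg_invr_idn R.
have cS : \sum_j (((Num.sqrt (kp j n) + n%:R^-1) * (n%:R * p j n) + Num.sqrt (kp j n)) / 2
    + kp j n + p j n) @[n --> \oo] -->
    \sum_j (((Num.sqrt 0 + 0) * - ln (G (x j)) + Num.sqrt 0) / 2 + 0 + 0 : R).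
  apply: cvg_sumr => j _.
  have ck := cvg_truncated_sq (Gx j).
  have csk : Num.sqrt (kp j n) @[n --> \oo] --> Num.sqrt (0 : R).
    by apply: (cvg_comp _ _ ck); exact: sqrt_continuous.
  apply: cvgD; last exact: cvg_tail0.
  apply: cvgD => //; apply: cvgMr_tmp; apply: cvgD => //.
  by apply: cvgM; [exact: cvgD|exact: (cvg_tail iidX a_gt0 cvgMax (Gx j))].
have cq : (Num.sqrt (Num.sqrt (n%:R : R)))^-1 @[n --> \oo] --> (0 : R).
  apply/gtr0_cvgV0.
    by near=> n; rewrite !sqrtr_gt0 ltr0n; near: n; exact: nbhs_infty_gt.
  apply/cvgryPge => K; near=> n.
  have [K0|K0] := leP K 0; first exact: le_trans K0 (sqrtr_ge0 _).
  rewrite -[K]gtr0_norm// -sqrtr_sqr ler_wsqrtr//.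
  by near: n; move/cvgryPge : cvg_sqrt_pinfty; apply.
have rhs0 : rhs n @[n --> \oo] --> (0 : R).
  have -> : (0 : R) = C * (\sum_(j : I) (((Num.sqrt 0 + 0) * - ln (G (x j)) + Num.sqrt 0) / 2
      + 0 + 0) + 0 + 0 + 0).
    rewrite big1 => [|j _]; first by rewrite !addr0 mulr0.
    by rewrite sqrtr0 !addr0 mul0r mul0r.
  apply: cvgMl_tmp; apply: cvgD => //; apply: cvgD; last exact: cvg_big_sq.
  exact: cvgD.
apply/cvgr0Pnorm_le => e e0; near=> n.
have n0 : (0 < n)%N by near: n; exact: nbhs_infty_gt.
have qq0 : 0 <= Num.sqrt (Num.sqrt (n%:R : R)) by exact: sqrtr_ge0.
apply: le_trans (HC n _ n0 qq0) _.
apply: (@le_trans _ _ (rhs n)); last first.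
  by near: n; exact: (cvgr_le _ rhs0).
apply: ler_wpM2l => //; rewrite !lerD2r; apply: lerD.
  by apply: ler_sum => j _; exact: truncated_moment_bound.
have q0 : 0 < Num.sqrt (Num.sqrt (n%:R : R)) by rewrite !sqrtr_gt0 ltr0n.
rewrite ler_pdivrMr ?sqrtr_gt0 ?ltr0n// -[X in _ * X](@sqr_sqrtr _ (Num.sqrt n%:R)) ?sqrtr_ge0//.
by rewrite expr2 mulKf ?lt0r_neq0.
Unshelve. all: by end_near. Qed.

(** The exchange estimate requires [n] times each tail to be bounded, that is, [G] positive at all
    levels. Otherwise the order-statistics factor already has expectation tending to 0, and both
    sides vanish. *)
Lemma cvg_joint_heat (H : R) :
  \int[P]_w bel n (iota 0 n) w @[n --> \oo] --> H ->
  \int[P]_w (bel n (iota 0 n) w * heat y s0 (partial_sum X n w / Num.sqrt n%:R))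
    @[n --> \oo] --> H * heat y (s0 + 1) 0.
Proof.
move=> cH.
have ib n : intg (bel n (iota 0 n)).
  exact: (intg_belowX a b iidX x kap n (iota_uniq 0 n)).
have [Gx|/existsNP[j Gj]] := pselect (forall j, 0 < G (x j)).
  apply: (@cvg_eq_from _ 0 (fun n => (\int[P]_w (bel n (iota 0 n) w
      * heat y s0 (partial_sum X n w / Num.sqrt n%:R))
    - \int[P]_w bel n (iota 0 n) w * heat y (s0 + 1) 0)
    + \int[P]_w bel n (iota 0 n) w * heat y (s0 + 1) 0)).
    by move=> n _; rewrite subrK.
  rewrite -[X in _ --> X]add0r; apply: cvgD; first exact: cvg_lindeberg.
  exact: cvgMr_tmp.
have Gj0 : G (x j) = 0.
  apply/eqP; rewrite eq_le (limit_cdf_ge0 iidX a_gt0 cvgMax) andbT leNgt.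
  exact/negP.
have c0 := cvg_belowX_zero iidX a_gt0 cvgMax kap Gj0.
have -> : H = 0 by apply: (cvg_unique _ cH c0).
rewrite mul0r; apply: (squeeze_cvgr _ (cvg_cst (0 : R)) c0); near=> n.
have b0 := @belowX_ge0 _ _ _ _ X a b _ x kap n (iota 0 n).
have b1 := @belowX_le1 _ _ _ _ X a b _ x kap n (iota 0 n).
rewrite Rintegral_ge0 => [|w _]; last by rewrite mulr_ge0 ?heat_ge0.
apply: Ele => //.
  apply: heat_intg; first exact: intg_meas (ib n).
    by move=> w; rewrite ger0_norm.
  apply: measurable_funM; last exact: measurable_cst.
  exact: intg_meas (intg_partial_sum iidX EX2 n).
by move=> w; rewrite ler_piMr ?heat_le1.
Unshelve. all: by end_near. Qed.

End FixedVariance.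

End JointLimit.

(** * Logarithmic averages *)

Section LogAverage.
Context {R : realType}.
Implicit Types (u e : nat -> R) (l : R).

Definition harm (N : nat) : R := \sum_(1 <= n < N.+1) n%:R^-1.

Lemma ln_nat_gt0 N : (2 <= N)%N -> 0 < ln (N%:R : R).
Proof. by move=> N2; rewrite ln_gt0// ltr1n. Qed.

Lemma ln_nat_ge0 N : 0 <= ln (N%:R : R).
Proof. by case: N => [|N]; [rewrite ln0|rewrite ln_ge0// ler1n]. Qed.

Lemma harmS N : harm N.+1 = harm N + N.+1%:R^-1.
Proof. by rewrite /harm big_nat_recr. Qed.

Lemma lnS_bounds N : (0 < N)%N ->
  N.+1%:R^-1 <= ln (N.+1%:R : R) - ln N%:R <= N%:R^-1.
Proof.
move=> N0; have NR : 0 < N%:R :> R by rewrite ltr0n.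
have SR : 0 < N.+1%:R :> R by [].
rewrite -ln_div ?posrE//; apply/andP; split.
  have := @le_ln1Dx R (- N.+1%:R^-1).
  have -> : 1 + - N.+1%:R^-1 = N%:R / N.+1%:R :> R.
    by rewrite -natr1; field; rewrite natr1 lt0r_neq0.
  rewrite !ln_div ?posrE// => h.
  rewrite -[leRHS]opprB lerNr; apply: h; rewrite ltrN2 invf_lt1// ltr1n ltnS//.
have := @le_ln1Dx R N%:R^-1.
have -> : 1 + N%:R^-1 = N.+1%:R / N%:R :> R.
  by rewrite -natr1; field; rewrite lt0r_neq0.
by apply; apply: lt_trans (_ : 0 < _); rewrite ?invr_gt0// ltrN10.
Qed.

Lemma harm_ge N : ln (N.+1%:R : R) <= harm N.
Proof.
elim: N => [|N IH]; first by rewrite ln1 /harm big_geq.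
have /andP[_ k2] := @lnS_bounds N.+1 isT; rewrite harmS.
by rewrite -[leLHS](subrK (ln N.+1%:R)) addrC lerD.
Qed.

Lemma harm_le N : (0 < N)%N -> harm N <= 1 + ln N%:R.
Proof.
elim: N => // -[|N] IH _; first by rewrite ln1 /harm big_nat1 invr1 addr0.
have /andP[k1 _] := @lnS_bounds N.+1 isT; rewrite harmS.
apply: le_trans (lerD (IH isT) k1) _.
by rewrite -addrA subrKC.
Qed.

Lemma harm_ge0 N : 0 <= harm N.
Proof. by apply: sumr_ge0 => n _; rewrite invr_ge0. Qed.

Lemma cvg_ln_nat : ln (N%:R : R) @[N --> \oo] --> +oo.
Proof.
apply/cvgryPge => K; near=> N.
have h : expR K <= N%:R by near: N; exact: nbhs_infty_ger.
by rewrite -[leLHS]expRK ler_ln ?posrE ?expR_gt0// (lt_le_trans _ h) ?expR_gt0.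
Unshelve. all: by end_near. Qed.

Lemma cvg_ln_natV : (ln (N%:R : R))^-1 @[N --> \oo] --> (0 : R).
Proof.
apply/gtr0_cvgV0; last exact: cvg_ln_nat.
by near=> N; apply: ln_nat_gt0; near: N; exact: nbhs_infty_ge.
Unshelve. all: by end_near. Qed.

Lemma cvg_harm_ln : (ln (N%:R : R))^-1 * harm N @[N --> \oo] --> (1 : R).
Proof.
have up : (ln (N%:R : R))^-1 + 1 @[N --> \oo] --> (1 : R).
  by rewrite -[X in _ --> X]add0r; apply: cvgD; [exact: cvg_ln_natV|exact: cvg_cst].
apply: (squeeze_cvgr _ (cvg_cst (1 : R)) up); near=> N.
have N2 : (2 <= N)%N by near: N; exact: nbhs_infty_ge.
have l0 := ln_nat_gt0 N2; have N0 : (0 < N)%N by exact: leq_trans N2.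
rewrite ler_pdivlMl// mulr1 ler_pdivrMl// mulrDr mulfV ?lt0r_neq0// mulr1.
rewrite harm_le// andbT (le_trans _ (harm_ge N))//.
by rewrite ler_ln ?posrE ?ltr0n// ler_nat.
Unshelve. all: by end_near. Qed.

Lemma log_averageB u e N :
  log_average (fun n => u n - e n) N = log_average u N - log_average e N.
Proof.
rewrite /log_average -mulrBr -sumrB; congr (_ * _); apply: eq_bigr => n _.
by rewrite mulrBr.
Qed.

Lemma log_averageD u e N :
  log_average (fun n => u n + e n) N = log_average u N + log_average e N.
Proof.
rewrite /log_average -mulrDr -big_split/=; congr (_ * _); apply: eq_bigr => n _.
by rewrite mulrDr.
Qed.

Lemma log_average_cst l N : log_average (fun=> l) N = (ln N%:R)^-1 * harm N * l.
Proof. by rewrite /log_average -mulr_suml mulrA. Qed.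

Lemma le_log_average u e N : (forall n, (0 < n)%N -> u n <= e n) ->
  log_average u N <= log_average e N.
Proof.
move=> ue; apply: ler_wpM2l; first by rewrite invr_ge0 ln_nat_ge0.
rewrite big_nat_cond [leRHS]big_nat_cond; apply: ler_sum => n /andP[/andP[n0 _] _].
by apply: ler_wpM2l; [rewrite invr_ge0|exact: ue].
Qed.

Lemma cvg_log_average_cst l : log_average (fun=> l) N @[N --> \oo] --> l.
Proof.
apply: (@cvg_eq_from _ 0 (fun N => (ln N%:R)^-1 * harm N * l)).
  by move=> N _; rewrite log_average_cst.
by rewrite -[X in _ --> X]mul1r; apply: cvgMr_tmp; exact: cvg_harm_ln.
Qed.

(** Toeplitz argument: the first [n0] terms form a constant, killed by the inverse logarithm, and
    the rest is at most [eps / 4] times a normalized harmonic sum tending to 1. *)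
Lemma cvg_log_average e l : e n @[n --> \oo] --> l ->
  log_average e N @[N --> \oo] --> l.
Proof.
move=> el.
suff h : log_average (fun n => e n - l) N @[N --> \oo] --> (0 : R).
  apply: (@cvg_eq_from _ 0 (fun N => log_average (fun n => e n - l) N + log_average (fun=> l) N)).
    by move=> N _; rewrite log_averageB subrK.
  by rewrite -[X in _ --> X]add0r; apply: cvgD => //; exact: cvg_log_average_cst.
apply/cvgr0Pnorm_le => eps eps0.
have eps2 : 0 < eps / 2 by rewrite divr_gt0.
move/cvgrPdist_le : (el) => /(_ (eps / 4)) [|n0 _ Hn0]; first by rewrite divr_gt0.
pose K := \sum_(1 <= n < n0.+1) n%:R^-1 * `|e n - l|.
have K0 : 0 <= K by apply: sumr_ge0 => n _; rewrite mulr_ge0 ?invr_ge0.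
have cK : (ln (N%:R : R))^-1 * K + ((ln N%:R)^-1 * harm N) * (eps / 4) @[N --> \oo]
    --> 0 * K + 1 * (eps / 4).
  by apply: cvgD; apply: cvgMr_tmp; [exact: cvg_ln_natV|exact: cvg_harm_ln].
rewrite mul0r mul1r add0r in cK.
near=> N.
have N2 : (2 <= N)%N by near: N; exact: nbhs_infty_ge.
have N3 : (n0 <= N)%N by near: N; exact: nbhs_infty_ge.
have l0 := ln_nat_gt0 N2.
apply: (@le_trans _ _ ((ln (N%:R : R))^-1 * K + ((ln N%:R)^-1 * harm N) * (eps / 4))); last first.
  near: N; apply: (cvgr_le _ cK); lra.
have lV0 : 0 <= (ln (N%:R : R))^-1 by rewrite invr_ge0 ltW.
rewrite /log_average normrM (ger0_norm lV0) -mulrA -mulrDr.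
apply: ler_wpM2l => //.
apply: le_trans (ler_norm_sum _ _ _) _.
rewrite (big_cat_nat (n := n0.+1))//=; apply: lerD.
  by apply: ler_sum => n _; rewrite normrM ger0_norm ?invr_ge0.
rewrite /harm [in leRHS](big_cat_nat (n := n0.+1))//= mulrDl.
apply: ler_wpDl; first by rewrite mulr_ge0 ?sumr_ge0// ?divr_ge0 ?ltW.
rewrite mulr_suml big_nat_cond [leRHS]big_nat_cond.
apply: ler_sum => n /andP[/andP[n1 _] _]; rewrite normrM ger0_norm ?invr_ge0//.
by apply: ler_wpM2l; rewrite ?invr_ge0// distrC; apply: Hn0 => /=; exact: ltnW.
Unshelve. all: by end_near. Qed.

Lemma ln_pow2 k : ln ((2 ^ k)%:R : R) = k%:R * ln 2.
Proof. by rewrite natrX lnXn// mulr_natl. Qed.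

(** The quadratic exponent meets two opposite demands: the inverse logarithms are summable, and the
    ratio of consecutive logarithms tends to 1. *)
Definition grid (i : nat) : nat := (2 ^ (i ^ 2))%N.

Lemma grid_ge i : (i < grid i)%N.
Proof.
apply: leq_trans (ltn_expl i (ltnSn 1)) _; rewrite leq_exp2l//.
by case: i => // i; rewrite leq_pmulr.
Qed.

Lemma ln_grid i : ln ((grid i)%:R : R) = i%:R ^+ 2 * ln 2.
Proof. by rewrite /grid ln_pow2 natrX. Qed.

(* Since [ln (grid i.+1) / ln (grid i) -> 1], the logarithmic averages of a
   nonnegative sequence are determined by their values along [grid]. *)
Lemma log_average_grid u l : (forall n, 0 <= u n) ->
  log_average u (grid i) @[i --> \oo] --> l -> log_average u N @[N --> \oo] --> l.
Proof.
move=> u0 ul.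
pose S N := \sum_(1 <= n < N.+1) n%:R^-1 * u n.
have Smono N M : (N <= M)%N -> S N <= S M.
  move=> NM; rewrite /S [leRHS](big_cat_nat (n := N.+1))//= lerDl.
  by apply: sumr_ge0 => n _; rewrite mulr_ge0 ?invr_ge0.
have ln2 : 0 < ln 2 :> R by rewrite ln_gt0// ltr1n.
(* This is the ratio of [ln (grid i)] to [ln (grid i.+1)]. *)
pose rho i : R := i%:R ^+ 2 / i.+1%:R ^+ 2.
have crho : rho i @[i --> \oo] --> (1 : R).
  have h : (1 - (i.+1%:R)^-1 : R) @[i --> \oo] --> (1 : R).
    by rewrite -[X in _ --> X]subr0; apply: cvgB; [exact: cvg_cst|exact: cvg_harmonic].
  apply: (@cvg_eq_from _ 0 (fun i => (1 - (i.+1%:R)^-1) * (1 - (i.+1%:R)^-1))).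
    by move=> i _; rewrite /rho -natr1; field; rewrite natr1 lt0r_neq0.
  by rewrite -[X in _ --> X]mulr1; exact: cvgM.
have clo : rho i * log_average u (grid i) @[i --> \oo] --> l.
  by rewrite -[X in _ --> X]mul1r; exact: cvgM.
have chi : (rho i)^-1 * log_average u (grid i.+1) @[i --> \oo] --> l.
  rewrite -[X in _ --> X]mul1r -[X in X * _]invr1; apply: cvgM.
    by apply: cvgV => //; rewrite oner_neq0.
  by have := ul; rewrite -(cvg_shiftS (fun i => log_average u (grid i))).
apply/cvgrPdist_le => e e0.
move/cvgrPdist_le : clo => /(_ e e0) [i1 _ Hi1].
move/cvgrPdist_le : chi => /(_ e e0) [i2 _ Hi2].
near=> N.
pose i0 := maxn (maxn i1 i2) 1.
have Ni0 : (grid i0 <= N)%N by near: N; exact: nbhs_infty_ge.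
have ub i : (grid i <= N)%N -> (i <= N)%N.
  by move=> h; exact: leq_trans (ltnW (grid_ge i)) h.
(* The largest [i] with [grid i <= N] brackets [N] between consecutive grid points; comparing sums
   and logarithms separately costs the factor [rho i] or its inverse. *)
have [i gi imax] := ex_maxnP (ex_intro _ i0 Ni0) ub.
have i0i : (i0 <= i)%N by exact: imax.
have Ngi : (N < grid i.+1)%N.
  by rewrite ltnNge; apply/negP => /imax; rewrite ltnn.
move: i0i; rewrite !geq_max => /andP[/andP[/Hi1 lo /Hi2 hi] i1'].
have ip : 0 < i%:R :> R by rewrite ltr0n.
have lgi : 0 < ln ((grid i)%:R : R) by rewrite ln_grid mulr_gt0// exprn_gt0.
have lgS : 0 < ln ((grid i.+1)%:R : R) by rewrite ln_grid mulr_gt0// exprn_gt0.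
have lNlo : ln ((grid i)%:R : R) <= ln N%:R.
  by rewrite ler_ln ?posrE ?ltr0n ?expn_gt0// ?ler_nat// (leq_trans _ gi)// expn_gt0.
have lNhi : ln (N%:R : R) <= ln (grid i.+1)%:R.
  rewrite ler_ln ?posrE ?ltr0n ?expn_gt0// ?ler_nat; first exact: ltnW.
  by rewrite (leq_trans _ gi)// expn_gt0.
have lN : 0 < ln (N%:R : R) by exact: lt_le_trans lNlo.
have S0 M : 0 <= S M by apply: sumr_ge0 => n _; rewrite mulr_ge0 ?invr_ge0.
have L1 : rho i * log_average u (grid i) <= log_average u N.
  rewrite /log_average -!/(S _) mulrA; apply: ler_pM => //; last exact: Smono.
    by rewrite mulr_ge0 ?invr_ge0 ?divr_ge0 ?exprn_ge0// ltW.
  have -> : rho i * (ln (grid i)%:R)^-1 = (ln (grid i.+1)%:R)^-1.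
    rewrite !ln_grid /rho; field.
    by rewrite !lt0r_neq0.
  by rewrite lef_pV2 ?posrE.
have L2 : log_average u N <= (rho i)^-1 * log_average u (grid i.+1).
  rewrite /log_average -!/(S _) mulrA; apply: ler_pM => //; last by apply: Smono; exact: ltnW.
    by rewrite invr_ge0 ltW.
  have -> : (rho i)^-1 * (ln (grid i.+1)%:R)^-1 = (ln (grid i)%:R)^-1.
    rewrite !ln_grid /rho; field.
    by rewrite !lt0r_neq0.
  by rewrite lef_pV2 ?posrE.
move: lo hi; rewrite !ler_norml => /andP[lo1 lo2] /andP[hi1 hi2].
apply/andP; split; lra.
Unshelve. all: by end_near. Qed.

End LogAverage.

(** * Almost sure averages from covariance decay *)

Section AlmostSureLogAverage.
Context {d : measure_display} {T : measurableType d} {R : realType}.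
Variable P : probability T R.

Local Notation intg f := (P.-integrable setT (EFin \o f)).

Lemma cvg_subseq (u : nat -> R) (l : R) (f : nat -> nat) : (forall i, (i <= f i)%N) ->
  u n @[n --> \oo] --> l -> u (f i) @[i --> \oo] --> l.
Proof.
move=> fi /cvgrPdist_le ul; apply/cvgrPdist_le => e e0.
have [N _ HN] := ul e e0; exists N => // i /= Ni; apply: HN => /=.
exact: leq_trans (fi i).
Qed.

(** The sum telescopes: with [t ^+ 2 = s ^+ 2 + 1], the inequality [t^-1 <= 2 * (t - s)] amounts to
    [(s - t) ^+ 2 >= 0]. *)
Lemma sum_inv_sqrt_le N : \sum_(1 <= m < N.+1) (Num.sqrt (m%:R : R))^-1 <= 2 * Num.sqrt N%:R.
Proof.
elim: N => [|N IH]; first by rewrite big_geq// sqrtr0 mulr0.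
rewrite big_nat_recr//=; apply: le_trans (lerD IH (lexx _)) _.
set s := Num.sqrt (N%:R : R); set t := Num.sqrt (N.+1%:R : R).
have s0 : 0 <= s by exact: sqrtr_ge0.
have t0 : 0 < t by rewrite sqrtr_gt0.
have st : t ^+ 2 = s ^+ 2 + 1 by rewrite !sqr_sqrtr// natr1.
rewrite -(ler_pM2r t0) mulrDl mulVf ?lt0r_neq0//.
have := sqr_ge0 (s - t); nra.
Qed.

Lemma sum_inv_sq_le n : \sum_(0 <= i < n) (i.+1%:R ^+ 2 : R)^-1 <= 2.
Proof.
suff h : forall n, \sum_(0 <= i < n.+1) (i.+1%:R ^+ 2 : R)^-1 <= 2 - n.+1%:R^-1.
  case: n => [|n]; first by rewrite big_geq.
  by apply: le_trans (h n) _; rewrite gerBl invr_ge0.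
elim=> [|k IH]; first by rewrite big_nat1 expr1n invr1 -[2]/(1 + 1) addrK.
rewrite big_nat_recr//=; apply: le_trans (lerD IH (lexx _)) _.
set x := k.+1%:R; have x0 : 0 < x :> R by [].
have -> : k.+2%:R = x + 1 :> R by rewrite natr1.
have x1 : 0 < x + 1 by rewrite addr_gt0.
rewrite -subr_ge0.
have -> : 2 - (x + 1)^-1 - (2 - x^-1 + ((x + 1) ^+ 2)^-1) = (x * (x + 1) ^+ 2)^-1.
  by field; rewrite !lt0r_neq0.
by rewrite invr_ge0 mulr_ge0 ?exprn_ge0 ?ltW.
Qed.

Variables (xi : nat -> T -> R) (C l : R).
Hypothesis C0 : 0 <= C.
Hypothesis mxi : forall n, measurable_fun setT (xi n).
Hypothesis xi01 : forall n w, 0 <= xi n w <= 1.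
Hypothesis cov_xi : forall m n, (0 < m)%N -> (m < n)%N ->
  `|\int[P]_w (xi m w * xi n w) - \int[P]_w xi m w * \int[P]_w xi n w|
  <= C * Num.sqrt (m%:R / n%:R).
Hypothesis E_xi : \int[P]_w xi n w @[n --> \oo] --> l.

Let e n := \int[P]_w xi n w.
Let eta n w := xi n w - e n.

Let ixi n : intg (xi n).
Proof.
apply: (@intg_bnd _ _ _ P _ 1) => // w.
by case/andP: (xi01 n w) => *; rewrite ger0_norm.
Qed.

Let e01 n : 0 <= e n <= 1.
Proof.
rewrite /e Rintegral_ge0; last by move=> w _; case/andP: (xi01 n w).
rewrite -[X in _ <= X](Ecst P); apply: Ele => //; first exact: intg_cst.
by move=> w; case/andP: (xi01 n w).
Qed.

Let meta n : measurable_fun setT (eta n).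
Proof. by apply: measurable_funB => //; exact: measurable_cst. Qed.

Let eta1 n w : `|eta n w| <= 1.
Proof.
rewrite ler_norml /eta; have := xi01 n w; have := e01 n.
move=> /andP[? ?] /andP[? ?]; apply/andP; split; lra.
Qed.

Let ieta m n : intg (fun w => eta m w * eta n w).
Proof.
apply: (@intg_bnd _ _ _ P _ 1); first exact: measurable_funM.
by move=> w; rewrite normrM -[1]mulr1 ler_pM.
Qed.

Let ixx m n : intg (fun w => xi m w * xi n w).
Proof. by apply: (@intg_bndM _ _ _ P _ _ 1) => // w; case/andP: (xi01 m w) => *; rewrite ger0_norm. Qed.

Let E_eta m n : \int[P]_w (eta m w * eta n w) = \int[P]_w (xi m w * xi n w) - e m * e n.
Proof.
have -> : (fun w => eta m w * eta n w) =
  fun w => (xi m w * xi n w - e m * xi n w) - (e n * xi m w - e m * e n).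
  by apply/funext => w; rewrite /eta; ring.
have i1 := intgZ (e m) (ixi n); have i2 := intgZ (e n) (ixi m).
have i3 := intg_cst P (e m * e n).
rewrite (EB (intgB (ixx m n) i1) (intgB i2 i3)) (EB (ixx m n) i1) (EB i2 i3) Ecst !EZ//.
rewrite -/(e n) -/(e m); ring.
Qed.

Let Y N w := \sum_(1 <= n < N.+1) n%:R^-1 * eta n w.

Let mY N : measurable_fun setT (Y N).
Proof. by apply: measurable_sum => n; apply: measurable_funM => //; exact: measurable_cst. Qed.

Let Y_bnd N w : `|Y N w| <= harm N.
Proof.
apply: le_trans (ler_norm_sum _ _ _) _; apply: ler_sum => n _.
by rewrite normrM ger0_norm ?invr_ge0// ler_piMr ?invr_ge0.
Qed.

Let iY2 N : intg (fun w => Y N w ^+ 2).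
Proof.
apply: (@intg_bnd _ _ _ P _ (harm N ^+ 2)); first exact: measurable_funX.
by move=> w; rewrite normrX lerXn2r ?nnegrE ?harm_ge0.
Qed.

(** By induction on [N]: the covariance hypothesis bounds the expectation of [Y N * eta N.+1] by
    [C / sqrt (N + 1)] times a sum of inverse square roots, hence by [2 * C]. Adding one term thus
    increases the second moment by at most [(4 * C + 1) / (N + 1)]. *)
Let E_Y2 N : \int[P]_w (Y N w ^+ 2) <= (4 * C + 1) * harm N.
Proof.
elim: N => [|N IH].
  rewrite /Y; under eq_Rintegral => w _ do rewrite big_geq// expr0n.
  by rewrite Ecst /harm big_geq// mulr0.
set v : R := N.+1%:R^-1; have v0 : 0 <= v by rewrite invr_ge0.
have v1 : v <= 1 by rewrite invf_le1// ler1n.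
have -> : (fun w => Y N.+1 w ^+ 2) = fun w => Y N w ^+ 2 + (2 * v * (Y N w * eta N.+1 w)
    + v ^+ 2 * (eta N.+1 w * eta N.+1 w)).
  by apply/funext => w; rewrite /Y big_nat_recr//= -/v; ring.
have iYe : intg (fun w => Y N w * eta N.+1 w).
  apply: (@intg_bnd _ _ _ P _ (harm N)); first exact: measurable_funM.
  by move=> w; rewrite normrM -[leRHS]mulr1 ler_pM.
have i1 := intgZ (2 * v) iYe; have i2 := intgZ (v ^+ 2) (ieta N.+1 N.+1).
rewrite (ED (iY2 N) (intgD i1 i2)) (ED i1 i2) !EZ//.
have eYe : \int[P]_w (Y N w * eta N.+1 w) <= 2 * C.
  have -> : (fun w => Y N w * eta N.+1 w) =
      fun w => \sum_(1 <= m < N.+1) m%:R^-1 * (eta m w * eta N.+1 w).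
    by apply/funext => w; rewrite /Y mulr_suml; apply: eq_bigr => m _; rewrite mulrA.
  rewrite Esum; last by move=> m; exact: intgZ.
  apply: (@le_trans _ _ (\sum_(1 <= m < N.+1) (Num.sqrt (m%:R : R))^-1 * (C * Num.sqrt v))).
    rewrite big_nat_cond [leRHS]big_nat_cond; apply: ler_sum => m /andP[/andP[m0 mN] _].
    rewrite EZ// E_eta; apply: (@le_trans _ _ (m%:R^-1 * (C * Num.sqrt (m%:R / N.+1%:R)))).
      apply: ler_wpM2l; first by rewrite invr_ge0.
      exact: le_trans (ler_norm _) (cov_xi m0 mN).
    have mp : 0 < Num.sqrt m%:R :> R by rewrite sqrtr_gt0 ltr0n.
    rewrite sqrtrM// -/v -[X in X^-1](@sqr_sqrtr _ m%:R)// expr2.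
    by rewrite le_eqVlt; apply/orP; left; apply/eqP; field; rewrite lt0r_neq0.
  rewrite -mulr_suml; apply: (@le_trans _ _ (2 * Num.sqrt N%:R * (C * Num.sqrt v))).
    by apply: ler_wpM2r; [rewrite mulr_ge0 ?sqrtr_ge0|exact: sum_inv_sqrt_le].
  have h : Num.sqrt N%:R * Num.sqrt v <= 1 :> R.
    rewrite -sqrtrM// -[leRHS]sqrtr1 ler_wsqrtr// /v ler_pdivrMr// mul1r ler_nat//.
  have -> : 2 * Num.sqrt N%:R * (C * Num.sqrt v) = 2 * C * (Num.sqrt N%:R * Num.sqrt v) by ring.
  by rewrite ler_piMr// mulr_ge0.
have ee : \int[P]_w (eta N.+1 w * eta N.+1 w) <= 1.
  rewrite -[leRHS](Ecst P); apply: Ele => //; first exact: intg_cst.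
  move=> w; apply: le_trans (ler_norm _) _; by rewrite normrM -[1]mulr1 ler_pM.
rewrite harmS -/v mulrDr; apply: lerD => //.
have := sqr_ge0 v; nra.
Qed.

(** Borel-Cantelli in integrated form: the squared centred averages along [grid] have a summable
    series of expectations, so their series converges almost surely and its terms tend to 0. *)
Lemma ae_log_average : {ae P, forall w, log_average (xi ^~ w) N @[N --> \oo] --> l}.
Proof.
pose L : R := ln 2; have L0 : 0 < L by rewrite ln_gt0// ltr1n.
(* The index starts at 1 because [grid 0 = 1] has logarithm 0. *)
pose h i w := ((ln ((grid i.+1)%:R : R))^-1 * Y (grid i.+1) w) ^+ 2.
have lg i : ln ((grid i.+1)%:R : R) = i.+1%:R ^+ 2 * L by rewrite ln_grid.
have lg0 i : 0 < ln ((grid i.+1)%:R : R) by rewrite lg mulr_gt0// exprn_gt0.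
have mh i : measurable_fun setT (h i).
  by apply: measurable_funX; apply: measurable_funM => //; exact: measurable_cst.
have h0 i w : 0 <= h i w by exact: sqr_ge0.
(* With [z = (i + 1) ^ 2] the logarithm is [z * L] and the harmonic sum at most [1 + z * L];
   dividing by [(z * L) ^+ 2] and using [z >= 1] leaves [K / z]. *)
pose K := (4 * C + 1) * (L ^- 2 + L^-1).
have C41 : 0 <= 4 * C + 1 by rewrite addr_ge0 ?mulr_ge0.
have LV : 0 <= L^-1 by rewrite invr_ge0 ltW.
have LV2 : 0 <= L ^- 2 by rewrite invr_ge0 exprn_ge0 ?ltW.
have K0 : 0 <= K by apply: mulr_ge0 => //; exact: addr_ge0.
have hE i : h i = fun w => (ln ((grid i.+1)%:R : R)) ^- 2 * Y (grid i.+1) w ^+ 2.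
  by apply/funext => w; rewrite /h exprMn exprVn.
have ih i : intg (h i) by rewrite hE; exact: intgZ.
have Eh i : \int[P]_w h i w <= K * (i.+1%:R ^+ 2)^-1.
  have -> : \int[P]_w h i w = ln (grid i.+1)%:R ^- 2 * \int[P]_w (Y (grid i.+1) w ^+ 2).
    by rewrite hE EZ.
  have g0 : (0 < grid i.+1)%N by rewrite expn_gt0.
  apply: (@le_trans _ _ (ln ((grid i.+1)%:R : R) ^- 2 *
     ((4 * C + 1) * (1 + ln (grid i.+1)%:R)))).
    apply: ler_wpM2l; first by rewrite invr_ge0 exprn_ge0 ?ltW.
    apply: le_trans (E_Y2 _) _; apply: ler_wpM2l => //.
    exact: harm_le.
  rewrite lg /K; set z : R := i.+1%:R ^+ 2.
  have z1 : 1 <= z by rewrite exprn_ege1// ler1n.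
  have z0 : 0 < z by exact: lt_le_trans z1.
  have -> : (z * L) ^- 2 * ((4 * C + 1) * (1 + z * L)) =
     (4 * C + 1) * (L ^- 2 * z^-1 + L^-1) * z^-1.
    by field; rewrite !lt0r_neq0.
  apply: ler_wpM2r; first by rewrite invr_ge0 ltW.
  apply: ler_wpM2l => //.
  by rewrite lerD2r ler_piMr// invf_le1.
have mEh i : measurable_fun setT (fun w => (h i w)%:E) by exact/measurable_EFinP.
have fin : (\int[P]_w (\sum_(0 <= i <oo) (h i w)%:E) < +oo)%E.
  rewrite integral_nneseries//; last by move=> i w _; rewrite lee_fin.
  apply: (@le_lt_trans _ _ (K * 2)%:E); last exact: ltry.
  apply: lime_le.
    by apply: is_cvg_nneseries => i _ _; apply: integral_ge0 => w _; rewrite lee_fin.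
  near=> n.
  have -> : (\sum_(0 <= i < n) \int[P]_w (h i w)%:E =
     (\sum_(0 <= i < n) \int[P]_w h i w)%:E)%E.
    rewrite -sumEFin; apply: eq_bigr => i _; rewrite /Rintegral fineK//.
    exact: (integrable_fin_num measurableT (ih i)).
  rewrite lee_fin; apply: (@le_trans _ _ (\sum_(0 <= i < n) K * (i.+1%:R ^+ 2)^-1)).
    by apply: ler_sum.
  by rewrite -mulr_sumr; apply: ler_wpM2l => //; exact: sum_inv_sq_le.
have mS : measurable_fun setT (fun w => \sum_(0 <= i <oo) (h i w)%:E)%E.
  by apply: ge0_emeasurable_sum => // i w _ _; rewrite lee_fin.
have iS : P.-integrable setT (fun w => \sum_(0 <= i <oo) (h i w)%:E)%E.
  apply/integrableP; split => //; apply: le_lt_trans fin.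
  apply: ge0_le_integral => //; first exact: measurableT_comp.
  by move=> w _; rewrite gee0_abs//; apply: nneseries_ge0 => i _ _; rewrite lee_fin.
have := integrable_ae measurableT iS; apply: filterS => w /(_ I) finw.
have hs : h i w @[i --> \oo] --> (0 : R).
  apply: cvg_series_cvg_0; apply: nnseries_is_cvg => //.
  by rewrite ltey_eq finw.
have Yg : log_average (eta ^~ w) (grid i) @[i --> \oo] --> (0 : R).
  rewrite -(cvg_shiftS (fun i => log_average (eta ^~ w) (grid i))).
  apply/cvgr0Pnorm_le => eps eps0.
  have eps2 : 0 < eps ^+ 2 by rewrite exprn_gt0.
  near=> i.
  have : h i w <= eps ^+ 2 by near: i; exact: (cvgr_le _ hs).
  rewrite /h -real_normK ?num_real// ler_sqr ?nnegrE ?normr_ge0 ?(ltW eps0)//.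
apply: log_average_grid => [n|]; first by case/andP: (xi01 n w).
apply: (@cvg_eq_from _ 0 (fun i => log_average (eta ^~ w) (grid i) + log_average e (grid i))).
  by move=> i _; rewrite (log_averageB (xi ^~ w)) subrK.
rewrite -[X in _ --> X]add0r; apply: cvgD => //.
apply: (@cvg_subseq (log_average e)); first by move=> i; exact: ltnW (grid_ge i).
exact: cvg_log_average.
Unshelve. all: by end_near. Qed.

End AlmostSureLogAverage.

(** * Covariance decay *)

Section Covariance.
Context {d : measure_display} {T : measurableType d} {R : realType}.
Context {P : probability T R}.
Variables (X : nat -> {RV P >-> R}) (F : cumulativeBounded (0 : R) (1 : R)).
Variables (a b : nat -> R).
Hypothesis iidX : iid_with_cdf X F.
Hypothesis EX : ('E_P[X 0%N] = 0)%E.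
Hypothesis EX2 : ('E_P[(fun w => (X 0%N w ^+ 2)%R)] = 1)%E.
Variables (I : finType) (x : I -> R) (kap : I -> nat) (y s0 : R).
Hypothesis s0_gt0 : 0 < s0.

Local Notation intg f := (P.-integrable setT (EFin \o f)).
Local Notation sigX K := (g_sigma_algebraType (cylinders X K)).
Local Notation lvl := (levels a b x).
Local Notation bel := (belowX X a b x kap).
Local Notation late m n := (iota m (n - m)).

Definition belowX1 n j s w : R :=
  below (fun=> kap j) (excess X (fun _ : unit => lvl n j) s [ffun=> 0%N] w).

(** If discarding the first [m] observations changes the event, some level [j] has fewer than
    [kap j] late exceedances while one of the early observations exceeds it. Early and late parts
    appear as separate factors, which are independent. *)
Lemma belowX_late m n w : (m <= n)%N ->
  `|bel n (iota 0 n) w - bel n (late m n) w|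
  <= \sum_j \sum_(i < m) belowX1 n j (late m n) w * (lvl n j < X i w)%R%:R.
Proof.
move=> mn.
have r0 j : 0 <= \sum_(i < m) belowX1 n j (late m n) w * (lvl n j < X i w)%R%:R.
  by apply: sumr_ge0 => i _; rewrite /belowX1 /below mulr_ge0.
have split_count j : (count (fun i => (lvl n j < X i w)%R) (iota 0 n) =
    count (fun i => (lvl n j < X i w)%R) (iota 0 m) +
    count (fun i => (lvl n j < X i w)%R) (late m n))%N.
  by rewrite -count_cat -{2}[m]add0n -iotaD subnKC.
rewrite !belowXE; case: forallP => [h|/existsNP[j /negP]].
  rewrite (_ : [forall j, _] = true) ?subrr ?normr0 ?sumr_ge0//.
  by apply/forallP => j; apply: leq_ltn_trans (h j); rewrite split_count leq_addl.
rewrite -leqNgt => hj.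
case: forallP => [h|_]; last by rewrite subrr normr0 sumr_ge0.
rewrite sub0r normrN normr1 (bigD1 j)//=; apply: ler_wpDr; first exact: sumr_ge0.
have : has (fun i => (lvl n j < X i w)%R) (iota 0 m).
  rewrite has_count -(ltn_add2r (count (fun i => (lvl n j < X i w)%R) (late m n))).
  by rewrite add0n -split_count; exact: leq_trans (h j) hj.
move=> /hasP[i]; rewrite mem_iota/= add0n => im ui.
rewrite (bigD1 (Ordinal im))//= ui mulr1; apply: ler_wpDr.
  by apply: sumr_ge0 => k _; rewrite /belowX1 /below mulr_ge0.
rewrite /belowX1 /below (_ : [forall _, _] = true)//.
by apply/forallP => -[]; rewrite !ffunE add0n h.
Qed.

Lemma late_disjoint m n : [set i | (i < m)%N] `&` [set i | (m <= i < n)%N] = set0.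
Proof. by apply/seteqP; split => // i [/= im /andP[mi _]]; move: im; rewrite ltnNge mi. Qed.

Lemma late_sub m n : [set` late m n] `<=` [set i | (m <= i < n)%N].
Proof.
move=> i /=; rewrite mem_iota => /andP[mi]; rewrite mi/=.
have [mn|nm] := leqP m n; first by rewrite subnKC.
by move: (nm) => /ltnW; rewrite -subn_eq0 => /eqP ->; rewrite addn0 ltnNge mi.
Qed.

(** By independence each summand is a tail times the probability of few exceedances among [n - m]
    observations, to which [below_single_bound] applies whatever the level. *)
Lemma E_belowX_late m n : (m <= n)%N ->
  intg (fun w => \sum_j \sum_(i < m) belowX1 n j (late m n) w * (lvl n j < X i w)%R%:R) /\
  \int[P]_w (\sum_j \sum_(i < m) belowX1 n j (late m n) w * (lvl n j < X i w)%R%:R)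
  <= (\sum_j kap j)%:R * (m%:R / (n - m).+1%:R).
Proof.
move=> mn; have us := iota_uniq m (n - m).
have prod j i : (i < m)%N ->
    intg (fun w => belowX1 n j (late m n) w * (lvl n j < X i w)%R%:R) /\
    \int[P]_w (belowX1 n j (late m n) w * (lvl n j < X i w)%R%:R) <= (kap j)%:R / (n - m).+1%:R.
  move=> im.
  have [m1 i1 _] := excess_distr iidX (fun _ : unit => lvl n j) us (below (fun=> kap j)) [ffun=> 0%N].
  have m2 : measurable_fun [set: sigX [set i]] ((fun w => (lvl n j < X i w)%R%:R) : sigX [set i] -> R).
    by apply: (measurableT_comp (@meas_gt R (lvl n j))); exact: measurable_sigX.
  have [|i12 e12] := @sigX_indep_expectation _ _ _ _ X iidX.1 [set` late m n] [set i]
      (belowX1 n j (late m n)) (fun w => (lvl n j < X i w)%R%:R) _ m1 m2 i1 (intg_gt X i (lvl n j)).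
    apply/seteqP; split => // k [/= + kE]; rewrite kE mem_iota => /andP[mi _].
    by move: im; rewrite ltnNge mi.
  split=> //; rewrite e12 (E_gt iidX i (lvl n j)) mulrC.
  by have := below_single_bound iidX (lvl n j) (kap j) us; rewrite size_iota.
have ip j : intg (fun w => \sum_(i < m) belowX1 n j (late m n) w * (lvl n j < X i w)%R%:R).
  by apply: intg_sum => i; case: (prod j i (ltn_ord i)).
split; first by apply: intg_sum.
rewrite Esum// natr_sum mulr_suml; apply: ler_sum => j _.
rewrite Esum; last by move=> i; case: (prod j i (ltn_ord i)).
apply: (@le_trans _ _ (\sum_(i < m) (kap j)%:R / (n - m).+1%:R)).
  by apply: ler_sum => i _; case: (prod j i (ltn_ord i)).
by rewrite sumr_const card_ord -[leLHS]mulr_natl mulrCA.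
Qed.

Definition late_sum m n w : R := \sum_(i <- late m n) X i w.

Lemma partial_sum_late m n w : (m <= n)%N ->
  partial_sum X n w = partial_sum X m w + late_sum m n w.
Proof.
move=> mn; by rewrite /partial_sum /late_sum -!(big_mkord xpredT (fun i => X i w)) (big_cat_nat _ mn).
Qed.

Lemma measurable_late_sum m n :
  measurable_fun [set: sigX [set i | (m <= i < n)%N]]
    (late_sum m n : sigX [set i | (m <= i < n)%N] -> R).
Proof.
rewrite /late_sum; have := @late_sub m n; elim: (late m n) => [_|i s IH h].
  have -> : (fun w => \sum_(k <- [::]) X k w) = cst 0 by apply/funext => w; rewrite big_nil.
  exact: measurable_cst.
have -> : (fun w => \sum_(k <- i :: s) X k w) = fun w => X i w + \sum_(k <- s) X k w.
  by apply/funext => w; rewrite big_cons.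
apply: measurable_funD; last by apply: IH => k ks; apply: h; rewrite /= inE orbC [_ \in _]ks.
by apply: measurable_sigX; apply: h; rewrite /= mem_head.
Qed.

Definition smoothed n w : R := bel n (iota 0 n) w * heat y s0 (partial_sum X n w / Num.sqrt n%:R).

Definition late_smoothed m n w : R := bel n (late m n) w * heat y s0 (late_sum m n w / Num.sqrt n%:R).

Let measurable_heat_scaled d' (U : measurableType d') (z : U -> R) (q : R) :
  measurable_fun setT z -> measurable_fun setT (fun w => heat y s0 (z w / q)).
Proof.
move=> mz; apply: (measurableT_comp (f := heat y s0)).
  by apply: continuous_measurable_fun; exact: continuous_heat.
by apply: measurable_funM => //; exact: measurable_cst.
Qed.

Lemma measurable_smoothed n K : (forall i, (i < n)%N -> K i) ->
  measurable_fun [set: sigX K] (smoothed n : sigX K -> R).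
Proof.
move=> nK; apply: measurable_funM.
  have [+ _ _] := excess_distr iidX (lvl n) (iota_uniq 0 n) (below kap) [ffun=> 0%N].
  by apply: measurable_sigX_sub => i /=; rewrite mem_iota/= add0n; exact: nK.
by apply: measurable_heat_scaled; exact: measurable_partial_sum.
Qed.

Lemma measurable_late_smoothed m n :
  measurable_fun [set: sigX [set i | (m <= i < n)%N]]
    (late_smoothed m n : sigX [set i | (m <= i < n)%N] -> R).
Proof.
apply: measurable_funM.
  have [+ _ _] := excess_distr iidX (lvl n) (iota_uniq m (n - m)) (below kap) [ffun=> 0%N].
  by apply: measurable_sigX_sub; exact: late_sub.
by apply: measurable_heat_scaled; exact: measurable_late_sum.
Qed.

Lemma smoothed_ge0_le1 n w : 0 <= smoothed n w <= 1.
Proof.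
by rewrite mulr_ge0 ?mulr_ile1 ?belowX_ge0 ?belowX_le1 ?heat_ge0 ?heat_le1.
Qed.

Lemma late_smoothed_ge0_le1 m n w : 0 <= late_smoothed m n w <= 1.
Proof.
by rewrite mulr_ge0 ?mulr_ile1 ?belowX_ge0 ?belowX_le1 ?heat_ge0 ?heat_le1.
Qed.

Let norm01 (t : R) : 0 <= t <= 1 -> `|t| <= 1.
Proof. by case/andP => t0 t1; rewrite ger0_norm. Qed.

Let mul01 (u v : R) : 0 <= u <= 1 -> 0 <= v <= 1 -> 0 <= u * v <= 1.
Proof. by move=> /andP[u0 u1] /andP[v0 v1]; rewrite mulr_ge0 ?mulr_ile1. Qed.

Let dist01 (u v : R) : 0 <= u <= 1 -> 0 <= v <= 1 -> `|u - v| <= 1.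
Proof. by move=> /andP[u0 u1] /andP[v0 v1]; rewrite ler_norml; apply/andP; split; lra. Qed.

Lemma intg_smoothed n : intg (smoothed n).
Proof.
apply: (@intg_bnd _ _ _ P _ 1); last by move=> w; exact/norm01/smoothed_ge0_le1.
by apply: (@measurable_sigXT _ _ _ _ X setT); exact: measurable_smoothed.
Qed.

Lemma intg_late_smoothed m n : intg (late_smoothed m n).
Proof.
apply: (@intg_bnd _ _ _ P _ 1); last by move=> w; exact/norm01/late_smoothed_ge0_le1.
by apply: measurable_sigXT; exact: measurable_late_smoothed.
Qed.

Lemma smoothed_late m n w : (0 < m)%N -> (m <= n)%N ->
  `|smoothed n w - late_smoothed m n w| <=
  \sum_j \sum_(i < m) belowX1 n j (late m n) w * (lvl n j < X i w)%R%:R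
  + ((Num.sqrt s0)^-1 * (Num.sqrt n%:R)^-1) * `|partial_sum X m w|.
Proof.
move=> m0 mn; have n0 : 0 < Num.sqrt n%:R :> R by rewrite sqrtr_gt0 ltr0n (leq_trans m0).
rewrite /smoothed /late_smoothed.
set f := bel _ _ _; set g := bel _ _ _; set h := heat _ _ _; set h' := heat _ _ _.
have -> : f * h - g * h' = (f - g) * h + g * (h - h') by ring.
apply: le_trans (ler_normD _ _) _; apply: lerD.
  rewrite normrM -[leRHS]mulr1; apply: ler_pM => //; first exact: belowX_late.
  by rewrite ger0_norm ?heat_ge0 ?heat_le1.
rewrite normrM; apply: (@le_trans _ _ `|h - h'|).
  by rewrite ler_piMl// ger0_norm ?belowX_ge0 ?belowX_le1.
apply: le_trans (heat_lipschitz _ _ _ s0_gt0) _.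
rewrite -mulrA ler_wpM2l ?invr_ge0 ?sqrtr_ge0// -mulrBl (partial_sum_late w mn) addrK.
by rewrite normrM [leRHS]mulrC normfV (gtr0_norm n0).
Qed.

(** Since [2 * m <= n], the denominator [n - m + 1] is at least [n / 2], and [m / n <= 1] is at most
    its square root. The shift of the sum contributes the mean of [|S_m|] over the square root of
    [n], of the same order. *)
Lemma E_smoothed_late m n : (0 < m)%N -> (m.*2 <= n)%N ->
  \int[P]_w `|smoothed n w - late_smoothed m n w| <=
  (2 * (\sum_j kap j)%:R + (Num.sqrt s0)^-1) * Num.sqrt (m%:R / n%:R).
Proof.
move=> m0 m2n.
have mn : (m <= n)%N by apply: leq_trans m2n; rewrite -addnn leq_addr.
have n0 : (0 < n)%N by exact: leq_trans mn.
have [i1 e1] := E_belowX_late mn.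
have i2 := intgZ ((Num.sqrt s0)^-1 * (Num.sqrt (n%:R : R))^-1) (intg_norm (intg_partial_sum iidX EX2 m)).
have id := intgB (intg_smoothed n) (intg_late_smoothed m n).
apply: le_trans (Ele (intg_norm id) (intgD i1 i2) _) _ => [w|]; first exact: smoothed_late.
rewrite (ED i1 i2) EZ; last exact: intg_norm (intg_partial_sum iidX EX2 m).
have n0R : 0 < n%:R :> R by rewrite ltr0n.
have q1 : m%:R / n%:R <= 1 :> R by rewrite ler_pdivrMr// mul1r ler_nat.
have q0 : 0 <= m%:R / n%:R :> R by rewrite divr_ge0.
rewrite mulrDl; apply: lerD.
  apply: le_trans e1 _; rewrite [leRHS]mulrAC [leRHS]mulrC; apply: ler_wpM2l => //.
  apply: (@le_trans _ _ (2 * (m%:R / n%:R))); last first.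
    apply: ler_wpM2l => //; rewrite -[leLHS]sqr_sqrtr// expr2 ler_piMl ?sqrtr_ge0//.
    by rewrite -[leRHS]sqrtr1 ler_wsqrtr.
  rewrite mulrCA; apply: ler_wpM2l => //.
  rewrite ler_pdivlMr// mulrC ler_pdivrMr// -natrM ler_nat mul2n.
  by lia.
rewrite -mulrA; apply: ler_wpM2l; first by rewrite invr_ge0 sqrtr_ge0.
rewrite sqrtrM// sqrtrV// [leRHS]mulrC; apply: ler_wpM2l; first by rewrite invr_ge0 sqrtr_ge0.
exact: (E_norm_partial_sum iidX EX EX2 m).
Qed.

(** As [f] and [h] are uncorrelated, the covariance of [f] with [g] is that of [f] with [g - h]. *)
Lemma cov_approx (f g h : T -> R) : intg f -> intg g -> intg h ->
  (forall w, 0 <= f w <= 1) -> \int[P]_w (f w * h w) = \int[P]_w f w * \int[P]_w h w ->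
  `|\int[P]_w (f w * g w) - \int[P]_w f w * \int[P]_w g w| <= 2 * \int[P]_w `|g w - h w|.
Proof.
move=> If Ig Ih f01 fh.
have fb w : `|f w| <= 1 by exact: norm01.
have mf := intg_meas If.
have igh := intgB Ig Ih; have ia := intg_norm igh.
have ifg := intg_bndM mf fb Ig; have ifh := intg_bndM mf fb Ih; have ip := intg_bndM mf fb igh.
have -> : \int[P]_w (f w * g w) - \int[P]_w f w * \int[P]_w g w
  = \int[P]_w (f w * (g w - h w)) - \int[P]_w f w * \int[P]_w (g w - h w).
  rewrite (EB Ig Ih) mulrBr -fh.
  under [in RHS]eq_Rintegral => w _ do rewrite mulrBr.
  rewrite (EB ifg ifh); ring.
have Ef : `|\int[P]_w f w| <= 1 by rewrite -[leRHS](Ecst P); apply: Ele_norm => //; exact: intg_cst.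
rewrite mulr_natl mulr2n; apply: le_trans (ler_normB _ _) _; apply: lerD.
  by apply: Ele_norm => // w; rewrite normrM ler_piMl.
rewrite normrM; apply: (@le_trans _ _ (1 * `|\int[P]_w (g w - h w)|)).
  exact: ler_wpM2r.
by rewrite mul1r; apply: Ele_norm.
Qed.

Let half_le_sqrt_ratio m n : (0 < n)%N -> (n < m.*2)%N ->
  2^-1 <= Num.sqrt (m%:R / n%:R) :> R.
Proof.
move=> n0 n2m; rewrite -[leLHS]gtr0_norm// -sqrtr_sqr ler_wsqrtr// ler_pdivlMr ?ltr0n//.
have : n%:R <= 2 * m%:R :> R by rewrite -natrM ler_nat mul2n ltnW.
have : 0 <= n%:R :> R by []; lra.
Qed.

Lemma cov_smoothed m n : (0 < m)%N -> (m < n)%N ->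
  `|\int[P]_w (smoothed m w * smoothed n w)
    - \int[P]_w smoothed m w * \int[P]_w smoothed n w|
  <= (2 * (2 * (\sum_j kap j)%:R + (Num.sqrt s0)^-1) + 2) * Num.sqrt (m%:R / n%:R).
Proof.
move=> m0 mn; set K := 2 * (\sum_j _)%:R + _.
have K0 : 0 <= K by rewrite addr_ge0 ?mulr_ge0 ?invr_ge0 ?sqrtr_ge0.
have n0R : 0 < n%:R :> R by rewrite ltr0n (leq_ltn_trans _ mn).
have q0 : 0 <= m%:R / n%:R :> R by rewrite divr_ge0.
have E01 f : intg f -> (forall w, 0 <= f w <= 1) -> 0 <= \int[P]_w f w <= 1.
  move=> If f01; rewrite Rintegral_ge0; last by move=> w _; case/andP: (f01 w).
  rewrite -[X in _ <= X](Ecst P); apply: Ele => //; first exact: intg_cst.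
  by move=> w; case/andP: (f01 w).
have im := intg_smoothed m; have inn := intg_smoothed n.
have imn : intg (fun w => smoothed m w * smoothed n w).
  apply: (@intg_bndM _ _ _ P _ _ 1) => //; first exact: intg_meas im.
  by move=> w; exact/norm01/smoothed_ge0_le1.
have em := E01 _ im (smoothed_ge0_le1 m); have en := E01 _ inn (smoothed_ge0_le1 n).
(* For [n < 2 * m] the covariance is at most [1 <= 2 * sqrt (m / n)], which accounts for the final
   [+ 2] of the constant. *)
have [m2n|n2m] := leqP m.*2 n; last first.
  have emn : 0 <= \int[P]_w (smoothed m w * smoothed n w) <= 1.
    by apply: (E01 _ imn) => w; exact: (mul01 (smoothed_ge0_le1 m w) (smoothed_ge0_le1 n w)).
  apply: (@le_trans _ _ 1); first exact: (dist01 emn (mul01 em en)).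
  apply: (@le_trans _ _ (2 * Num.sqrt (m%:R / n%:R))).
    by rewrite mulrC -ler_pdivrMr// mul1r half_le_sqrt_ratio// (leq_ltn_trans _ mn).
  by apply: ler_wpM2r; rewrite ?sqrtr_ge0// lerDr mulr_ge0.
have il := intg_late_smoothed m n.
have [||iml eml] := @sigX_indep_expectation _ _ _ _ X iidX.1 _ _ (smoothed m) (late_smoothed m n)
    (late_disjoint m n) _ _ im il.
- exact: measurable_smoothed.
- exact: measurable_late_smoothed.
have := cov_approx im inn il (smoothed_ge0_le1 m) eml.
move=> h; apply: le_trans h _; apply: le_trans (ler_wpM2l _ (E_smoothed_late m0 m2n)) _ => //.
by rewrite mulrA [leRHS]mulrDl lerDl mulr_ge0 ?sqrtr_ge0.
Qed.

End Covariance.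

(** * Almost sure limits *)

Section Sandwich.
Context {R : realType}.
Implicit Types (u : nat -> R) (y z delta sigma l : R).

Lemma std_normal_cdf_mono : {homo @std_normal_cdf R : y z / y <= z}.
Proof.
move=> y z yz; apply: fine_le; rewrite ?fin_num_measure//.
apply: le_measure; rewrite ?inE//= => t /=; rewrite !in_itv/= => ty; exact: le_trans yz.
Qed.

Lemma log_average_sandwich u (lo up : nat -> nat -> R) (llo lup : nat -> R) l :
  (forall j n, (0 < n)%N -> lo j n <= u n <= up j n) ->
  (forall j, log_average (lo j) N @[N --> \oo] --> llo j) ->
  (forall j, log_average (up j) N @[N --> \oo] --> lup j) ->
  llo j @[j --> \oo] --> l -> lup j @[j --> \oo] --> l ->
  log_average u N @[N --> \oo] --> l.
Proof.
move=> lou clo cup /cvgrPdist_lt hlo /cvgrPdist_lt hup; apply/cvgrPdist_le => e e0.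
have e2 : 0 < e / 2 by rewrite divr_gt0.
have [j [j1 j2]] : exists j, `|l - llo j| < e / 2 /\ `|l - lup j| < e / 2.
  have [N _ HN] := hlo _ e2; have [N' _ HN'] := hup _ e2.
  exists (maxn N N'); split; [apply: HN|apply: HN'] => /=; rewrite ?leq_maxl ?leq_maxr//.
have /cvgrPdist_lt/(_ _ e2) c1 := clo j; have /cvgrPdist_lt/(_ _ e2) c2 := cup j.
near=> N.
have : `|llo j - log_average (lo j) N| < e / 2 by near: N.
have : `|lup j - log_average (up j) N| < e / 2 by near: N.
have : log_average (lo j) N <= log_average u N.
  by apply: le_log_average => n /(lou j) /andP[].
have : log_average u N <= log_average (up j) N.
  by apply: le_log_average => n /(lou j) /andP[].
move: j1 j2; rewrite !ltr_norml => /andP[? ?] /andP[? ?] h1 h2 /andP[? ?] /andP[? ?].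
rewrite ler_norml; apply/andP; split; lra.
Unshelve. all: by end_near. Qed.

(** For [z <= y] the shift by [delta] keeps the smoothed value at least [Phi (delta / sigma)], so
    the deficit from 1 is a normal tail. *)
Lemma indic_le_heat y z delta sigma : 0 < sigma ->
  (z <= y)%R%:R <= heat (y + delta) (sigma ^+ 2) z + (1 - std_normal_cdf (delta / sigma)).
Proof.
move=> s0; rewrite /heat sqrtr_sqr gtr0_norm//.
case: (leP z y) => zy; last by rewrite addr_ge0 ?std_normal_cdf_ge0// subr_ge0 std_normal_cdf_le1.
rewrite addrC -addrA lerDl addrC subr_ge0; apply: std_normal_cdf_mono.
by rewrite ler_pM2r ?invr_gt0// addrAC lerDr subr_ge0.
Qed.

Lemma heat_le_indic y z delta sigma : 0 < sigma ->
  heat (y - delta) (sigma ^+ 2) z - std_normal_cdf (- delta / sigma) <= (z <= y)%R%:R.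
Proof.
move=> s0; rewrite /heat sqrtr_sqr gtr0_norm// lerBlDr.
case: (leP z y) => zy; first by apply: ler_wpDr; [exact: std_normal_cdf_ge0|exact: std_normal_cdf_le1].
rewrite add0r; apply: std_normal_cdf_mono.
by rewrite ler_pM2r ?invr_gt0// addrAC gerDr subr_le0 ltW.
Qed.

Definition smoothing j : R := j.+1%:R ^- 2.

Local Notation sig := smoothing.

Lemma smoothing_gt0 j : 0 < sig j. Proof. by rewrite invr_gt0 exprn_gt0. Qed.

Let cvg_inv : (n.+1%:R : R)^-1 @[n --> \oo] --> (0 : R).
Proof. exact: cvg_harmonic. Qed.

Let cvg_sig : sig n @[n --> \oo] --> (0 : R).
Proof.
under eq_fun => n do rewrite /smoothing -exprVn expr2.
by rewrite -(mulr0 (0 : R)); apply: cvgM; exact: cvg_inv.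
Qed.

(** The smoothing variance adds to the unit variance of the Gaussian limit; it and the shift both
    disappear as [j] grows. *)
Lemma cvg_heat_limit y (c : R) :
  heat (y + c * (j.+1%:R)^-1) (sig j ^+ 2 + 1) 0 @[j --> \oo] --> std_normal_cdf y.
Proof.
suff h : (y + c * (j.+1%:R)^-1 - 0) / Num.sqrt (sig j ^+ 2 + 1) @[j --> \oo] --> y.
  by apply: (cvg_comp _ _ h); exact: continuous_std_normal_cdf.
rewrite -[X in _ --> X]mulr1 -[X in _ * X]invr1 -[X in X^-1]sqrtr1.
apply: cvgM.
  rewrite -[X in _ --> X]subr0; apply: cvgB; last exact: cvg_cst.
  rewrite -[X in _ --> X]addr0; apply: cvgD; first exact: cvg_cst.
  by rewrite -(mulr0 c); apply: cvgMl_tmp; exact: cvg_inv.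
apply: cvgV; first by rewrite sqrtr1 oner_neq0.
suff h : sig j ^+ 2 + 1 @[j --> \oo] --> (1 : R).
  by apply: (cvg_comp _ _ h); exact: sqrt_continuous.
rewrite -[X in _ --> X]add0r; apply: cvgD; last exact: cvg_cst.
under eq_fun => n do rewrite expr2.
by rewrite -(mulr0 (0 : R)); apply: cvgM; exact: cvg_sig.
Qed.

Lemma cvg_cdf_tail_up : 1 - @std_normal_cdf R (n.+1%:R) @[n --> \oo] --> (0 : R).
Proof.
rewrite -(subrr (1 : R)); apply: cvgB; first exact: cvg_cst.
apply: (@cvg_comp _ _ _ (fun n => n.+1%:R : R) (@std_normal_cdf R) _ _ _ _ (@cvg_std_normal_cdf_pinfty R)).
by apply/cvgryPge => A; near=> n; apply: (@le_trans _ _ n%:R); [near: n; exact: nbhs_infty_ger|rewrite ler_nat].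
Unshelve. all: by end_near. Qed.

Lemma cvg_cdf_tail_down : @std_normal_cdf R (- n.+1%:R) @[n --> \oo] --> (0 : R).
Proof.
apply: (@cvg_comp _ _ _ (fun n => - n.+1%:R : R) (@std_normal_cdf R) _ _ _ _ (@cvg_std_normal_cdf_ninfty R)).
apply/cvgrNyPle => A; near=> n; rewrite lerNl; apply: (@le_trans _ _ n%:R); last by rewrite ler_nat.
by near: n; exact: nbhs_infty_ger.
Unshelve. all: by end_near. Qed.

(* Smoothing at scale [sigma = (j.+1)^-2] with shift [delta = (j.+1)^-1]: the error
   terms are the normal tails at [delta / sigma = j.+1]. *)
Lemma log_average_unsmooth (f z : nat -> R) (H y : R) : (forall n, 0 <= f n <= 1) ->
  (forall j, log_average (fun n => f n * heat (y + (j.+1%:R)^-1) (sig j ^+ 2) (z n)) N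
     @[N --> \oo] --> H * heat (y + (j.+1%:R)^-1) (sig j ^+ 2 + 1) 0) ->
  (forall j, log_average (fun n => f n * heat (y - (j.+1%:R)^-1) (sig j ^+ 2) (z n)) N
     @[N --> \oo] --> H * heat (y - (j.+1%:R)^-1) (sig j ^+ 2 + 1) 0) ->
  log_average (fun n => f n * (z n <= y)%R%:R) N @[N --> \oo] --> H * std_normal_cdf y.
Proof.
move=> f01 cup clo.
have ds j : (j.+1%:R)^-1 / sig j = j.+1%:R :> R.
  by rewrite /smoothing invrK expr2 mulKf.
pose eup j : R := 1 - std_normal_cdf (j.+1%:R); pose elo j : R := std_normal_cdf (- j.+1%:R).
apply: (@log_average_sandwich _
   (fun j n => f n * heat (y - (j.+1%:R)^-1) (sig j ^+ 2) (z n) - elo j)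
   (fun j n => f n * heat (y + (j.+1%:R)^-1) (sig j ^+ 2) (z n) + eup j)
   (fun j => H * heat (y - (j.+1%:R)^-1) (sig j ^+ 2 + 1) 0 - elo j)
   (fun j => H * heat (y + (j.+1%:R)^-1) (sig j ^+ 2 + 1) 0 + eup j)).
- move=> j n _; have /andP[fn0 fn1] := f01 n; apply/andP; split.
    have := heat_le_indic y (z n) (j.+1%:R)^-1 (smoothing_gt0 j); rewrite mulNr ds -/(elo j) => h.
    have := ler_wpM2l fn0 h; rewrite mulrBr; apply: le_trans; rewrite lerD2l lerN2.
    by rewrite ler_piMl// std_normal_cdf_ge0.
  have := indic_le_heat y (z n) (j.+1%:R)^-1 (smoothing_gt0 j); rewrite ds -/(eup j) => h.
  have := ler_wpM2l fn0 h; rewrite mulrDr => /le_trans; apply; rewrite lerD2l.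
  by rewrite ler_piMl// subr_ge0 std_normal_cdf_le1.
- move=> j; apply: (@cvg_eq_from _ 0 (fun N =>
    log_average (fun n => f n * heat (y - (j.+1%:R)^-1) (sig j ^+ 2) (z n)) N
      - log_average (fun=> elo j) N)); last by apply: cvgB => //; exact: cvg_log_average_cst.
  by move=> N _; exact/esym/log_averageB.
- move=> j; apply: (@cvg_eq_from _ 0 (fun N =>
    log_average (fun n => f n * heat (y + (j.+1%:R)^-1) (sig j ^+ 2) (z n)) N
      + log_average (fun=> eup j) N)); last by apply: cvgD => //; exact: cvg_log_average_cst.
  by move=> N _; exact/esym/log_averageD.
- rewrite -[X in _ --> X]subr0; apply: cvgB; last exact: cvg_cdf_tail_down.
  apply: cvgMl_tmp; have := @cvg_heat_limit y (-1).
  by under eq_fun => j do rewrite mulN1r.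
- rewrite -[X in _ --> X]addr0; apply: cvgD; last exact: cvg_cdf_tail_up.
  apply: cvgMl_tmp; have := @cvg_heat_limit y 1.
  by under eq_fun => j do rewrite mul1r.
Qed.

End Sandwich.

(** * Order statistics as exceedance counts *)

Section OrderStatistics.
Context {d : measure_display} {T : measurableType d} {R : realType}.
Context {P : probability T R}.
Variables (X : nat -> {RV P >-> R}) (a b : nat -> R).

(** In a decreasing list the entries above [z] form a prefix. The condition on the default [x0]
    covers positions past the end, that is, samples shorter than the rank. *)
Lemma nth_sorted_le (disp : Order.disp_t) (S : orderType disp) (x0 z : S) (s : seq S) k :
  (x0 <= z)%O -> sorted >=%O s ->
  (nth x0 s k <= z)%O = (count (fun t => z < t)%O s <= k)%N.
Proof.
move=> x0z; elim: s k => [|t s IH] k /=; first by rewrite nth_nil x0z.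
move=> pts; have ss := path_sorted pts.
have count0 : (t <= z)%O -> count (fun t => z < t)%O s = 0%N.
  move=> tz; apply/eqP; rewrite -leqn0 leqNgt -has_count; apply/hasPn => t' ts.
  rewrite -leNgt; apply: le_trans tz.
  by have /allP/(_ _ ts) := order_path_min ge_trans pts.
case: k => [|k] /=; case: (leP t z) => tz; rewrite ?(count0 tz) ?add0n//.
- by rewrite IH// count0.
- by rewrite IH.
Qed.

Lemma order_max_le n j w (u : R) : (0 < j)%N ->
  (order_max X n j w <= u%:E)%E = (count (fun i => (u < X i w)%R) (iota 0 n) < j)%N.
Proof.
move=> j0; rewrite /order_max nth_sorted_le ?leNye//; last first.
  by apply: sort_sorted; exact: ge_total.
rewrite (permP (permEl (perm_sort _ _))) count_map.
rewrite (eq_count (a2 := fun i => (u < X i w)%R)); last by move=> i /=; rewrite lte_fin.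
by rewrite -ltnS prednK.
Qed.

Lemma normalize_order_max_le n j w x : (0 < j)%N -> 0 < a n ->
  (normalize a b n (order_max X n j w) <= x%:E)%E =
  (count (fun i => (level a b n x < X i w)%R) (iota 0 n) < j)%N.
Proof. by move=> j0 an; rewrite normalize_le// order_max_le. Qed.

End OrderStatistics.

Section AlmostSureLimit.
Context {d : measure_display} {T : measurableType d} {R : realType}.
Context {P : probability T R}.
Variables (X : nat -> {RV P >-> R}) (F G : cumulativeBounded (0 : R) (1 : R)).
Variables (a b : nat -> R).
Hypothesis iidX : iid_with_cdf X F.
Hypothesis EX : ('E_P[X 0%N] = 0)%E.
Hypothesis EX2 : ('E_P[(fun w => (X 0%N w ^+ 2)%R)] = 1)%E.
Hypothesis a_gt0 : forall n, (1 <= n)%N -> 0 < a n.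
Hypothesis cvgMax : forall x : R,
  P [set w | (normalize a b n (sample_max X n w) <= x%:E)%E] @[n --> \oo] --> (G x)%:E.
Variables (I : finType) (x : I -> R) (kap : I -> nat) (H : R).
Hypothesis cvgH : \int[P]_w belowX X a b x kap n (iota 0 n) w @[n --> \oo] --> H.

Lemma ae_log_average_smoothed y s0 : 0 < s0 ->
  {ae P, forall w, log_average (fun n => belowX X a b x kap n (iota 0 n) w *
      heat y s0 (partial_sum X n w / Num.sqrt n%:R)) N @[N --> \oo] --> H * heat y (s0 + 1) 0}.
Proof.
move=> s00.
apply: (@ae_log_average _ _ _ P (smoothed X a b x kap y s0)
  (2 * (2 * (\sum_j kap j)%:R + (Num.sqrt s0)^-1) + 2)).
- by rewrite addr_ge0 ?mulr_ge0 ?addr_ge0 ?mulr_ge0 ?invr_ge0 ?sqrtr_ge0.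
- by move=> n; exact: intg_meas (intg_smoothed a b iidX x kap y s0 n).
- by move=> n w; exact: smoothed_ge0_le1.
- by move=> m n; exact: (cov_smoothed a b iidX EX EX2 x kap y s00).
- exact: (@cvg_joint_heat _ _ _ _ _ _ _ _ _ iidX EX EX2 a_gt0 (@cvgMax) _ _ _ y _ s00 H (@cvgH)).
Qed.

Lemma ae_log_average_joint y :
  {ae P, forall w, log_average (fun n => belowX X a b x kap n (iota 0 n) w *
      (partial_sum X n w / Num.sqrt n%:R <= y)%R%:R) N @[N --> \oo] --> H * std_normal_cdf y}.
Proof.
(* Only countably many smoothings are used, so a single null set serves for all of them. *)
have up := ae_foralln (fun j => ae_log_average_smoothed (y + (j.+1%:R)^-1)
  (exprn_gt0 2 (smoothing_gt0 j))).
have lo := ae_foralln (fun j => ae_log_average_smoothed (y - (j.+1%:R)^-1)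
  (exprn_gt0 2 (smoothing_gt0 j))).
apply: filterS2 up lo => w up lo.
apply: log_average_unsmooth => //.
by move=> n; rewrite belowX_ge0 belowX_le1.
Qed.

End AlmostSureLimit.

Lemma log_average_eq {R : realType} (u v : nat -> R) :
  (forall n, (0 < n)%N -> u n = v n) -> forall N, log_average u N = log_average v N.
Proof.
move=> uv N; congr (_ * _); rewrite big_nat_cond [RHS]big_nat_cond.
by apply: eq_bigr => n /andP[/andP[n0 _] _]; rewrite uv.
Qed.

Section Joint.
Context {d : measure_display} {T : measurableType d} {R : realType}.
Context {P : probability T R}.
Variables (X : nat -> {RV P >-> R}) (a b : nat -> R).
Hypothesis a_gt0 : forall n, (1 <= n)%N -> 0 < a n.

Lemma belowX_order_max (I : finType) (x : I -> R) (kap : I -> nat) n w :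
  (0 < n)%N -> (forall j, (0 < kap j)%N) ->
  belowX X a b x kap n (iota 0 n) w =
  [forall j, (normalize a b n (order_max X n (kap j) w) <= (x j)%:E)%E]%:R.
Proof.
move=> n0 kap0; rewrite belowXE; congr (nat_of_bool _)%:R.
by apply: eq_forallb => j; rewrite normalize_order_max_le ?a_gt0.
Qed.

Lemma joint_cdfE (F : cumulativeBounded (0 : R) (1 : R)) (iidX : iid_with_cdf X F)
    k n (x : 'I_k -> R) : (0 < n)%N ->
  joint_cdf X a b n x = (\int[P]_w belowX X a b x (fun j : 'I_k => j.+1) n (iota 0 n) w)%:E.
Proof.
move=> n0; pose B := [set w | forall j : 'I_k,
  (normalize a b n (order_max X n j.+1 w) <= (x j)%:E)%E].
have E : belowX X a b x (fun j : 'I_k => j.+1) n (iota 0 n) = \1_B.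
  apply/funext => w; rewrite belowX_order_max// indicE; congr (nat_of_bool _)%:R.
  by apply/forallP/idP => [h|]; rewrite inE.
(* The event is recovered as the set where the already measurable function [belowX] equals 1. *)
have mB : measurable B.
  have mb := intg_meas (intg_belowX a b iidX x (fun j : 'I_k => j.+1) n (iota_uniq 0 n)).
  rewrite (_ : B = belowX X a b x (fun j : 'I_k => j.+1) n (iota 0 n) @^-1` [set 1]).
    by rewrite -[X in measurable X]setTI; exact: mb.
  rewrite E; apply/seteqP; split=> w /=; rewrite indicE; first by move=> Bw; rewrite mem_set.
  by case: (boolP (w \in B)) => [/set_mem//|_ /eqP]; rewrite eq_sym oner_eq0.
by rewrite E E_indic// /joint_cdf fineK// fin_num_measure.
Qed.

End Joint.

(* In the first limit, [ln 0 = 0] in the library, but the factor [G x] makes the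
   right-hand side 0 whenever [G x = 0], as intended; [0 ^+ 0 = 1]. *)
Theorem theorem3p1 (R : realType) (d : measure_display) (T : measurableType d)
    (P : probability T R) (X : nat -> {RV P >-> R})
    (F G : cumulativeBounded (0 : R) (1 : R)) (a b : nat -> R)
    (iidX : iid_with_cdf X F) (ndF : nondegenerate_df F)
    (EX : ('E_P[X 0%N] = 0)%E)
    (EX2 : ('E_P[(fun w => (X 0%N w ^+ 2)%R)] = 1)%E)
    (a_gt0 : forall n, (1 <= n)%N -> 0 < a n) (ndG : nondegenerate_df G)
    (cvgM : forall x : R,
      P [set w | (normalize a b n (sample_max X n w) <= x%:E)%E]
        @[n --> \oo] --> (G x)%:E)
    (k : nat) (k_ge1 : (1 <= k)%N) :
  (forall x y : R,
    {ae P, forall w,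
      log_average (fun n =>
        ((normalize a b n (order_max X n k w) <= x%:E)%E &&
         (partial_sum X n w / Num.sqrt n%:R <= y))%R%:R) N
      @[N --> \oo] -->
      G x * (\sum_(i < k) (- ln (G x)) ^+ i / (i`!)%:R) * std_normal_cdf y})
  /\
  (exists H : ('I_k -> R) -> R,
    (forall x : 'I_k -> R, joint_cdf X a b n x @[n --> \oo] --> (H x)%:E) /\
    (forall (x : 'I_k -> R) (y : R),
      {ae P, forall w,
        log_average (fun n =>
          ([forall j : 'I_k,
             (normalize a b n (order_max X n j.+1 w) <= (x j)%:E)%E] &&
           (partial_sum X n w / Num.sqrt n%:R <= y))%R%:R) N
        @[N --> \oo] --> H x * std_normal_cdf y})).
Proof.
(* The first limit is the case of one level, indexed by [unit], with rank [k]. *)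
pose one (x : R) := fun _ : unit => x.
split=> [x y|].
  have cvgH : \int[P]_w belowX X a b (one x) (fun=> k) n (iota 0 n) w @[n --> \oo]
      --> G x * \sum_(i < k) (- ln (G x)) ^+ i / i`!%:R.
    have [G0|] := eqVneq (G x) 0.
      by rewrite G0 mul0r; exact: (cvg_belowX_zero iidX a_gt0 (@cvgM) (x := one x) _ (j := tt)).
    move=> G0; have {}G0 : 0 < G x by rewrite lt0r G0 (limit_cdf_ge0 iidX a_gt0 (@cvgM)).
    exact: (@cvg_below_single _ _ _ _ _ _ _ _ _ iidX a_gt0 (@cvgM) x k G0).
  have := ae_log_average_joint iidX EX EX2 a_gt0 (@cvgM) (@cvgH) y.
  apply: filterS => w h; apply: (@cvg_eq_from _ 0 _ _ _ _ h) => N _; apply: log_average_eq => n n0.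
  rewrite belowX_order_max// -natrM mulnb; congr ((nat_of_bool (_ && _))%:R).
  by apply/forallP/idP => [/(_ tt)|hx []].
have exH (x : 'I_k -> R) : exists H : R,
    \int[P]_w belowX X a b x (fun j => j.+1) n (iota 0 n) w @[n --> \oo] --> H.
  (* Either all levels have a positive limit and the Poisson limit provides [H x], with [k >= 1]
     supplying a level, or some level forces [H x = 0]. *)
  have [Gx|/existsNP[j /negP]] := pselect (forall j, 0 < G (x j)).
    exact: (cvg_belowX_pos iidX a_gt0 (@cvgM) _ (Ordinal k_ge1) Gx).
  rewrite lt_neqAle (limit_cdf_ge0 iidX a_gt0 (@cvgM)) andbT negbK => /eqP/esym Gj.
  by exists 0; exact: (cvg_belowX_zero iidX a_gt0 (@cvgM) _ Gj).
have [H cvgH] := choice exH.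
exists H; split=> [x|x y].
  apply: (@cvg_trans _ (EFin (\int[P]_w belowX X a b x (fun j => j.+1) n (iota 0 n) w) @[n --> \oo])).
    by apply: near_eq_cvg; near=> n; rewrite (joint_cdfE _ _ iidX)//; near: n; exact: nbhs_infty_gt.
  by apply: cvg_EFin; [near=> n|exact: cvgH].
have := ae_log_average_joint iidX EX EX2 a_gt0 (@cvgM) (@cvgH x) y.
apply: filterS => w h; apply: (@cvg_eq_from _ 0 _ _ _ _ h) => N _; apply: log_average_eq => n n0.
by rewrite belowX_order_max// -natrM mulnb.
Unshelve. all: by end_near. Qed.
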